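(* Let $K$ be a number field, $E$ an elliptic curve over $K$ with Weierstrass equation $w_E(x,y)=0$, and $n\geq 2$ an integer. Let $u$ be a polynomial of degree $1$ in $x$ and $y$ with coefficients in $K$ such that $K[u,[-1]^*u]=K[x,y]$. Suppose that the action of $G_K$ on $E_n$ is transitive. Then: (1) The polynomial $\widetilde{\psi}_n$ if $n\neq 2$, respectively $\psi_2^2$ (viewed as a polynomial in $x$) if $n=2$, is irreducible over $K$ and its Galois group is isomorphic to $\overline{\rho_{E,n}}(G_K)$. (2) For $P\in E_n$, the characteristic polynomial of multiplication by $u(P)$ on the $K$-vector space $K(P)=K(x(P),y(P))$ is irreducible over $K$ and its Galois group is isomorphic to $\rho_{E,n}(G_K)$.
   Context: $\overline{K}$ is an algebraic closure of $K$, $G_K=\mathrm{Gal}(\overline{K}/K)$, and $\rho_{E,n}:G_K\to\mathrm{Aut}(E[n])\simeq\mathrm{GL}_2(\mathbb{Z}/n\mathbb{Z})$ is the Galois representation on the $n$-torsion of $E$. $\overline{\rho_{E,n}}=\pi_n\circ\rho_{E,n}$, where $\pi_n:\mathrm{GL}_2(\mathbb{Z}/n\mathbb{Z})\to\mathrm{GL}_2(\mathbb{Z}/n\mathbb{Z})/\{\pm\mathrm{id}\}$ is the canonical projection. $E_n$ is the set of points of $E(\overline{K})$ of exact order $n$. The Galois group of a polynomial over $K$ is that of its splitting field over $K$. $w_E(X,Y)=Y^2+a_1XY+a_3Y-X^3-a_2X^2-a_4X-a_6$ with $a_i\in K$; $K[x,y]=K[X,Y]/(w_E)$ is the affine coordinate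 ring. $[-1]^*u$ is the pull-back of $u$ by inversion on $E$ ($y$ is replaced by $-y-a_1x-a_3$). Let $(\psi_n)_{n\ge1}$ be the usual division polynomials of $E$ (with $\psi_1=1$, $\psi_2=2y+a_1x+a_3$, $\psi_n^2$ being a polynomial in $x$ with leading coefficient $n^2$ whose roots are the $x$-coordinates of the nonzero $n$-torsion points). The primitive division polynomials $\widetilde{\psi}_n$ are defined recursively by $\psi_n=\prod_{m\mid n}\widetilde{\psi}_m$; for $n\ne 2$, $\widetilde{\psi}_n\in K[X]$ is a polynomial in $x$ alone. *)

(* Defs.v *)
From HB Require Import structures.
From mathcomp Require Import all_boot all_order all_algebra all_fingroup all_field.
From mathcomp Require Import qpoly ring zify.
From mathcomp Require Import boolp classical_sets.

Set Implicit Arguments.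
Unset Strict Implicit.
Unset Printing Implicit Defensive.

Import GRing.Theory.
Local Open Scope ring_scope.

(* [u] is a polynomial in two variables x and y, where the variable of the
   inner polynomial ring is x and that of the outer one is y. *)
Definition eval_xy (K R : nzRingType) (f : K -> R) (u : {poly {poly K}})
    (x y : R) : R :=
  (map_poly (map_poly f) u).[y%:P].[x].

Record weierstrass (R : Type) :=
  Weierstrass { a1 : R; a2 : R; a3 : R; a4 : R; a6 : R }.

Definition map_weierstrass (R S : Type) (f : R -> S) (E : weierstrass R) :=
  Weierstrass (f (a1 E)) (f (a2 E)) (f (a3 E)) (f (a4 E)) (f (a6 E)).

Section Invariants.
Variables (R : comNzRingType) (E : weierstrass R).

Definition b2 : R := a1 E ^+ 2 + 4%:R * a2 E.
Definition b4 : R := 2%:R * a4 E + a1 E * a3 E.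
Definition b6 : R := a3 E ^+ 2 + 4%:R * a6 E.
Definition b8 : R :=
  a1 E ^+ 2 * a6 E + 4%:R * a2 E * a6 E - a1 E * a3 E * a4 E
  + a2 E * a3 E ^+ 2 - a4 E ^+ 2.
Definition discriminant : R :=
  - b2 ^+ 2 * b8 - 8%:R * b4 ^+ 3 - 27%:R * b6 ^+ 2 + 9%:R * b2 * b4 * b6.

Definition weq (x y : R) : R :=
  y ^+ 2 + a1 E * x * y + a3 E * y
  - x ^+ 3 - a2 E * x ^+ 2 - a4 E * x - a6 E.

End Invariants.

(* [None] is the point at infinity. *)
Definition ecpoint (F : Type) := option (F * F).

Definition map_point (F G : Type) (f : F -> G) : ecpoint F -> ecpoint G :=
  omap (fun P => (f P.1, f P.2)).

Section GroupLaw.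
Variables (F : fieldType) (E : weierstrass F).

Definition on_curve (P : ecpoint F) : bool :=
  if P is Some (x, y) then weq E x y == 0 else true.

Definition opp_point (P : ecpoint F) : ecpoint F :=
  if P is Some (x, y) then Some (x, - y - a1 E * x - a3 E) else None.

(* The point (x3, - y3 - a1 x3 - a3), where (x3, y3) is the third intersection
   of the curve with the line of slope [l] through (x1, y1) and a point of
   abscissa [x2]. *)
Definition chord_point (l x1 y1 x2 : F) : ecpoint F :=
  let x3 := l ^+ 2 + a1 E * l - a2 E - x1 - x2 in
  opp_point (Some (x3, l * (x3 - x1) + y1)).

Definition add_point (P Q : ecpoint F) : ecpoint F :=
  match P, Q with
  | None, _ => Q
  | _, None => P
  | Some (x1, y1), Some (x2, y2) =>
    if x1 == x2 then
      if y1 == - y2 - a1 E * x2 - a3 E then None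
      else chord_point
             ((3%:R * x1 ^+ 2 + 2%:R * a2 E * x1 + a4 E - a1 E * y1)
                / (2%:R * y1 + a1 E * x1 + a3 E)) x1 y1 x2
    else chord_point ((y2 - y1) / (x2 - x1)) x1 y1 x2
  end.

Definition mul_point (n : nat) (P : ecpoint F) : ecpoint F :=
  iter n (add_point P) None.

Definition in_torsion (n : nat) (P : ecpoint F) : bool :=
  on_curve P && (mul_point n P == None).

Definition exact_order (n : nat) (P : ecpoint F) : Prop :=
  in_torsion n P /\ forall m, (0 < m < n)%N -> mul_point m P <> None.

Definition torsion (n : nat) := {P : ecpoint F | in_torsion n P}.

Lemma on_curve_opp P : on_curve P -> on_curve (opp_point P).
Proof.
case: P => [[x y]|] //=; rewrite /weq => /eqP e; apply/eqP; rewrite -[RHS]e.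
by ring.
Qed.

Lemma on_curve_chord l x1 y1 x2 :
    weq E x1 y1 = 0 ->
    2%:R * l * y1 + a1 E * (y1 + l * x1) + a3 E * l
      - 3%:R * x1 ^+ 2 - 2%:R * a2 E * x1 - a4 E
      + (x2 - x1) * (l ^+ 2 + a1 E * l - a2 E - 3%:R * x1 - (x2 - x1)) = 0 ->
  on_curve (chord_point l x1 y1 x2).
Proof.
move=> e1 e2; apply: on_curve_opp; apply/eqP; set x3 := _ - x2.
rewrite -[RHS]e1 -[in RHS](addr0 (weq E x1 y1)) -[in RHS](mulr0 (x3 - x1)) -e2.
by rewrite /weq /x3; ring.
Qed.

Lemma on_curve_same_x x y1 y2 : weq E x y1 = 0 -> weq E x y2 = 0 ->
  y1 != - y2 - a1 E * x - a3 E ->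
  y1 = y2 /\ 2%:R * y1 + a1 E * x + a3 E != 0.
Proof.
move=> e1 e2 ne.
have ne0 : y1 - (- y2 - a1 E * x - a3 E) != 0 by rewrite subr_eq0.
have /eqP : (y1 - (- y2 - a1 E * x - a3 E)) * (y1 - y2) = 0.
  by rewrite -[RHS](subr0 0) -{1}e1 -e2 /weq; ring.
rewrite mulf_eq0 (negPf ne0) subr_eq0 /= => /eqP y12; split=> //.
by move: ne0; rewrite -y12; congr (_ != 0); ring.
Qed.

Lemma on_curve_add P Q : on_curve P -> on_curve Q -> on_curve (add_point P Q).
Proof.
case: P Q => [[x1 y1]|] [[x2 y2]|] //= /eqP e1 /eqP e2.
have [ex|nx] := eqVneq x1 x2.
  subst x2; have [//|ne] := eqVneq; have [_ nd] := on_curve_same_x e1 e2 ne.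
  by apply: on_curve_chord => //; field.
have nd : x2 - x1 != 0 by rewrite subr_eq0 eq_sym.
apply: on_curve_chord => //; apply: (mulfI nd); rewrite mulr0.
rewrite -[RHS](subr0 0) -{1}e2 -e1 /weq.
by field.
Qed.

Lemma opp_add_point P Q : on_curve P -> on_curve Q ->
  add_point (opp_point P) (opp_point Q) = opp_point (add_point P Q).
Proof.
case: P Q => [[x1 y1]|] [[x2 y2]|] //= /eqP e1 /eqP e2.
have [ex|nx] := eqVneq x1 x2.
  subst x2.
  have -> : (- y1 - a1 E * x1 - a3 E
              == - (- y2 - a1 E * x1 - a3 E) - a1 E * x1 - a3 E)
            = (y1 == - y2 - a1 E * x1 - a3 E).
    rewrite -subr_eq0 -[RHS]subr_eq0 -oppr_eq0; congr (_ == 0); ring.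
  have [//|ne] := eqVneq; have [_ nd] := on_curve_same_x e1 e2 ne.
  have nd' : 2%:R * (- y1 - a1 E * x1 - a3 E) + a1 E * x1 + a3 E != 0.
    by rewrite -oppr_eq0; move: nd; congr (_ != 0); ring.
  by rewrite /chord_point /=; congr (Some (_, _)); field; rewrite nd nd'.
have nd : x2 - x1 != 0 by rewrite subr_eq0 eq_sym.
by rewrite /chord_point /=; congr (Some (_, _)); field.
Qed.

Lemma on_curve_mul n P : on_curve P -> on_curve (mul_point n P).
Proof. by move=> cP; elim: n => //= n; apply: on_curve_add. Qed.

Lemma mul_opp_point n P : on_curve P ->
  mul_point n (opp_point P) = opp_point (mul_point n P).
Proof.
move=> cP; elim: n => //= n; rewrite /mul_point /= => ->.
by rewrite opp_add_point // on_curve_mul.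
Qed.

Lemma in_torsion_opp n P : in_torsion n P -> in_torsion n (opp_point P).
Proof.
by case/andP=> cP /eqP nP; rewrite /in_torsion on_curve_opp // mul_opp_point ?nP.
Qed.

Definition opp_torsion n (P : torsion n) : torsion n :=
  exist _ (opp_point (val P)) (in_torsion_opp (valP P)).

End GroupLaw.

Section BaseChange.
Variables (F G : fieldType) (f : {rmorphism F -> G}) (E : weierstrass F).
Local Notation fE := (map_weierstrass f E).

Lemma map_chord_point l x1 y1 x2 :
  map_point f (chord_point E l x1 y1 x2)
  = chord_point fE (f l) (f x1) (f y1) (f x2).
Proof.
by rewrite /chord_point /= !(rmorphXn, rmorphN, rmorphD, rmorphM).
Qed.

Lemma map_add_point P Q :
  map_point f (add_point E P Q) = add_point fE (map_point f P) (map_point f Q).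
Proof.
case: P Q => [[x1 y1]|] [[x2 y2]|] //=.
have -> : - f y2 - f (a1 E) * f x2 - f (a3 E) = f (- y2 - a1 E * x2 - a3 E).
  by rewrite !rmorphB rmorphN rmorphM.
rewrite !fmorph_eq; case: ifP => _; [case: ifP => _ //|];
  by rewrite map_chord_point
             !(rmorph_nat, rmorphXn, rmorphN, rmorphD, rmorphM, fmorphV).
Qed.

Lemma map_in_torsion n P : in_torsion fE n (map_point f P) = in_torsion E n P.
Proof.
congr (_ && _).
  case: P => [[x y]|] //=; rewrite -(fmorph_eq0 f); congr (_ == 0).
  by rewrite /weq !(rmorphXn, rmorphN, rmorphD, rmorphM).
have -> : mul_point fE n (map_point f P) = map_point f (mul_point E n P).
  by elim: n => //= n; rewrite /mul_point /= => ->; rewrite -map_add_point.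
by case: mul_point.
Qed.

End BaseChange.

Section AbsoluteGalois.
Variables (K : fieldType) (L : closedFieldType) (iota : {rmorphism K -> L}).

(* When [L] is algebraic over [K], this is the absolute Galois group of K. *)
Record abs_gal := AbsGal {
  gal_fun :> {rmorphism L -> L};
  gal_bij : bijective gal_fun;
  gal_fix : forall c, gal_fun (iota c) = iota c }.

Variables (E : weierstrass K) (n : nat).
Local Notation EL := (map_weierstrass iota E).

Lemma gal_in_torsion (s : abs_gal) (P : ecpoint L) :
  in_torsion EL n P -> in_torsion EL n (map_point s P).
Proof.
have {2}-> : EL = map_weierstrass s EL by rewrite /map_weierstrass /= !gal_fix.
by rewrite map_in_torsion.
Qed.

Definition rho (s : abs_gal) (P : torsion EL n) : torsion EL n :=
  exist _ (map_point s (val P)) (gal_in_torsion s (valP P)).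

Lemma rho_additive s (P Q R : torsion EL n) :
  add_point EL (val P) (val Q) = val R ->
  add_point EL (val (rho s P)) (val (rho s Q)) = val (rho s R).
Proof.
move=> /= <-; rewrite map_add_point; congr (add_point _ _ _).
by rewrite /map_weierstrass /= !gal_fix.
Qed.

(* The class of [rho s] modulo {id, - id}, as a coset. *)
Definition rho_bar (s : abs_gal) : set (torsion EL n -> torsion EL n) :=
  [set rho s; @opp_torsion L EL n \o rho s]%classic.

End AbsoluteGalois.

(* Products in ['Gal(E / F)] are diagrammatic, (s * t) x = t (s x) (see [galM]),
   hence so is composition here. *)
Definition comp_op (T : Type) (f g : T -> T) : T -> T := g \o f.

Definition coset_op (T : Type) (A B : set (T -> T)) : set (T -> T) :=
  [set comp_op f g | f in A & g in B]%classic.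

(* [H] is a set of elements of [U] which is a group for the law [op]. *)
Definition isog_to (gT : finGroupType) (G : {set gT}) (U : Type)
    (op : U -> U -> U) (H : set U) : Prop :=
  exists f : gT -> U,
    [/\ {in G &, forall s t, f (s * t)%g = op (f s) (f t)},
        {in G &, injective f}
      & (f @` [set s | s \in G] = H)%classic].

(* A splitting field is unique up to isomorphism. *)
Definition galois_group_isog (K : fieldType) (p : {poly K}) (U : Type)
    (op : U -> U -> U) (H : set U) : Prop :=
  forall S : splittingFieldType K,
    splittingFieldFor 1%VS (map_poly (in_alg S) p) {:S}%VS ->
  isog_to 'Gal({:S}%VS / 1%VS)%g op H.

Section CoordinateRing.
Variables (K : fieldType) (E : weierstrass K).

Definition weq_poly : {poly {poly K}} :=
  'X^2 + ((a1 E *: 'X + (a3 E)%:P) *: 'X)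
  - ('X^3 + a2 E *: 'X^2 + a4 E *: 'X + (a6 E)%:P)%:P.

Definition coord_ring := {poly %/ weq_poly}.

Definition degree_one (u : {poly {poly K}}) : Prop :=
  exists al be ga : K,
    (al, be) != (0, 0) /\ u = be%:P *: 'X + (al *: 'X + ga%:P)%:P.

(* The pull-back by inversion: y is replaced by - y - a1 x - a3. *)
Definition inv_pullback (u : {poly {poly K}}) : {poly {poly K}} :=
  u \Po (- 'X - (a1 E *: 'X + (a3 E)%:P)%:P).

Definition generates_coord_ring (u : {poly {poly K}}) : Prop :=
  forall g : coord_ring, exists G : {poly {poly K}},
    g = eval_xy (fun c => in_qpoly weq_poly c%:P%:P) G
          (in_qpoly weq_poly u) (in_qpoly weq_poly (inv_pullback u)).

End CoordinateRing.

(* Thus [coord_ring E] is indeed K[X, Y] / (w_E). *)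
Lemma mk_monic_weq_poly (K : fieldType) (E : weierstrass K) :
  mk_monic (weq_poly E) = weq_poly E.
Proof.
set B := a1 E *: 'X + (a3 E)%:P.
set C := 'X^3 + a2 E *: 'X^2 + a4 E *: 'X + (a6 E)%:P.
have lt2 : (size (B *: 'X - C%:P : {poly {poly K}})%R < 3)%N.
  rewrite (leq_ltn_trans (size_polyD _ _)) // size_polyN gtn_max.
  rewrite (leq_ltn_trans (size_scale_leq _ _)) ?size_polyX //.
  by rewrite (leq_ltn_trans (size_polyC_leq1 _)).
rewrite /mk_monic -/B -/C; set w := weq_poly E.
have -> : w = 'X^2 + (B *: 'X - C%:P) by rewrite /w /weq_poly -addrA.
by rewrite monicE size_polyDl ?lead_coefDl ?size_polyXn //= lead_coefXn eqxx.
Qed.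

Section DivisionPolynomials.
Variables (K : fieldType) (E : weierstrass K).

(* psi_2 ^ 2, psi_3 and psi_4 / psi_2, as polynomials in x. *)
Definition psi2_sq : {poly K} :=
  4%:R *: 'X^3 + b2 E *: 'X^2 + (2%:R * b4 E) *: 'X + (b6 E)%:P.
Definition psi3 : {poly K} :=
  3%:R *: 'X^4 + b2 E *: 'X^3 + (3%:R * b4 E) *: 'X^2 + (3%:R * b6 E) *: 'X
  + (b8 E)%:P.
Definition psi4_red : {poly K} :=
  2%:R *: 'X^6 + b2 E *: 'X^5 + (5%:R * b4 E) *: 'X^4 + (10%:R * b6 E) *: 'X^3
  + (10%:R * b8 E) *: 'X^2 + (b2 E * b8 E - b4 E * b6 E) *: 'X
  + (b4 E * b8 E - b6 E ^+ 2)%:P.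

(* [psi_red n] is the polynomial in x equal to psi_n if n is odd, and to
   psi_n / psi_2 if n is even; see [psi], [psi_odd] and [psi_even]. *)
Fixpoint psi_red_rec (fuel n : nat) : {poly K} :=
  if fuel is k.+1 then
    let p := psi_red_rec k in
    match n with
    | 0 => 0
    | 1 | 2 => 1
    | 3 => psi3
    | 4 => psi4_red
    | _ =>
      let m := n./2 in
      if odd n then
        p m.+2 * p m ^+ 3 * (if odd m then 1 else psi2_sq ^+ 2)
        - p m.-1 * p m.+1 ^+ 3 * (if odd m then psi2_sq ^+ 2 else 1)
      else
        p m * (p m.+2 * p m.-1 ^+ 2 - p m.-2 * p m.+1 ^+ 2)
    end
  else 0.
Definition psi_red (n : nat) : {poly K} := psi_red_rec n n.

Definition psi2 : {poly {poly K}} :=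
  2%:R *: 'X + (a1 E *: 'X + (a3 E)%:P)%:P.

Definition psi (n : nat) : coord_ring E :=
  in_qpoly (weq_poly E) ((psi_red n)%:P * (if odd n then 1 else psi2)).

(* The polynomials defined by psi_n = \prod_(m | n) prim_psi_m, up to the factor
   prim_psi_2 = psi_2: it occurs in psi_n exactly when n is even, so that
   psi_red n is the product of the prim_psi_m over the divisors m != 2 of n.
   Hence [prim_psi n] is the n-th primitive division polynomial for n != 2. *)
Fixpoint prim_psi_rec (fuel n : nat) : {poly K} :=
  if fuel is k.+1 then
    psi_red n %/
      \prod_(m <- divisors n | (m != 2) && (m < n)%N) prim_psi_rec k m
  else 1.
Definition prim_psi (n : nat) : {poly K} := prim_psi_rec n n.

End DivisionPolynomials.

Section DivisionPolynomialsTheory.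
Variables (K : fieldType) (E : weierstrass K).
Local Notation cl := (in_qpoly (weq_poly E)).

Lemma psi2_sqE : cl (psi2 E) ^+ 2 = cl (psi2_sq E)%:P.
Proof.
rewrite -rmorphXn /=; have -> : psi2 E ^+ 2 = (psi2_sq E)%:P + 4%:R * weq_poly E.
  rewrite /psi2 /psi2_sq /weq_poly /b2 /b4 /b6.
  rewrite -!mul_polyC !(rmorphD, rmorphM, rmorphXn, rmorph_nat) /=. ring.
have w0 : cl (weq_poly E) = 0.
  have mw : weq_poly E \is monic by rewrite -mk_monic_weq_poly monic_mk_monic.
  by apply/val_eqP; rewrite /= mk_monic_weq_poly Pdiv.RingMonic.rmodpp.
by rewrite in_qpolyD in_qpolyM w0 mulr0 addr0.
Qed.

Lemma psi_red_recE k n : (n <= k)%N -> psi_red_rec E k n = psi_red E n.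
Proof.
have H k1 : forall k2 n, (n <= k1)%N -> (n <= k2)%N ->
    psi_red_rec E k1 n = psi_red_rec E k2 n.
  elim: k1 => [|k1 IH] [|k2] [|[|[|[|[|n']]]]] //=; rewrite ?ltnS => h1 h2.
  have hh := half_leq; have odd2 := odd_double_half n'.
  by rewrite -!(IH k2) //; lia.
by move=> le; apply: H.
Qed.

Lemma psi_red_step n : (4 < n)%N -> psi_red E n =
  let p := psi_red E in let m := n./2 in
  if odd n then
    p m.+2 * p m ^+ 3 * (if odd m then 1 else psi2_sq E ^+ 2)
    - p m.-1 * p m.+1 ^+ 3 * (if odd m then psi2_sq E ^+ 2 else 1)
  else p m * (p m.+2 * p m.-1 ^+ 2 - p m.-2 * p m.+1 ^+ 2).
Proof.
have recS k : (4 < n)%N -> psi_red_rec E k.+1 n =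
    let p := psi_red_rec E k in let m := n./2 in
    if odd n then
      p m.+2 * p m ^+ 3 * (if odd m then 1 else psi2_sq E ^+ 2)
      - p m.-1 * p m.+1 ^+ 3 * (if odd m then psi2_sq E ^+ 2 else 1)
    else p m * (p m.+2 * p m.-1 ^+ 2 - p m.-2 * p m.+1 ^+ 2).
  by case: (n) => [|[|[|[|[|n']]]]].
move=> n4; rewrite -[LHS](psi_red_recE (leqnSn n)) recS //; cbv zeta.
by have := odd_double_half n; case: ifP => on en; rewrite !psi_red_recE //; lia.
Qed.

Lemma psi_red_odd m : (2 <= m)%N -> psi_red E m.*2.+1 =
   psi_red E m.+2 * psi_red E m ^+ 3 * (if odd m then 1 else psi2_sq E ^+ 2)
   - psi_red E m.-1 * psi_red E m.+1 ^+ 3 * (if odd m then psi2_sq E ^+ 2 else 1).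
Proof.
by move=> m2; rewrite psi_red_step ?oddS ?odd_double //=; [rewrite uphalf_double|lia].
Qed.

Lemma psi_red_even m : (3 <= m)%N -> psi_red E m.*2 =
   psi_red E m * (psi_red E m.+2 * psi_red E m.-1 ^+ 2
       - psi_red E m.-2 * psi_red E m.+1 ^+ 2).
Proof.
by move=> m3; rewrite psi_red_step ?odd_double ?doubleK //; lia.
Qed.

Lemma psi_odd m : (2 <= m)%N ->
  psi E m.*2.+1 = psi E m.+2 * psi E m ^+ 3 - psi E m.-1 * psi E m.+1 ^+ 3.
Proof.
move=> m2; rewrite /psi /= odd_double psi_red_odd //.
have -> : odd m.-1 = ~~ odd m by lia.
case: (odd m) => /=; rewrite ?mulr1 polyCB !polyCM ?polyC_exp;
  rewrite [LHS]raddfB /= !(in_qpolyM, rmorphXn) /= -?psi2_sqE;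
  move: (cl _) (cl _) (cl _) (cl _) (cl _) => t1 t2 t3 t4 t5; ring.
Qed.

Lemma psi_even m : (3 <= m)%N ->
  psi E m.*2 * cl (psi2 E)
  = psi E m * (psi E m.+2 * psi E m.-1 ^+ 2 - psi E m.-2 * psi E m.+1 ^+ 2).
Proof.
move=> m3; rewrite /psi /= odd_double psi_red_even //.
have -> : odd m.-1 = ~~ odd m by lia.
have -> : odd m.-2 = odd m by lia.
case: (odd m) => /=; rewrite ?mulr1 polyCM polyCB !polyCM ?polyC_exp;
  rewrite !in_qpolyM raddfB /= !(in_qpolyM, rmorphXn) /=;
  move: (cl _) (cl _) (cl _) (cl _) (cl _) (cl _) => t1 t2 t3 t4 t5 t6; ring.
Qed.

Lemma prim_psiE n : (0 < n)%N -> prim_psi E n =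
  psi_red E n %/ \prod_(m <- divisors n | (m != 2) && (m < n)%N) prim_psi E m.
Proof.
have H k1 : forall k2 m, (0 < m <= k1)%N -> (m <= k2)%N ->
    prim_psi_rec E k1 m = prim_psi_rec E k2 m.
  elim: k1 => [|k1 IH] [|k2] m /=; try lia.
  move=> h1 h2; congr (_ %/ _); rewrite big_seq_cond [RHS]big_seq_cond.
  apply: eq_bigr => d /and3P[]; rewrite -dvdn_divisors; last by lia.
  move=> /dvdn_gt0 dm _ ltdm; apply: IH; lia.
case: n => // n _; rewrite {1}/prim_psi /=; congr (_ %/ _).
rewrite big_seq_cond [RHS]big_seq_cond; apply: eq_bigr => d /and3P[].
by rewrite -dvdn_divisors // => /dvdn_gt0 dm _ ltdm; apply: H; lia.
Qed.

End DivisionPolynomialsTheory.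

Definition mul_charpoly (K : fieldType) (F : fieldExtType K) (z : F) : {poly K} :=
  char_poly (passmx.mxof (vbasis {:F}) (vbasis {:F}) (amull z)).

(* Main.v *)
(* The ideal class of a point of E in its coordinate ring determines the point, and
   classes multiply as points add: hence the group law. The formula
   x(kP) = x(P) - psi_{k+1} psi_{k-1} / psi_k^2 then shows that E[n] has n^2
   elements for all n, hence is free of rank 2 over Z/n, and that the roots of the
   polynomial of (1) are simple and are the abscissas of the points of E_n. It is
   irreducible by transitivity; an automorphism which fixes the abscissas is 1 or
   -1 at every point of E_n, and the sign is the same for all points.
   As to (2), the main point is that u is injective on E_n. If u(P) = u(Q), the
   chord through P and Q has its slope l in K, hence so is
   x(P) + x(Q) + x(P + Q) = l^2 + a1 l - a2. The leading terms of the division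
   polynomials show that the abscissas of the points of exact order m have mean
   -b2 / 12 for all m > 1; as G_K is transitive on E_m for m | n, averaging over
   conjugates gives l^2 + a1 l - a2 = -b2 / 4, that is (2 l + a1)^2 = 0. But then u
   and its pull-back by [-1] take the same values at all points of order 2, and do
   not generate K[x, y]. Hence an automorphism which fixes u(P) fixes P, so that
   K(u(P)) = K(P) and the characteristic polynomial is the minimal polynomial of
   u(P), with roots the u(Q) for Q in E_n. *)

Require Import Defs.
From HB Require Import structures.
From mathcomp Require Import all_boot all_order all_algebra all_fingroup all_field.
From mathcomp Require Import qpoly ring zify.
From mathcomp Require Import boolp classical_sets.

Set Implicit Arguments.
Unset Strict Implicit.
Unset Printing Implicit Defensive.

Import GRing.Theory.
Local Open Scope ring_scope.

(** The obstacle is that the division polynomials are known only through recurrences, while deducing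
    x(kP) from these divides by values psi_j(P) that vanish at torsion points, the very points of
    interest. Points without small vanishing multiples escape this, and there all relations
    psi_{m+n} psi_{m-n} = (x(nP) - x(mP)) psi_m^2 psi_n^2 with a given m + n are equivalent to the
    recurrence. Two consequences free of division are polynomial identities in x, so they hold
    everywhere, and they are strong enough to step over the zeros of psi_k. Simplicity of the roots
    of psi_n is a result of the count of E[n], not a means to it: the count uses a generic fibre of
    multiplication by n, where simple roots come from a Wronskian. The mean - b2 / 12 is that of the
    roots of psi_2^2 = 4 x^3 + b2 x^2 + ..., and the recurrences preserve it. The averages over
    conjugates run over the finite set of maps which G_K induces on the abscissas concerned. *)

(** * Ideals of the coordinate ring *)

(* [(p, q)] stands for the function p + q y on the affine curve. *)
Definition affine_ring (F : fieldType) (E : weierstrass F) :=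
  ({poly F} * {poly F})%type.
HB.instance Definition _ (F : fieldType) (E : weierstrass F) :=
  GRing.Zmodule.on (affine_ring E).

Section AffineRing.
Variables (F : fieldType) (E : weierstrass F).

Local Notation R := (affine_ring E).
Local Notation B := (a1 E *: 'X + (a3 E)%:P).
Local Notation C := ('X^3 + a2 E *: 'X^2 + a4 E *: 'X + (a6 E)%:P).

Definition ar_one : R := (1, 0).
(** Products are reduced by [y ^ 2 = C - B y]. *)
Definition ar_mul (f g : R) : R :=
  (f.1 * g.1 + f.2 * g.2 * C, f.1 * g.2 + f.2 * g.1 - f.2 * g.2 * B).

Lemma ar_mulA : associative ar_mul.
Proof. by move=> [p q] [r s] [t v]; congr (_, _) => /=; ring. Qed.
Lemma ar_mulC : commutative ar_mul.
Proof. by move=> [p q] [r s]; congr (_, _) => /=; ring. Qed.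
Lemma ar_mul1 : left_id ar_one ar_mul.
Proof. by move=> [p q]; congr (_, _) => /=; ring. Qed.
Lemma ar_mulDl : left_distributive ar_mul +%R.
Proof. by move=> [p q] [r s] [t v]; congr (_, _) => /=; ring. Qed.
Lemma ar_one_neq0 : ar_one != 0.
Proof. by rewrite xpair_eqE oner_eq0. Qed.
End AffineRing.

HB.instance Definition _ (F : fieldType) (E : weierstrass F) :=
  GRing.Zmodule_isComNzRing.Build (affine_ring E)
    (@ar_mulA F E) (@ar_mulC F E) (@ar_mul1 F E) (@ar_mulDl F E)
    (@ar_one_neq0 F E).

Section AffineRingTheory.
Variables (F : fieldType) (E : weierstrass F).
Local Notation R := (affine_ring E).
Local Notation B := (a1 E *: 'X + (a3 E)%:P).
Local Notation C := ('X^3 + a2 E *: 'X^2 + a4 E *: 'X + (a6 E)%:P).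

Definition ar_poly (p : {poly F}) : R := (p, 0).
Fact ar_poly_zmod : zmod_morphism ar_poly.
Proof. by move=> p q; congr (_, _); rewrite subr0. Qed.
Fact ar_poly_monoid : monoid_morphism ar_poly.
Proof. by split=> // p q; congr (_, _) => /=; ring. Qed.
HB.instance Definition _ := GRing.isZmodMorphism.Build {poly F} R ar_poly ar_poly_zmod.
HB.instance Definition _ :=
  GRing.isMonoidMorphism.Build {poly F} R ar_poly ar_poly_monoid.

Definition ar_cst (c : F) : R := ar_poly c%:P.
HB.instance Definition _ := GRing.RMorphism.copy ar_cst (ar_poly \o polyC).

Definition ar_x : R := ar_poly 'X.
Definition ar_y : R := (0, 1).

Lemma ar_weq : ar_y ^+ 2 + (ar_cst (a1 E) * ar_x + ar_cst (a3 E)) * ar_y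
  - (ar_x ^+ 3 + ar_cst (a2 E) * ar_x ^+ 2 + ar_cst (a4 E) * ar_x + ar_cst (a6 E)) = 0.
Proof.
rewrite /ar_x /ar_cst /= -!(rmorphXn, rmorphM, rmorphD) /=.
by rewrite expr2; congr (_, _) => /=; rewrite -?mul_polyC; ring.
Qed.

(** The product of [f] and its conjugate by inversion, which sends y to [- y - B]: the norm down to
    polynomials in x, hence multiplicative. *)
Definition ar_norm (f : R) : {poly F} := f.1 ^+ 2 - f.1 * f.2 * B - f.2 ^+ 2 * C.

Lemma ar_normM f g : ar_norm (f * g) = ar_norm f * ar_norm g.
Proof. by case: f g => [p q] [r s]; rewrite /ar_norm /=; ring. Qed.

Lemma size_cubic : size C = 4%N.
Proof.
rewrite -!addrA size_polyDl ?size_polyXn //.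
rewrite (leq_ltn_trans (size_polyD _ _)) // gtn_max.
rewrite (leq_ltn_trans (size_scale_leq _ _)) ?size_polyXn //=.
rewrite (leq_ltn_trans (size_polyD _ _)) // gtn_max.
rewrite (leq_ltn_trans (size_scale_leq _ _)) ?size_polyX //=.
by rewrite (leq_ltn_trans (size_polyC_leq1 _)).
Qed.

Lemma size_linear : (size B <= 2)%N.
Proof.
rewrite (leq_trans (size_polyD _ _)) // geq_max.
rewrite (leq_trans (size_scale_leq _ _)) ?size_polyX //=.
by rewrite (leq_trans (size_polyC_leq1 _)).
Qed.

(** The degrees of [p ^ 2] and [q ^ 2 * C] have opposite parities, so these terms cannot cancel, and
    the cross term has degree below the larger of the two. A function that involves y thus never has
    a norm of degree at most 2. *)
Lemma size_ar_norm (f : R) :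
  (if f.2 == 0%R then size (ar_norm f) = (size f.1 + size f.1).-1
  else 4 <= size (ar_norm f))%N.
Proof.
case: f => p q; rewrite /ar_norm /=; case: eqVneq => [->|q0].
  rewrite !(mulr0, mul0r, expr0n, subr0) /= expr2.
  by have [->|p0] := eqVneq p 0; rewrite ?mul0r ?size_poly0 // size_mul.
have sq : (0 < size q)%N by rewrite lt0n size_poly_eq0.
have s3 : (size (q ^+ 2 * C)%R = size q + size q + 2)%N.
  have C0 : C != 0 by rewrite -size_poly_eq0 size_cubic.
  by rewrite size_mul ?expf_neq0 // size_cubic expr2 size_mul //; move: (size q) sq => k; lia.
have s1 : (size (p ^+ 2)%R = (size p + size p).-1)%N.
  by have [->|p0] := eqVneq p 0; rewrite ?expr0n ?size_poly0 // expr2 size_mul.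
have s2 : (size (p * q * B)%R <= size p + size q)%N.
  have := size_polyMleq (p * q) B; have := size_polyMleq p q.
  by have := size_linear; lia.
have [le|lt] := leqP (size p) (size q).+1.
  have -> : p ^+ 2 - p * q * B - q ^+ 2 * C = - (q ^+ 2 * C) + (p ^+ 2 - p * q * B).
    by ring.
  rewrite size_polyDl ?size_polyN ?s3; first by move: (size q) sq => k; lia.
  by rewrite (leq_ltn_trans (size_polyD _ _)) // size_polyN gtn_max s1; move: s2 sq le;
    move: (size p) (size q) (size (p * q * B)) => a b c; lia.
have lt2 : (size (- (p * q * B) - q ^+ 2 * C)%R < size (p ^+ 2)%R)%N.
  rewrite (leq_ltn_trans (size_polyD _ _)) // !size_polyN gtn_max s1 s3.
  by move: s2 sq lt; move: (size p) (size q) (size (p * q * B)) => a b c; lia.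
rewrite -addrA size_polyDl // s1.
by move: sq lt; move: (size p) (size q) => a b; lia.
Qed.

Lemma ar_norm_eq0 f : (ar_norm f == 0) = (f == 0).
Proof.
apply/eqP/eqP => [n0|->]; last by rewrite /ar_norm /= !(mul0r, expr0n, subr0).
have := size_ar_norm f; rewrite n0 size_poly0.
case: eqVneq => // f20 s1; rewrite [f]surjective_pairing f20; congr (_, _).
by apply/eqP; rewrite -size_poly_eq0; lia.
Qed.

Lemma ar_mulf_eq0 (f g : R) : (f * g == 0) = (f == 0) || (g == 0).
Proof. by rewrite -!ar_norm_eq0 ar_normM mulf_eq0. Qed.

Lemma ar_mulfI (f : R) : f != 0 -> injective ( *%R f).
Proof.
move=> f0 g h /eqP; rewrite -subr_eq0 -mulrBr ar_mulf_eq0 (negPf f0) subr_eq0.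
by move/eqP.
Qed.
End AffineRingTheory.

Section Ideals.
Variable R : comNzRingType.
Implicit Types (I J K : set R) (a b f g : R).

Definition is_ideal I :=
  [/\ I 0, forall f g, I f -> I g -> I (f + g) & forall a f, I f -> I (a * f)].

(** The intersection of all ideals that contain the products: an inclusion out of a product is then
    checked on [a * b] alone, without finite sums. *)
Definition ideal_mul I J : set R :=
  [set f | forall K, is_ideal K -> (forall a b, I a -> J b -> K (a * b)) -> K f]%classic.

Definition ideal_scale a I : set R := [set a * f | f in I]%classic.

Lemma set_eq I J : (forall f, I f <-> J f) -> I = J.
Proof. by move=> h; apply/funext => f; apply/propext. Qed.

Lemma is_ideal_mul I J : is_ideal (ideal_mul I J).
Proof.
split=> [K [K0 _ _] //|f g If Ig K iK h|a f If K iK h].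
  by case: (iK) => _ KD _; apply: KD; [apply: If|apply: Ig].
by case: (iK) => _ _ KM; apply: KM; apply: If.
Qed.

Lemma is_ideal_scale a I : is_ideal I -> is_ideal (ideal_scale a I).
Proof.
case=> I0 ID IM; split.
- by exists 0; rewrite ?mulr0.
- by move=> _ _ [f If <-] [g Ig <-]; exists (f + g); rewrite ?mulrDr //; apply: ID.
- by move=> b _ [f If <-]; exists (b * f); [apply: IM|rewrite mulrCA].
Qed.

Lemma is_idealT : is_ideal (@setT R).
Proof. by []. Qed.

Lemma mem_ideal_mul I J a b : I a -> J b -> ideal_mul I J (a * b).
Proof. by move=> Ia Jb K _; apply. Qed.

Lemma ideal_mul_sub I J K : is_ideal K ->
  (forall a b, I a -> J b -> K (a * b)) -> forall f, ideal_mul I J f -> K f.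
Proof. by move=> iK h f; apply. Qed.

Lemma ideal_mulC I J : ideal_mul I J = ideal_mul J I.
Proof.
by apply: set_eq => f; split=> h K iK h'; apply: h => // a b Ia Jb; rewrite mulrC;
  apply: h'.
Qed.

(** Allows one factor [c] to be fixed, so that inclusions of triple products also reduce to products
    of elements. *)
Lemma is_ideal_colon I c : is_ideal I -> is_ideal [set g | I (g * c)]%classic.
Proof.
case=> I0 ID IM; split=> /=; first by rewrite mul0r.
- by move=> f g; rewrite mulrDl; apply: ID.
- by move=> a f; rewrite -mulrA; apply: IM.
Qed.

Lemma ideal_mulA_sub I J K f :
  ideal_mul (ideal_mul I J) K f -> ideal_mul I (ideal_mul J K) f.
Proof.
apply: ideal_mul_sub; first exact: is_ideal_mul.
move=> g c IJg Kc; have iL := is_ideal_colon c (is_ideal_mul I (ideal_mul J K)).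
apply: (ideal_mul_sub iL _ IJg) => a b Ia Jb /=; rewrite -mulrA.
by apply: mem_ideal_mul => //; apply: mem_ideal_mul.
Qed.

Lemma ideal_mulA I J K :
  ideal_mul I (ideal_mul J K) = ideal_mul (ideal_mul I J) K.
Proof.
apply: set_eq => f; split; last exact: ideal_mulA_sub.
rewrite ideal_mulC (ideal_mulC J) (ideal_mulC _ K) (ideal_mulC I).
exact: ideal_mulA_sub.
Qed.

Lemma ideal_mul1 I : is_ideal I -> ideal_mul setT I = I.
Proof.
move=> iI; apply: set_eq => f; split.
  by apply: ideal_mul_sub => // a b _ Ib; case: iI => _ _; apply.
by move=> If; rewrite -[f]mul1r; apply: mem_ideal_mul.
Qed.

Lemma ideal_scale_mul a I J :
  ideal_scale a (ideal_mul I J) = ideal_mul (ideal_scale a I) J.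
Proof.
apply: set_eq => f; split.
  case=> g IJg <-; rewrite mulrC.
  have iL := is_ideal_colon a (is_ideal_mul (ideal_scale a I) J).
  apply: (ideal_mul_sub iL _ IJg) => b c Ib Jc /=.
  by rewrite mulrC mulrA; apply: mem_ideal_mul => //; exists b.
apply: ideal_mul_sub; first exact/is_ideal_scale/is_ideal_mul.
by move=> _ c [b Ib <-] Jc; exists (b * c); rewrite ?mulrA //; apply: mem_ideal_mul.
Qed.

Lemma ideal_scale_scale a b I :
  ideal_scale a (ideal_scale b I) = ideal_scale (a * b) I.
Proof.
apply: set_eq => f; split=> [[_ [g Ig <-] <-]|[g Ig <-]].
  by exists g; rewrite ?mulrA.
by exists (b * g); rewrite ?mulrA //; exists g.
Qed.
End Ideals.

Section PointIdeals.
Variables (F : fieldType) (E : weierstrass F).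
Local Notation R := (affine_ring E).
Local Notation X := (ar_x E).
Local Notation Y := (ar_y E).
Local Notation c := (ar_cst E).
Implicit Types (I J K : set R).

(** Equality of ideal classes, with denominators cleared so as to stay inside the ring. *)
Definition ideal_sim I J := exists a b : R,
  [/\ a != 0, b != 0 & ideal_scale a I = ideal_scale b J].

Lemma ideal_sim_refl I : ideal_sim I I.
Proof. by exists 1, 1; rewrite oner_eq0. Qed.

Lemma ideal_sim_sym I J : ideal_sim I J -> ideal_sim J I.
Proof. by case=> a [b [a0 b0 e]]; exists b, a. Qed.

Lemma ideal_sim_trans J I K : ideal_sim I J -> ideal_sim J K -> ideal_sim I K.
Proof.
case=> a [b [a0 b0 e]] [a' [b' [a0' b0' e']]].
exists (a' * a), (b * b'); rewrite !ar_mulf_eq0 !negb_or a0 b0 a0' b0'.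
by rewrite -!ideal_scale_scale e -e' !ideal_scale_scale mulrC.
Qed.

Lemma ideal_sim_mul I J I' J' : ideal_sim I J -> ideal_sim I' J' ->
  ideal_sim (ideal_mul I I') (ideal_mul J J').
Proof.
case=> a [b [a0 b0 e]] [a' [b' [a0' b0' e']]].
exists (a' * a), (b' * b); rewrite !ar_mulf_eq0 !negb_or a0 b0 a0' b0'; split=> //.
have e1 : ideal_scale a (ideal_mul I I') = ideal_scale b (ideal_mul J I').
  by rewrite !ideal_scale_mul e.
have e2 : ideal_scale a' (ideal_mul J I') = ideal_scale b' (ideal_mul J J').
  by rewrite ![ideal_mul J _]ideal_mulC !ideal_scale_mul e'.
by rewrite -ideal_scale_scale e1 ideal_scale_scale mulrC -ideal_scale_scale e2
           ideal_scale_scale mulrC.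
Qed.

Lemma ideal_scaleI (a : R) I J : a != 0 ->
  ideal_scale a I = ideal_scale a J -> I = J.
Proof.
move=> a0 e; apply: set_eq => f.
have := congr1 (fun S : set R => S (a * f)) e => /= efs; split=> hf.
  have: ideal_scale a I (a * f) by exists f.
  by rewrite efs => -[g Jg /(ar_mulfI a0) <-].
have: ideal_scale a J (a * f) by exists f.
by rewrite -efs => -[g Jg /(ar_mulfI a0) <-].
Qed.

(** For a point of the curve, its maximal ideal; the point at infinity is sent to the unit ideal,
    whose class is trivial. *)
Definition point_ideal (P : ecpoint F) : set R :=
  if P is Some (x, y) then
    [set f | exists r s, f = r * (X - c x) + s * (Y - c y)]%classic
  else setT.

Lemma is_ideal_point P : is_ideal (point_ideal P).
Proof.
case: P => [[x y]|] //=; split.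
- by exists 0, 0; rewrite !mul0r addr0.
- by move=> _ _ [r [s ->]] [r' [s' ->]]; exists (r + r'), (s + s'); ring.
- by move=> a _ [r [s ->]]; exists (a * r), (a * s); ring.
Qed.

Lemma point_ideal_x x y : point_ideal (Some (x, y)) (X - c x).
Proof. by exists 1, 0; ring. Qed.
Lemma point_ideal_y x y : point_ideal (Some (x, y)) (Y - c y).
Proof. by exists 0, 1; ring. Qed.

Lemma ar_x_sub_neq0 x : X - c x != 0.
Proof.
have -> : X - c x = ar_poly E ('X - x%:P) by rewrite rmorphB.
by rewrite xpair_eqE polyXsubC_eq0.
Qed.

Definition ar_eval (x y : F) (f : R) : F := f.1.[x] + f.2.[x] * y.

Lemma ar_eval_monoid x y : weq E x y = 0 -> monoid_morphism (ar_eval x y).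
Proof.
move=> e; split=> [|[p q] [r s]]; rewrite /ar_eval /= !hornerE /= ?hornerXn; first by ring.
rewrite -[LHS]addr0 -[X in _ + X](mulr0 (q.[x] * s.[x])) -e /weq; ring.
Qed.
End PointIdeals.

(** Proves identities modulo known relations: [d] is a combination of quantities that vanish, and
    [ring] checks that [a - b] equals it. The long values given to [d] are such certificates. *)
Lemma eq_of_sub (V : zmodType) (d a b : V) : d = 0 -> a - b = d -> a = b.
Proof. by move=> -> /eqP; rewrite subr_eq0 => /eqP. Qed.

Lemma ideal_mul_mono (R : comNzRingType) (I J I' J' : set R) :
  (forall f, I f -> I' f) -> (forall f, J f -> J' f) ->
  forall f, ideal_mul I J f -> ideal_mul I' J' f.
Proof.
move=> h h'; apply: ideal_mul_sub; first exact: is_ideal_mul.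
by move=> a b Ia Jb; apply: mem_ideal_mul; [apply: h|apply: h'].
Qed.

Lemma ideal_mul_principal (R : comNzRingType) (a : R) (I : set R) : is_ideal I ->
  ideal_mul (ideal_scale a setT) I = ideal_scale a I.
Proof. by move=> iI; rewrite -ideal_scale_mul ideal_mul1. Qed.

Lemma ideal_mulACA (R : comNzRingType) (I J K L : set R) :
  ideal_mul (ideal_mul I J) (ideal_mul K L) = ideal_mul (ideal_mul I K) (ideal_mul J L).
Proof. by rewrite -!ideal_mulA (ideal_mulA J) (ideal_mulC J) -!ideal_mulA. Qed.

Section Smooth.
Variables (F : fieldType) (E : weierstrass F).

Definition smooth := forall x y, weq E x y = 0 ->
  2%:R * y + a1 E * x + a3 E = 0 ->
  3%:R * x ^+ 2 + 2%:R * a2 E * x + a4 E - a1 E * y != 0.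

(* Euclid's algorithm for psi_2 ^ 2 and its derivative. *)
Lemma discriminant_bezout x (f := (psi2_sq E).[x])
    (g := 12%:R * x ^+ 2 + 2%:R * b2 E * x + 2%:R * b4 E)
    (r := 12%:R * (2%:R * b4 E * 2%:R) - 2%:R * b2 E ^+ 2)
    (s := 36%:R * b6 E - 2%:R * b2 E * b4 E) :
  - 576%:R * discriminant E
  = r ^+ 2 * g - (12%:R * r * x + 2%:R * b2 E * r - 12%:R * s)
      * (36%:R * f - (12%:R * x + b2 E) * g).
Proof.
rewrite /f /g /r /s /psi2_sq !hornerE /= /discriminant /b8 /b6 /b4 /b2 ?hornerXn.
ring.
Qed.

Lemma psi2_sq_weq x y :
  (psi2_sq E).[x] = (2%:R * y + a1 E * x + a3 E) ^+ 2 - 4%:R * weq E x y.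
Proof. by rewrite /psi2_sq !hornerE /= ?hornerXn /weq /b6 /b4 /b2; ring. Qed.

Hypothesis char0 : [pchar F] =i pred0.
Lemma char0_neq0 n : (0 < n)%N -> n%:R != 0 :> F.
Proof. by move=> n0; rewrite ((pcharf0P F).1 char0 n) -lt0n. Qed.

(** At a singular point [psi2_sq] and its derivative both vanish, and the Bezout identity writes -
    576 times the discriminant in terms of these two. *)
Lemma discriminant_smooth : discriminant E != 0 -> smooth.
Proof.
move=> d0 x y e w0; apply: contraNneq d0 => t0.
have := discriminant_bezout x; cbv zeta.
rewrite (psi2_sq_weq x y) w0 e.
have -> : 12%:R * x ^+ 2 + 2%:R * b2 E * x + 2%:R * b4 E =
  4%:R * (3%:R * x ^+ 2 + 2%:R * a2 E * x + a4 E - a1 E * y)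
  + 2%:R * a1 E * (2%:R * y + a1 E * x + a3 E) by rewrite /b2 /b4; ring.
rewrite t0 w0 => /eqP.
have -> : forall r k l : F, r * (4%:R * 0 + 2%:R * a1 E * 0)
  - k * (36%:R * (0 ^+ 2 - 4%:R * 0) - l * (4%:R * 0 + 2%:R * a1 E * 0)) = 0.
  by move=> *; ring.
by rewrite mulf_eq0 oppr_eq0 (negPf (char0_neq0 _)).
Qed.
End Smooth.

(** * The group law *)

Section PicardEmbedding.
Variables (F : fieldType) (E : weierstrass F) (smoothE : smooth E).
Local Notation R := (affine_ring E).
Local Notation X := (ar_x E).
Local Notation Y := (ar_y E).
Local Notation c := (ar_cst E).
Local Notation "''I' P" := (@point_ideal F E P) (at level 8, format "''I' P").

(** The product contains [X - x] multiplied by each of the constants 2 y + a1 x + a3 and 3 x^2 + 2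
    a2 x + a4 - a1 y; smoothness makes one of them nonzero. *)
Lemma ideal_mul_opp x y : weq E x y = 0 ->
  ideal_mul 'I (Some (x, y)) 'I (opp_point E (Some (x, y)))
  = ideal_scale (X - c x) setT.
Proof.
move=> e; set J := ideal_mul _ _.
have [J0 JD JM] : is_ideal J by apply: is_ideal_mul.
pose y' := - y - a1 E * x - a3 E.
(* The cofactor of [X - x] in the product [(Y - y) * (Y - y')] of the horizontal lines through P and
   - P. *)
pose h := X ^+ 2 + c x * X + c x ^+ 2 + c (a2 E) * (X + c x) + c (a4 E) - c (a1 E) * Y.
have eh : (Y - c y) * (Y - c y') = (X - c x) * h.
  rewrite -[LHS]subr0 -[X in _ - X](ar_weq E) -[LHS]addr0.
  by rewrite -[X in _ + X](rmorph0 c) -e /weq /y' /h; ring.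
have Jx : forall f, 'I (Some (x, y)) f -> J ((X - c x) * f).
  by move=> f If; rewrite mulrC; apply: mem_ideal_mul => //; apply: point_ideal_x.
have Jx' : forall f, 'I (Some (x, y')) f -> J ((X - c x) * f).
  by move=> f If; apply: mem_ideal_mul => //; apply: point_ideal_x.
have Jy : J ((X - c x) * h).
  by rewrite -eh; apply: mem_ideal_mul; apply: point_ideal_y.
have sub : forall f, J f -> ideal_scale (X - c x) setT f.
  apply: ideal_mul_sub; first exact/is_ideal_scale/is_idealT.
  move=> _ _ [r [s ->]] [r' [s' ->]].
  exists (r * r' * (X - c x) + r * s' * (Y - c y') + r' * s * (Y - c y) + s * s' * h) => //.
  by apply: (eq_of_sub (d := s * s' * ((X - c x) * h - (Y - c y) * (Y - c y'))));
    [rewrite eh; ring|rewrite /y'; ring].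
clearbody J; apply: set_eq => f; split=> [/sub //|].
case=> g _ <-; rewrite mulrC; apply: (JM g).
have Jdiv k : k != 0 -> J (c k * (X - c x)) -> J (X - c x).
  by move=> k0 /(JM (c k^-1)); rewrite mulrA -rmorphM mulVf // rmorph1 mul1r.
have [w0|w0] := eqVneq (2%:R * y + a1 E * x + a3 E) 0; last first.
  apply: (Jdiv _ w0).
  have -> : c (2%:R * y + a1 E * x + a3 E) * (X - c x) =
    (X - c x) * (Y - c y') + (-1) * ((X - c x) * (Y - c y)) by rewrite /y'; ring.
  by apply/JD; last apply/JM; [apply/Jx'/point_ideal_y|apply/Jx/point_ideal_y].
have t0 := smoothE e w0; apply: (Jdiv _ t0).
have -> : c (3%:R * x ^+ 2 + 2%:R * a2 E * x + a4 E - a1 E * y) * (X - c x) =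
   (X - c x) * h + ((- (X + c x + c x + c (a2 E))) * ((X - c x) * (X - c x))
    + c (a1 E) * ((X - c x) * (Y - c y))) by rewrite /h; ring.
apply/JD => //; apply/JD; apply/JM; apply: Jx;
  [exact: point_ideal_x|exact: point_ideal_y].
Qed.

(** In the application [m] is a line and the [v] are the vertical lines through its three
    intersections with the curve: modulo [m] only a multiple of [v1 * v2 * v3] survives, which is
    itself a multiple of [m]. *)
Lemma line_mul_sub (I1 I2 I3 : set R) (v1 v2 v3 m k : R) :
  (forall f, I1 f -> exists r s, f = r * v1 + s * m) ->
  (forall f, I2 f -> exists r s, f = r * v2 + s * m) ->
  (forall f, I3 f -> exists r s, f = r * v3 + s * m) ->
  v1 * v2 * v3 = m * k ->
  forall f, ideal_mul (ideal_mul I1 I2) I3 f -> ideal_scale m setT f.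
Proof.
move=> h1 h2 h3 e; have iK := is_ideal_scale m (is_idealT R).
apply: (ideal_mul_sub iK) => g f3 I12 I3f.
have iL := is_ideal_colon f3 iK.
apply: (ideal_mul_sub iL _ I12) => _ _ /h1[r1 [s1 ->]] /h2[r2 [s2 ->]] /=.
case/h3: I3f => r3 [s3 ->].
exists (r1 * r2 * r3 * k + r1 * r2 * v1 * v2 * s3 + r1 * v1 * s2 * (r3 * v3 + s3 * m)
  + s1 * (r2 * v2 + s2 * m) * (r3 * v3 + s3 * m)) => //.
by apply: (eq_of_sub (d := r1 * r2 * r3 * (m * k - v1 * v2 * v3)));
  [rewrite e; ring|ring].
Qed.

(** The classes agree through [(X - x3) I_P I_Q = m I_S], where [m] is the line and S the sum. The
    long hypothesis says that the curve equation restricted to the line, once divided by its zero at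
    [x1], vanishes at [x2]; it covers chords and tangents alike. *)
Lemma point_ideal_chord l x1 y1 x2 y2 :
    weq E x1 y1 = 0 ->
    2%:R * l * y1 + a1 E * (y1 + l * x1) + a3 E * l
      - 3%:R * x1 ^+ 2 - 2%:R * a2 E * x1 - a4 E
      + (x2 - x1) * (l ^+ 2 + a1 E * l - a2 E - 3%:R * x1 - (x2 - x1)) = 0 ->
    weq E x2 y2 = 0 -> y2 = l * (x2 - x1) + y1 ->
  ideal_sim (ideal_mul 'I (Some (x1, y1)) 'I (Some (x2, y2)))
    'I (chord_point E l x1 y1 x2).
Proof.
move=> e1 e12 e2 ey2; have := on_curve_chord e1 e12; rewrite /chord_point.
set x3 := l ^+ 2 + _ - _ - _ - _; set y3 := l * (x3 - x1) + y1.
set P := Some (x1, y1); set Q := Some (x2, y2); set S := opp_point E _ => cS.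
have e3 : weq E x3 y3 = 0.
  by move/on_curve_opp: cS => /= /eqP; rewrite -[RHS]/(0 : F) => <-; congr (weq E _ _); ring.
pose m := Y - c y1 - c l * (X - c x1).
pose m' := - Y - c (a1 E) * X - c (a3 E) - c y1 - c l * (X - c x1).
have emm : (X - c x1) * (X - c x2) * (X - c x3) = - (m * m').
  pose z1 := c (weq E x1 y1); pose z3 : R := Y ^+ 2 + (c (a1 E) * X + c (a3 E)) * Y
    - (X ^+ 3 + c (a2 E) * X ^+ 2 + c (a4 E) * X + c (a6 E)).
  pose z2 := c (2%:R * l * y1 + a1 E * (y1 + l * x1) + a3 E * l
      - 3%:R * x1 ^+ 2 - 2%:R * a2 E * x1 - a4 E
      + (x2 - x1) * (l ^+ 2 + a1 E * l - a2 E - 3%:R * x1 - (x2 - x1))).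
  apply: (eq_of_sub (d := z1 + (X - c x1) * z2 - z3)).
    by rewrite /z1 /z2 /z3 ar_weq e1 e12 rmorph0; ring.
  rewrite /z1 /z2 /z3 /m /m' /x3 /weq; ring.
have hP : forall f, 'I P f -> exists r s, f = r * (X - c x1) + s * m.
  by move=> _ [r [s ->]]; exists (r + s * c l), s; rewrite /m; ring.
have hQ : forall f, 'I Q f -> exists r s, f = r * (X - c x2) + s * m.
  by move=> _ [r [s ->]]; exists (r + s * c l), s; rewrite /m ey2; ring.
have hS' : forall f, 'I (Some (x3, y3)) f -> exists r s, f = r * (X - c x3) + s * m.
  by move=> _ [r [s ->]]; exists (r + s * c l), s; rewrite /m /y3; ring.
have hP' : forall f, 'I (opp_point E P) f -> exists r s, f = r * (X - c x1) + s * m'.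
  by move=> _ [r [s ->]]; exists (r - s * (c l + c (a1 E))), (- s); rewrite /m'; ring.
have hQ' : forall f, 'I (opp_point E Q) f -> exists r s, f = r * (X - c x2) + s * m'.
  by move=> _ [r [s ->]]; exists (r - s * (c l + c (a1 E))), (- s); rewrite /m' ey2; ring.
have hS : forall f, 'I S f -> exists r s, f = r * (X - c x3) + s * m'.
  by move=> _ [r [s ->]]; exists (r - s * (c l + c (a1 E))), (- s); rewrite /m' /y3; ring.
have sub1 : forall f, ideal_mul (ideal_mul 'I P 'I Q) 'I (Some (x3, y3)) f ->
    ideal_scale m setT f.
  by apply: (line_mul_sub hP hQ hS' (k := - m')); rewrite emm; ring.
have sub2 : forall f, ideal_mul (ideal_mul 'I (opp_point E P) 'I (opp_point E Q)) 'I S f ->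
    ideal_scale m' setT f.
  by apply: (line_mul_sub hP' hQ' hS (k := - m)); rewrite emm; ring.
have iPQ := is_ideal_mul 'I P 'I Q; have iS := is_ideal_point E S.
exists (X - c x3), m; split; first exact: ar_x_sub_neq0.
  rewrite /m xpair_eqE negb_and; apply/orP; right.
  rewrite /= !(mulr0, mul0r, subr0, addr0, add0r, oppr0).
  exact: oner_neq0.
have mono := ideal_mul_mono.
(* In this direction [X - x3] is replaced by the product of the ideals of S and - S; as - S is the
   third point of the line, its ideal times [I_P I_Q] lies in [(m)]. *)
apply: set_eq => f; split.
  rewrite -(ideal_mul_principal _ iPQ) -(ideal_mul_opp e3) -(ideal_mul_principal _ iS).
  rewrite (ideal_mulC _ (ideal_mul 'I P 'I Q)) ideal_mulA.
  exact: mono.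
(* For the converse, multiplication by [(X - x1) * (X - x2)] brings in the ideals of - P and - Q,
   whose product with [I_S] lies in [(m')]. Since [m * m'] is minus the product of the three
   vertical lines, the first two cancel. *)
case=> g Sg <-.
have : ideal_scale m' (ideal_mul 'I P 'I Q) ((X - c x1) * ((X - c x2) * g)).
  have : ideal_mul (ideal_scale (X - c x1) setT)
    (ideal_mul (ideal_scale (X - c x2) setT) 'I S) ((X - c x1) * ((X - c x2) * g)).
    rewrite (ideal_mul_principal _ iS) ideal_mul_principal; last exact: is_ideal_scale.
    by exists ((X - c x2) * g) => //; exists g.
  rewrite -(ideal_mul_opp e1) -(ideal_mul_opp e2) -(ideal_mul_principal _ iPQ).
  set P' := opp_point E P; set Q' := opp_point E Q => h.
  have : ideal_mul (ideal_mul (ideal_mul 'I P' 'I Q') 'I S) (ideal_mul 'I P 'I Q)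
      ((X - c x1) * ((X - c x2) * g)).
    move: h; rewrite ideal_mulA ideal_mulACA [ideal_mul (ideal_mul 'I P 'I Q) _]ideal_mulC.
    by rewrite -!(ideal_mulA (ideal_mul 'I P' 'I Q')) (ideal_mulC 'I S).
  exact: mono.
case=> h PQh eh; exists (- h); first by case: iPQ => _ _ M; rewrite -mulN1r; apply: M.
have vv : (X - c x1) * (X - c x2) != 0 by rewrite ar_mulf_eq0 negb_or !ar_x_sub_neq0.
apply: (ar_mulfI vv); rewrite mulrA emm.
transitivity (m * (m' * h)); [ring|rewrite eh; ring].
Qed.

Lemma point_ideal_add P Q : on_curve E P -> on_curve E Q ->
  ideal_sim (ideal_mul 'I P 'I Q) 'I (add_point E P Q).
Proof.
case: P Q => [[x1 y1]|] Q; last first.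
  move=> _ cQ; rewrite ideal_mul1; last exact: is_ideal_point.
  exact: ideal_sim_refl.
case: Q => [[x2 y2]|]; last first.
  move=> _ _; rewrite ideal_mulC ideal_mul1; last exact: is_ideal_point.
  exact: ideal_sim_refl.
move=> /= /eqP e1 /eqP e2.
have [ex|nx] := eqVneq x1 x2.
  subst x2; have [ey|ne] := eqVneq; last first.
    have [ey nd] := on_curve_same_x e1 e2 ne.
    by apply: point_ideal_chord => //; [field|rewrite subrr mulr0 add0r].
  rewrite ey ideal_mulC (ideal_mul_opp e2).
  exists 1, (X - c x1); rewrite oner_eq0 ar_x_sub_neq0; split=> //.
  by rewrite ideal_scale_scale mul1r.
have nd : x2 - x1 != 0 by rewrite subr_eq0 eq_sym.
apply: point_ideal_chord => //; last by field.
apply: (mulfI nd); rewrite mulr0.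
rewrite -[RHS](subr0 0) -{1}e2 -e1 /weq.
by field.
Qed.

(* The norm of a generator would have degree at most 2, so the generator would be
   a polynomial in x alone. *)
Lemma point_ideal_not_principal x y (h : R) : weq E x y = 0 ->
  'I (Some (x, y)) h -> 'I (Some (x, y)) <> ideal_scale h setT.
Proof.
move=> e _ eI.
have : 'I (Some (x, y)) (X - c x) by apply: point_ideal_x.
rewrite eI => -[f _ efx].
have : 'I (Some (x, y)) (Y - c y) by apply: point_ideal_y.
rewrite eI => -[g _ efy].
have h2 : h.2 = 0.
  have n1 : ar_norm (h * f) = ('X - x%:P) ^+ 2.
    rewrite efx /ar_norm /= !(subr0, mulr0, mul0r, oppr0, addr0) expr0n /=.
    by rewrite !(mul0r, subr0).
  have := size_ar_norm h; case: eqP => // _ le4.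
  have: (ar_norm h %| ('X - x%:P) ^+ 2) by rewrite -n1 ar_normM dvdp_mulr.
  move/dvdp_leq; rewrite size_exp_XsubC expf_neq0 ?polyXsubC_eq0 // => /(_ isT) le3.
  by have := leq_trans le4 le3.
(* As [h] is free of y, the coefficient 1 of y in [Y - y] makes [h] a unit; the ideal would then
   contain 1, which does not vanish at the point. *)
have e1 : h.1 * g.2 = 1.
  have := congr1 snd efy => /=; rewrite h2 !(mul0r, addr0, subr0) => ->.
  by rewrite ?oppr0 ?addr0.
have hg : h * ar_poly E g.2 = 1.
  by rewrite [h]surjective_pairing h2 -[(_, _)]/(ar_poly E h.1) -rmorphM e1 rmorph1.
have : 'I (Some (x, y)) 1 by rewrite eI; exists (ar_poly E g.2).
case=> r [s] /(congr1 (ar_eval x y)); have [ev1 evM] := ar_eval_monoid e.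
have evD (f1 f2 : R) : ar_eval x y (f1 + f2) = ar_eval x y f1 + ar_eval x y f2 :> F.
  by rewrite /ar_eval /= !hornerD; ring.
rewrite ev1 evD !evM /ar_eval /= !(oppr0, hornerE) /= => /eqP.
by rewrite addNr subrr !mulr0 addr0 oner_eq0.
Qed.

Lemma add_point_opp_eq0 P Q : on_curve E P -> on_curve E Q ->
  add_point E P (opp_point E Q) = None -> P = Q.
Proof.
case: P Q => [[x1 y1]|] [[x2 y2]|] //= _ _.
case: eqP => [->|_] //; case: eqP => [->|_] // _; congr (Some (_, _)); ring.
Qed.

(** Multiplication by the ideal of - Q makes the ideal of P - Q principal, which forces P - Q to be
    the point at infinity. *)
Lemma point_ideal_inj P Q : on_curve E P -> on_curve E Q ->
  ideal_sim 'I P 'I Q -> P = Q.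
Proof.
move=> cP cQ PQ; apply: add_point_opp_eq0 => //.
have cQ' := on_curve_opp cQ; have cS := on_curve_add cP cQ'.
have : ideal_sim setT 'I (add_point E P (opp_point E Q)).
  apply: ideal_sim_trans (point_ideal_add cP cQ').
  apply/ideal_sim_sym; apply: ideal_sim_trans (ideal_sim_mul PQ (ideal_sim_refl _)) _.
  case: {PQ cQ' cS} Q cQ => [[x y]|] /= cQ; last first.
    by rewrite ideal_mul1 //; exact: ideal_sim_refl.
  rewrite (ideal_mul_opp (eqP cQ)).
  exists 1, (X - c x); rewrite oner_eq0 ar_x_sub_neq0; split=> //.
  by rewrite ideal_scale_scale mul1r.
case: (add_point _ _ _) cS => // -[x y] cS [a [b [a0 b0 eab]]]; exfalso.
have : ideal_scale a setT a by exists 1; rewrite ?mulr1.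
rewrite eab => -[h Ih eh].
apply: (point_ideal_not_principal (eqP cS) Ih).
by apply: (ideal_scaleI b0); rewrite -eab ideal_scale_scale eh.
Qed.

Lemma add_pointA P Q S : on_curve E P -> on_curve E Q -> on_curve E S ->
  add_point E P (add_point E Q S) = add_point E (add_point E P Q) S.
Proof.
move=> cP cQ cS; have cPQ := on_curve_add cP cQ; have cQS := on_curve_add cQ cS.
apply: point_ideal_inj; try exact: on_curve_add.
apply: ideal_sim_trans (ideal_sim_sym (point_ideal_add cP cQS)) _.
apply: ideal_sim_trans (point_ideal_add cPQ cS).
apply: ideal_sim_trans (ideal_sim_mul (ideal_sim_refl _)
         (ideal_sim_sym (point_ideal_add cQ cS))) _.
rewrite ideal_mulA; apply: ideal_sim_mul (ideal_sim_refl _).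
exact: point_ideal_add.
Qed.

Lemma add_pointC P Q : on_curve E P -> on_curve E Q ->
  add_point E P Q = add_point E Q P.
Proof.
move=> cP cQ; apply: point_ideal_inj; try exact: on_curve_add.
apply: ideal_sim_trans (ideal_sim_sym (point_ideal_add cP cQ)) _.
by rewrite ideal_mulC; apply: point_ideal_add.
Qed.

Lemma add_point_oppl P : on_curve E P -> add_point E (opp_point E P) P = None.
Proof. by case: P => [[x y]|] //= _; rewrite !eqxx. Qed.
End PicardEmbedding.

Section PointGroup.
Variables (F : fieldType) (E : weierstrass F) (smoothE : smooth E).

(* The proof of smoothness is a phantom argument on which the group structure
   depends. *)
Definition curve_point (_ : smooth E) := {P : ecpoint F | on_curve E P}.
Local Notation pt := (curve_point smoothE).
HB.instance Definition _ := Choice.on pt.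

Definition pt_zero : pt := exist _ None isT.
Definition pt_opp (P : pt) : pt := exist _ (opp_point E (val P)) (on_curve_opp (valP P)).
Definition pt_add (P Q : pt) : pt :=
  exist _ (add_point E (val P) (val Q)) (on_curve_add (valP P) (valP Q)).

Fact pt_addA : associative pt_add.
Proof. by move=> P Q S; apply: val_inj; apply: add_pointA (valP _) (valP _) (valP _). Qed.
Fact pt_addC : commutative pt_add.
Proof. by move=> P Q; apply: val_inj; apply: add_pointC (valP _) (valP _). Qed.
Fact pt_add0 : left_id pt_zero pt_add.
Proof. by move=> P; apply: val_inj. Qed.
Fact pt_addN : left_inverse pt_zero pt_opp pt_add.
Proof. by move=> P; apply: val_inj; apply: add_point_oppl (valP _). Qed.
HB.instance Definition _ := GRing.isZmodule.Build pt pt_addA pt_addC pt_add0 pt_addN.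

Lemma val_mulrn (P : pt) n : val (P *+ n) = mul_point E n (val P).
Proof. by elim: n => //= n IH; rewrite mulrS /= IH. Qed.
End PointGroup.

(** * Addition formulas in terms of abscissas *)

Section XAddition.
Variables (F : fieldType) (E : weierstrass F) (smoothE : smooth E).
Local Notation pt := (curve_point smoothE).
Implicit Types P Q : pt.

Definition pv P : ecpoint F := val P.
Lemma pv_inj : injective pv. Proof. exact: val_inj. Qed.
Lemma pv_curve P : on_curve E (pv P). Proof. exact: valP. Qed.
Lemma pv_mulrn P n : pv (P *+ n) = mul_point E n (pv P). Proof. exact: val_mulrn. Qed.

(** At infinity both coordinates take the junk value 0, hence the side conditions [P != 0] below. *)
Definition px P : F := if pv P is Some (x, _) then x else 0.
Definition py P : F := if pv P is Some (_, y) then y else 0.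
Definition pw P : F := 2%:R * py P + a1 E * px P + a3 E.

Lemma pt_affine P : P != 0 -> pv P = Some (px P, py P) /\ weq E (px P) (py P) = 0.
Proof.
move=> P0; rewrite /px /py; have := pv_curve P; case e: (pv P) => [[x y]|] /=.
  by move/eqP.
by case/eqP: P0; apply: pv_inj.
Qed.

Lemma pv_ptD P Q : pv (P + Q) = add_point E (pv P) (pv Q). Proof. by []. Qed.
Lemma pv_ptN P : pv (- P) = opp_point E (pv P). Proof. by []. Qed.

Lemma px_opp P : px (- P) = px P.
Proof. by rewrite /px pv_ptN; case: (pv P) => // -[]. Qed.

Lemma pw_sq P : P != 0 -> pw P ^+ 2 = (psi2_sq E).[px P].
Proof. by case/pt_affine => _ e; rewrite (psi2_sq_weq E _ (py P)) e mulr0 subr0. Qed.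

Lemma px_eq P Q : P != 0 -> Q != 0 -> px P = px Q -> P = Q \/ P = - Q.
Proof.
move=> P0 Q0 ex; have [eP cP] := pt_affine P0; have [eQ cQ] := pt_affine Q0.
rewrite ex in cP.
have [ey|ny] := eqVneq (py P) (- py Q - a1 E * px Q - a3 E).
  by right; apply: pv_inj; rewrite pv_ptN eP eQ /= ex ey.
by left; apply: pv_inj; have [ey _] := on_curve_same_x cP cQ ny; rewrite eP eQ ex ey.
Qed.

Lemma pw_eq0 P : P != 0 -> (pw P == 0) = (P *+ 2 == 0).
Proof.
move=> P0; have [eP cP] := pt_affine P0; rewrite mulr2n (addr_eq0 P).
apply/eqP/eqP => [w0|ePP].
  apply: pv_inj; rewrite pv_ptN eP /=; congr (Some (_, _)).
  by apply: (eq_of_sub (d := pw P)) => //; rewrite /pw; ring.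
have : pv P = pv (- P) by rewrite -ePP.
rewrite pv_ptN eP /= => -[ey].
by rewrite /pw mulr_natl mulr2n {1}ey; ring.
Qed.

Definition xsum (a b : F) : F :=
  2%:R * a * b * (a + b) + b2 E * a * b + b4 E * (a + b) + b6 E.
Definition xprod (a b : F) : F := a ^+ 2 * b ^+ 2 - b4 E * a * b - b6 E * (a + b) - b8 E.
(** For a = x(P) and b = x(Q) this is [(a - b) ^ 2] times the monic polynomial in z with roots x(P +
    Q) and x(P - Q). It is symmetric in its three arguments, as is the vanishing of some signed sum
    of three points with these abscissas; this symmetry is what makes the relations between division
    polynomials work. *)
Definition biquad (a b z : F) : F := z ^+ 2 * (a - b) ^+ 2 - z * xsum a b + xprod a b.

Lemma biquadC a b z : biquad a b z = biquad a z b.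
Proof. by rewrite /biquad /xsum /xprod; ring. Qed.
Lemma biquadCA a b z : biquad a b z = biquad b a z.
Proof. by rewrite /biquad /xsum /xprod; ring. Qed.

Lemma curve_a6 x y : weq E x y = 0 ->
  a6 E = y ^+ 2 + a1 E * x * y + a3 E * y - x ^+ 3 - a2 E * x ^+ 2 - a4 E * x.
Proof. by move=> e; apply: (eq_of_sub (d := - weq E x y)); [rewrite e oppr0|rewrite /weq; ring].
  Qed.

(** The curve equations of two points are linear in [a4] and [a6]; eliminating these leaves free
    variables, and the addition formulas become identities for [field]. *)
Lemma curve_a4 x1 y1 x2 y2 : x1 != x2 -> weq E x1 y1 = 0 -> weq E x2 y2 = 0 ->
  a4 E = ((y1 ^+ 2 + a1 E * x1 * y1 + a3 E * y1 - x1 ^+ 3 - a2 E * x1 ^+ 2)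
    - (y2 ^+ 2 + a1 E * x2 * y2 + a3 E * y2 - x2 ^+ 3 - a2 E * x2 ^+ 2)) / (x1 - x2).
Proof.
move=> nx e1 e2; have nd : x1 - x2 != 0 by rewrite subr_eq0.
apply: (mulIf nd); rewrite divfK //.
apply: (eq_of_sub (d := weq E x2 y2 - weq E x1 y1)); first by rewrite e1 e2 subr0.
by rewrite /weq; ring.
Qed.

Lemma px_addB P Q : P != 0 -> Q != 0 -> px P != px Q ->
  [/\ P + Q != 0, P - Q != 0,
   (px (P + Q) + px (P - Q)) * (px P - px Q) ^+ 2 = xsum (px P) (px Q) &
   px (P + Q) * px (P - Q) * (px P - px Q) ^+ 2 = xprod (px P) (px Q)].
Proof.
move=> P0 Q0 nx; have [eP cP] := pt_affine P0; have [eQ cQ] := pt_affine Q0.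
have nd : px P - px Q != 0 by rewrite subr_eq0.
have nd' : px Q - px P != 0 by rewrite subr_eq0 eq_sym.
split.
- by rewrite addr_eq0; apply: contraNneq nx => ->; rewrite px_opp.
- by rewrite subr_eq0; apply: contraNneq nx => ->.
- rewrite /px !pv_ptD pv_ptN eP eQ /= (negPf nx) /= -/(px P) -/(px Q).
  have := curve_a4 nx cP cQ; have := curve_a6 cP.
  move: (px P) (px Q) (py P) (py Q) nd nd' => x1 x2 y1 y2 nd nd'.
  rewrite /xsum /b2 /b4 /b6; move: (a1 E) (a2 E) (a3 E) (a4 E) (a6 E).
  by move=> A1 A2 A3 A4 A6 -> ->; field; rewrite ?nd ?nd'.
- rewrite /px !pv_ptD pv_ptN eP eQ /= (negPf nx) /= -/(px P) -/(px Q).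
  have := curve_a4 nx cP cQ; have := curve_a6 cP.
  move: (px P) (px Q) (py P) (py Q) nd nd' => x1 x2 y1 y2 nd nd'.
  rewrite /xprod /b4 /b6 /b8; move: (a1 E) (a2 E) (a3 E) (a4 E) (a6 E).
  by move=> A1 A2 A3 A4 A6 -> ->; field; rewrite ?nd ?nd'.
Qed.

Lemma px_biquad P Q z : P != 0 -> Q != 0 -> px P != px Q ->
  (px (P + Q) - z) * (px (P - Q) - z) * (px P - px Q) ^+ 2 = biquad (px P) (px Q) z.
Proof.
by move=> P0 Q0 nx; have [_ _ s p] := px_addB P0 Q0 nx; rewrite /biquad -s -p; ring.
Qed.

Lemma px_double P : P != 0 -> pw P != 0 ->
  px (P *+ 2) * pw P ^+ 2 = xprod (px P) (px P).
Proof.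
move=> P0 w0; have [eP cP] := pt_affine P0.
have nw : (py P == - py P - a1 E * px P - a3 E) = false.
  apply: contraNF w0 => /eqP ey; apply/eqP.
  by rewrite /pw mulr_natl mulr2n {1}ey; ring.
rewrite mulr2n /px !pv_ptD eP /= eqxx nw /= -/(px P); move: w0; rewrite /pw.
have := curve_a6 cP; move: (px P) (py P) => x y.
rewrite /xprod /b4 /b6 /b8; move: (a1 E) (a2 E) (a3 E) (a4 E) (a6 E).
by move=> A1 A2 A3 A4 A6 -> w0; field.
Qed.

(** The degenerate case a = b: the quadratic term of [biquad] drops out, and the remaining root is
    x(2P). *)
Lemma biquad_double P z : P != 0 -> pw P != 0 ->
  pw P ^+ 2 * (px (P *+ 2) - z) = biquad (px P) (px P) z.
Proof.
move=> P0 w0; rewrite mulrBr (mulrC (_ ^+ 2)) px_double // pw_sq //.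
rewrite /biquad /xsum /xprod /psi2_sq !hornerE /= ?hornerXn /b8 /b6 /b4 /b2; ring.
Qed.

Lemma psi3_double P : P != 0 -> pw P != 0 ->
  (psi3 E).[px P] = (px P - px (P *+ 2)) * pw P ^+ 2.
Proof.
move=> P0 w0; rewrite mulrBl px_double // pw_sq //.
rewrite /psi2_sq /psi3 !hornerE /= ?hornerXn /xprod /b8 /b6 /b4 /b2; ring.
Qed.
End XAddition.

(** * Values of the division polynomials *)

Section PsiValues.
Variables (F : fieldType) (E : weierstrass F) (x w : F).
Hypothesis w_sq : w ^+ 2 = (psi2_sq E).[x].

(** The value of psi_k at a point of abscissa [x] where psi_2 takes the value [w]. *)
Definition psiv k : F := (psi_red E k).[x] * (if odd k then 1 else w).

Lemma psiv0 : psiv 0 = 0. Proof. by rewrite /psiv /psi_red /= horner0 mul0r. Qed.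
Lemma psiv1 : psiv 1 = 1. Proof. by rewrite /psiv /psi_red /= hornerC mul1r. Qed.
Lemma psiv2 : psiv 2 = w. Proof. by rewrite /psiv /psi_red /= hornerC mul1r. Qed.
Lemma psiv3 : psiv 3 = (psi3 E).[x]. Proof. by rewrite /psiv /psi_red /= mulr1. Qed.
Lemma psiv4 : psiv 4 = (psi4_red E).[x] * w. Proof. by []. Qed.

Lemma psiv_odd m : (2 <= m)%N ->
  psiv m.*2.+1 = psiv m.+2 * psiv m ^+ 3 - psiv m.-1 * psiv m.+1 ^+ 3.
Proof.
case: m => // m m2; rewrite /psiv /= odd_double psi_red_odd //= !negbK.
move: (psi_red E m.+3) (psi_red E m.+2) (psi_red E m.+1) (psi_red E m) => p3 p2 p1 p0.
move: (psi2_sq E) w_sq => q e.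
by case: (odd m) => /=; rewrite !(hornerD, hornerN, hornerM, horner_exp, hornerC) -e; ring.
Qed.

Lemma psiv_even m : (3 <= m)%N ->
  psiv m.*2 * w
  = psiv m * (psiv m.+2 * psiv m.-1 ^+ 2 - psiv m.-2 * psiv m.+1 ^+ 2).
Proof.
case: m => [|[|m]] // m2; rewrite /psiv /= odd_double psi_red_even //= !negbK.
move: (psi_red E m.+4) (psi_red E m.+3) (psi_red E m.+2) (psi_red E m.+1) (psi_red E m).
move=> p4 p3 p2 p1 p0.
by rewrite !(hornerD, hornerN, hornerM, horner_exp) /=; case: (odd m) => /=; ring.
Qed.
End PsiValues.

Section EllipticSequence.
Variables (F : fieldType) (E : weierstrass F) (smoothE : smooth E).
Local Notation pt := (curve_point smoothE).
Variable P : pt.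
Local Notation X k := (px (P *+ k)).
Local Notation W := (psiv E (px P) (pw P)).

(** The multiples of index below [s] are then affine, and the abscissas of mP and nP differ when m +
    n < s. *)
Definition no_mul s := forall j, (0 < j < s)%N -> P *+ j != 0.

Lemma no_mul_le s t : (s <= t)%N -> no_mul t -> no_mul s.
Proof. by move=> st h j js; apply: h; lia. Qed.

Section NoMul.
Variables (s : nat) (Ps : no_mul s).

Lemma X_neq m n : (0 < n < m)%N -> (m + n < s)%N -> X m != X n.
Proof.
move=> nm ms; apply/eqP => e.
have Pm : P *+ m != 0 by apply: Ps; lia.
have Pn : P *+ n != 0 by apply: Ps; lia.
case: (px_eq Pm Pn e) => [emn|/eqP].
  have : P *+ (m - n) != 0 by apply: Ps; lia.
  by rewrite mulrnBr ?emn ?subrr ?eqxx //; lia.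
rewrite -addr_eq0 -mulrnDr => /eqP e0.
have : P *+ (m + n) != 0 by apply: Ps; lia.
by rewrite e0 eqxx.
Qed.

Lemma X1_sub_neq0 k : (1 < k)%N -> (k.+1 < s)%N -> X 1 - X k != 0.
Proof. by move=> k1 ks; rewrite subr_eq0 eq_sym X_neq ?addn1. Qed.

Lemma X_biquad m n z : (0 < n < m)%N -> (m + n < s)%N ->
  (X (m + n) - z) * (X (m - n) - z) * (X m - X n) ^+ 2 = biquad E (X m) (X n) z.
Proof.
move=> nm ms; rewrite mulrnDr mulrnBr; last by lia.
by apply: px_biquad; [apply: Ps; lia|apply: Ps; lia|apply: X_neq].
Qed.

Lemma P_neq0 : (1 < s)%N -> P != 0.
Proof. by move=> s1; have := Ps (j := 1); rewrite mulr1n; apply. Qed.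

Lemma pw_neq0 : (2 < s)%N -> pw P != 0.
Proof.
move=> s2; rewrite pw_eq0; last by apply: P_neq0; lia.
by apply: Ps.
Qed.
End NoMul.

(** The relation of elliptic divisibility sequences; for n = 1 it is the formula for x(mP). *)
Definition psi_diff m n := W (m + n) * W (m - n) = (X n - X m) * W m ^+ 2 * W n ^+ 2.
Definition psi_diffs s := forall m n, (0 < n < m)%N -> (m + n <= s)%N -> psi_diff m n.

(** For j > 2 the relation with indices j - 1 and 1 has a nonzero right-hand side: x((j - 1)P)
    differs from x(P), and W (j - 1) is nonzero by induction. *)
Lemma psiv_neq0 s : no_mul s -> psi_diffs s -> forall j, (0 < j < s)%N -> W j != 0.
Proof.
move=> Ps D; elim/ltn_ind => -[|[|[|j]]] IH js //.
- by rewrite psiv1 oner_eq0.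
- by rewrite psiv2 (pw_neq0 Ps).
have := D j.+2 1%N; rewrite /psi_diff addn1 subn1 /= psiv1 expr1n mulr1.
move=> /(_ isT (ltnW _)) e; apply: contraTneq isT => W0.
have /eqP : W j.+3 * W j.+1 = (X 1 - X j.+2) * W j.+2 ^+ 2 by apply: e; lia.
rewrite W0 mul0r eq_sym mulf_eq0 expf_eq0 /= (negPf (IH j.+2 _ _)) ?orbF; try lia.
by rewrite subr_eq0 eq_sym (negPf (X_neq Ps _ _)) //; lia.
Qed.

(** In the application [t] is W (m - n + 1). The multipliers of the two relations are [v * t] and
    [t * u], so the terms in [A] agree; the other terms agree by the last hypothesis, which is the
    symmetry of [biquad]. *)
Lemma psi_diff_chain_algebra (A u v t q r g h k Wm p o y z x1 xm xn : F) :
  v * t = (p - xm) * Wm ^+ 2 * q ^+ 2 -> t * u = (x1 - y) * r ^+ 2 ->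
  g * q = (x1 - xn) * h ^+ 2 -> k * r = (xn - xm) * Wm ^+ 2 * h ^+ 2 ->
  (o - xm) * (p - xm) * (xn - x1) ^+ 2 = (z - x1) * (y - x1) * (xm - xn) ^+ 2 ->
  ((p - xm) * Wm ^+ 2 * q ^+ 2) * (A * u - (o - xm) * Wm ^+ 2 * g ^+ 2)
  = ((x1 - y) * r ^+ 2) * (A * v - (x1 - z) * k ^+ 2).
Proof.
move=> e1 e2 e3 e4 e5.
apply: (eq_of_sub (d := A * (((p - xm) * Wm ^+ 2 * q ^+ 2 - v * t) * u
     - ((x1 - y) * r ^+ 2 - t * u) * v)
  - (p - xm) * (o - xm) * Wm ^+ 4 * ((g * q) ^+ 2 - ((x1 - xn) * h ^+ 2) ^+ 2)
  + (x1 - y) * (x1 - z) * ((k * r) ^+ 2 - ((xn - xm) * Wm ^+ 2 * h ^+ 2) ^+ 2)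
  - Wm ^+ 4 * h ^+ 4 * ((o - xm) * (p - xm) * (xn - x1) ^+ 2
                        - (z - x1) * (y - x1) * (xm - xn) ^+ 2))); last by ring.
by rewrite e1 e2 e3 e4 e5 !subrr !(mul0r, mulr0, subr0, addr0).
Qed.

(** Reduces the relations of index sum s + 1 to any single one of them, once those of smaller sum
    are known. *)
Lemma psi_diff_chain s m n : no_mul s.+1 -> psi_diffs s -> (0 < n)%N -> (n.+1 < m)%N ->
    (m + n.+1 = s.+1)%N ->
  psi_diff m n.+1 <-> psi_diff (m + n) 1.
Proof.
move=> Ps D n0 nm es; have W0 := psiv_neq0 (no_mul_le (leqnSn s) Ps) D.
have D1 k : (1 < k < s)%N -> W k.+1 * W k.-1 = (X 1 - X k) * W k ^+ 2.
  by move=> ks; have := D k 1%N; rewrite /psi_diff addn1 subn1 psiv1 expr1n mulr1; apply; lia.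
rewrite /psi_diff addn1 subn1 psiv1 expr1n mulr1.
have -> : (m + n.+1 = (m + n).+1)%N by lia.
have -> : (m - n.+1 = (m - n).-1)%N by lia.
have Wmn : W (m - n).-1 != 0 by apply: W0; lia.
have Wmn' : W (m + n).-1 != 0 by apply: W0; lia.
have Wm : W m != 0 by apply: W0; lia.
have Wmnn : W (m - n) != 0 by apply: W0; lia.
set A := W (m + n).+1; set u := W (m - n).-1; set v := W (m + n).-1.
suff [c1 [c2 [c10 c20 e]]] : exists c1 c2, [/\ c1 != 0, c2 != 0 &
    c1 * (A * u - (X n.+1 - X m) * W m ^+ 2 * W n.+1 ^+ 2)
    = c2 * (A * v - (X 1 - X (m + n)) * W (m + n) ^+ 2)].
  split=> /eqP; rewrite -subr_eq0 => /eqP z; apply/eqP; rewrite -subr_eq0; apply/eqP.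
    by move: e; rewrite z mulr0 => /esym/eqP; rewrite mulf_eq0 (negPf c20) => /eqP.
  by move: e; rewrite z mulr0 => /eqP; rewrite mulf_eq0 (negPf c10) => /eqP.
(* For n = 1 the general multiplier would contain W (n - 1) = W 0 = 0; this case has its own
   multipliers and relies on the duplication formula. *)
case: n n0 nm es @A @u @v Wmn Wmn' Wmnn => // -[|n] _ nm es A u v Wmn Wmn' Wmnn.
  exists (W m ^+ 2), ((X 1 - X m.-1) * W m.-1 ^+ 2); split.
  - exact: expf_neq0.
  - by rewrite mulf_neq0 ?expf_neq0 ?(X1_sub_neq0 Ps) ?W0 //; lia.
  have e1 : W m * W (m - 1).-1 = (X 1 - X m.-1) * W m.-1 ^+ 2.
    by rewrite subn1 -{1}(@prednK m) ?D1 //; lia.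
  have e2 : W m.+1 * W m.-1 = (X 1 - X m) * W m ^+ 2 by apply: D1; lia.
  have e5 : (X m.+1 - X 1) * (X m.-1 - X 1) * (X m - X 1) ^+ 2
      = pw P ^+ 2 * (X 2 - X m).
    have P0 : P != 0 by apply: (P_neq0 Ps); lia.
    have w0 : pw P != 0 by apply: (pw_neq0 Ps); lia.
    rewrite (biquad_double _ P0 w0) -addn1 -subn1 (X_biquad Ps) ?mulr1n; try lia.
    by rewrite [LHS]biquadCA [LHS]biquadC.
  rewrite /A /u /v addn1 psiv2.
  apply: (eq_of_sub (d := W m.+2 * W m * (W m * W (m - 1).-1 - (X 1 - X m.-1) * W m.-1 ^+ 2)
    + (X 1 - X m.-1) * (X 1 - X m.+1) * ((W m.+1 * W m.-1) ^+ 2 - ((X 1 - X m) * W m ^+ 2) ^+ 2)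
    + W m ^+ 4 * ((X m.+1 - X 1) * (X m.-1 - X 1) * (X m - X 1) ^+ 2
                  - pw P ^+ 2 * (X 2 - X m)))); last by ring.
  by rewrite e1 e2 e5 !subrr !mulr0 !addr0.
exists ((X n.+1 - X m) * W m ^+ 2 * W n.+1 ^+ 2), ((X 1 - X (m - n.+2)) * W (m - n.+2) ^+ 2).
split.
- have Xm : X n.+1 - X m != 0 by rewrite subr_eq0 eq_sym (X_neq Ps) //; lia.
  have Wn : W n.+1 != 0 by apply: W0; lia.
  have Wm2 := expf_neq0 2 Wm; have Wn2 := expf_neq0 2 Wn.
  by apply: mulf_neq0 => //; apply: mulf_neq0.
- by rewrite mulf_neq0 ?expf_neq0 // ?(X1_sub_neq0 Ps) //; lia.
apply: (@psi_diff_chain_algebra _ _ _ (W (m - n.+1)) _ _ _ (W n.+2) _ _ _ _ _ _ _ _ (X n.+2)).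
- have := D m n.+1; rewrite /psi_diff /v (_ : (m + n.+2).-1 = m + n.+1)%N; last by lia.
  by apply; lia.
- by rewrite /u -(D1 (m - n.+2)%N); [congr (W _ * W _)|]; lia.
- by apply: (D1 n.+2); lia.
- by apply: D; lia.
have := @X_biquad s.+1 Ps n.+2 1 (X m) ltac:(lia) ltac:(lia).
rewrite addn1 subn1 /= => ->.
have e := @X_biquad s.+1 Ps m n.+2 (X 1) ltac:(lia) ltac:(lia).
by rewrite e biquadC biquadCA.
Qed.

Lemma psi_diff_base2 : no_mul 3 -> psi_diff 2 1.
Proof.
move=> Ps; have P0 := P_neq0 Ps isT; have w0 := pw_neq0 Ps isT.
rewrite /psi_diff psiv3 psiv1 psiv2 (psi3_double P0 w0) -[1%N]/(1 + 0)%N mulr1n; ring.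
Qed.

Lemma psi_diff_base3 : no_mul 4 -> psi_diff 3 1.
Proof.
move=> Ps; have P0 := P_neq0 Ps isT; have w0 := pw_neq0 Ps isT.
have P2 : P *+ 2 != 0 by apply: Ps.
have nx : X 2 != px P by have := @X_neq _ Ps 2 1 isT isT; rewrite mulr1n.
have [_ _ s3 _] := px_addB P2 P0 nx.
rewrite -mulrSr mulr2n addrK -mulr2n in s3.
have nd : X 2 - px P != 0 by rewrite subr_eq0.
have d2 := px_double P0 w0; have wsq := pw_sq P0.
have nd2 : (X 2 - px P) ^+ 2 != 0 by rewrite expf_neq0.
rewrite /psi_diff psiv4 psiv3 psiv1 psiv2 mulr1n expr1n mulr1.
transitivity (2%:R * px P * (psi3 E).[px P] ^+ 2 - pw P ^+ 4 * xsum E (X 2) (px P)); last first.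
  by rewrite -s3 (psi3_double P0 w0); ring.
have -> : pw P ^+ 4 * xsum E (X 2) (px P) = 2%:R * px P * (X 2 * pw P ^+ 2) ^+ 2
    + (2%:R * px P ^+ 2 + b2 E * px P + b4 E) * (X 2 * pw P ^+ 2) * pw P ^+ 2
    + (b4 E * px P + b6 E) * pw P ^+ 2 * pw P ^+ 2 by rewrite /xsum; ring.
rewrite d2 -[LHS]mulrA -[pw P * pw P]expr2 wsq /xprod /psi3 /psi4_red /psi2_sq !hornerE /=
  ?hornerXn.
by rewrite /b8 /b6 /b4 /b2; ring.
Qed.

(** Modulo relations of smaller sum, the recurrence for W (s + 1) is the relation with the closest
    possible indices, (k + 1, k) or (k + 1, k - 1). The recurrences start at index 5, so the sums 3
    and 4 are computed directly. *)
Lemma psi_diffs_no_mul s : no_mul s -> psi_diffs s.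
Proof.
elim: s => [_ m n|s IH Ps m n nm]; first by lia.
have Ds := IH (no_mul_le (leqnSn s) Ps).
rewrite leq_eqVlt => /predU1P[es|lt]; last by apply: Ds; lia.
have chain m' n' : (0 < n' -> n'.+1 < m' -> m' + n' = s ->
    psi_diff m' n'.+1 <-> psi_diff (m' + n') 1)%N.
  by move=> n0 nm' e; apply: psi_diff_chain Ps Ds _ _ _ => //; lia.
suff top : psi_diff s 1.
  case: n nm es => // -[|n] nm es; first by rewrite (_ : m = s) //; lia.
  by apply/chain; try lia; rewrite (_ : (m + n.+1)%N = s) //; lia.
have [s4|s4] := leqP s 3.
  have s2 : (2 <= s)%N by lia.
  have [es2|es3] : s = 2 \/ s = 3 by lia.
    by rewrite es2 in Ps *; apply: psi_diff_base2.
  by rewrite es3 in Ps *; apply: psi_diff_base3.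
have W0 := psiv_neq0 (no_mul_le (leqnSn s) Ps) Ds.
have D1 k : (1 < k < s)%N -> W k.+1 * W k.-1 = (X 1 - X k) * W k ^+ 2.
  by move=> ks; have := Ds k 1%N; rewrite /psi_diff addn1 subn1 psiv1 expr1n mulr1; apply; lia.
have P0 : P != 0 by apply: (P_neq0 Ps); lia.
have w0 : pw P != 0 by apply: (pw_neq0 Ps); lia.
have wsq := pw_sq P0.
have := odd_double_half s.+1; move: s.+1./2 => k; case: (odd s.+1) => ek.
  have mid : psi_diff k.+1 k.-1.+1.
    rewrite prednK /psi_diff; last by lia.
    have -> : (k.+1 + k = k.*2.+1)%N by lia.
    have -> : (k.+1 - k = 1)%N by lia.
    rewrite psiv1 mulr1 psiv_odd //; last by lia.
    have e1 := D1 k.+1 ltac:(lia); have e2 := D1 k ltac:(lia).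
    apply: (eq_of_sub (d := (W k.+2 * W k - (X 1 - X k.+1) * W k.+1 ^+ 2) * W k ^+ 2
       - (W k.+1 * W k.-1 - (X 1 - X k) * W k ^+ 2) * W k.+1 ^+ 2)); last by ring.
    by rewrite -e1 -e2 /= !subrr !mul0r subrr.
  have -> : s = (k.+1 + k.-1)%N by lia.
  by apply: (proj1 (chain k.+1 k.-1 _ _ _)) => //; lia.
have mid : psi_diff k.+1 k.-2.+1.
  rewrite (_ : k.-2.+1 = k.-1) /psi_diff; last by lia.
  have -> : (k.+1 + k.-1 = k.*2)%N by lia.
  have -> : (k.+1 - k.-1 = 2)%N by lia.
  rewrite psiv2 psiv_even //; last by lia.
  have e1 := D1 k.+1 ltac:(lia); have e2 := D1 k.-1 ltac:(lia).
  rewrite prednK in e2; last by lia.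
  apply: (eq_of_sub (d := (W k.+2 * W k - (X 1 - X k.+1) * W k.+1 ^+ 2) * W k.-1 ^+ 2
     - (W k * W k.-2 - (X 1 - X k.-1) * W k.-1 ^+ 2) * W k.+1 ^+ 2)); last by ring.
  by rewrite -e1 -e2 /= !subrr !mul0r subrr.
have -> : s = (k.+1 + k.-2)%N by lia.
by apply: (proj1 (chain k.+1 k.-2 _ _ _)) => //; lia.
Qed.
End EllipticSequence.

(** * Leading terms and roots of the division polynomials *)

Section TopCoefs.
Variables (F : fieldType) (t : F).
Implicit Types (p q : {poly F}) (c : F) (d : nat).

(* When c != 0, the polynomial p has degree d and leading coefficient c, and the
   arithmetic mean of its roots is - t / 12. *)
Definition top2 p d c :=
  [/\ (size p <= d.+1)%N, p`_d = c & 12%:R * ('X * p)`_d = c * d%:R * t].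

Lemma coefM_top p q d e : (size p <= d.+1)%N -> (size q <= e.+1)%N ->
  (p * q)`_(d + e) = p`_d * q`_e.
Proof.
move=> sp sq; have lt : (d < (d + e).+1)%N by lia.
rewrite coefM (bigD1 (Ordinal lt)) //= addKn big1 ?addr0 // => i ni.
have [id|di] := ltnP i d; last first.
  rewrite [p`_i]nth_default ?mul0r // (leq_trans sp) //.
  by rewrite ltn_neqAle di andbT eq_sym.
rewrite [q`_(_)]nth_default ?mulr0 // (leq_trans sq) //; lia.
Qed.

Lemma size_mul_top p q d e : (size p <= d.+1)%N -> (size q <= e.+1)%N ->
  (size (p * q)%R <= (d + e).+1)%N.
Proof.
move=> sp sq; apply: leq_trans (size_polyMleq _ _) _.
by move: (size p) (size q) sp sq => a b; lia.
Qed.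

Lemma size_top p d c : c != 0 -> top2 p d c -> size p = d.+1.
Proof.
move=> c0 [sp ep _]; apply/eqP; rewrite eqn_leq sp /= ltnNge; apply: contra c0 => le.
by rewrite -ep nth_default.
Qed.

Lemma top2_neq0 p d c : c != 0 -> top2 p d c -> p != 0.
Proof. by move=> c0 /(size_top c0) s; rewrite -size_poly_eq0 s. Qed.

(** A Leibniz rule for the second coefficient; the factor X moves it to index d, with value 0 when d
    = 0. *)
Lemma coefXM_top2 p q d e : (size p <= d.+1)%N -> (size q <= e.+1)%N ->
  ('X * (p * q))`_(d + e) = p`_d * ('X * q)`_e + ('X * p)`_d * q`_e.
Proof.
move=> sp sq; set r := p - p`_d *: 'X^d.
have sr : (size ('X * r)%R <= d.+1)%N.
  have : (size r <= d)%N.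
    apply/leq_sizeP => j; rewrite leq_eqVlt => /predU1P[<-|lt].
      by rewrite coefB coefZ coefXn eqxx mulr1 subrr.
    by rewrite coefB coefZ coefXn gtn_eqF // mulr0 subr0 nth_default // (leq_trans sp).
  move=> sr; apply: leq_trans (size_polyMleq _ _) _.
  by rewrite size_polyX; move: (size r) sr => a; lia.
have -> : 'X * (p * q) = p`_d *: ('X^d * ('X * q)) + ('X * r) * q.
  by rewrite /r -!mul_polyC; ring.
rewrite coefD coefZ coefXnM ltnNge leq_addr /= addKn coefM_top //; congr (_ + _ * _).
rewrite /r mulrBr coefB -scalerAr coefZ -exprS coefXn.
by rewrite ltn_eqF // mulr0 subr0.
Qed.

(** Minus the sum of the roots, here d t / 12, is additive under products. The condition therefore
    passes through the recurrences, whose differences have terms of equal degree. *)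
Lemma top2M p q d e c c' : top2 p d c -> top2 q e c' -> top2 (p * q) (d + e) (c * c').
Proof.
case=> sp ep tp [sq eq tq]; split; first exact: size_mul_top.
  by rewrite coefM_top // ep eq.
rewrite coefXM_top2 // ep eq mulrDr mulrCA tq mulrA tp natrD; ring.
Qed.

Lemma top2_1 : top2 1 0 1.
Proof. by split; rewrite ?size_poly1 ?coef1 // mulr1 coefX !mulr0 mul0r. Qed.

Lemma top2X p d c k : top2 p d c -> top2 (p ^+ k) (k * d) (c ^+ k).
Proof.
move=> h; elim: k => [|k IH]; first by rewrite mul0n; apply: top2_1.
by rewrite !exprS mulSn; apply: top2M.
Qed.

Lemma top2B p q d c c' : top2 p d c -> top2 q d c' -> top2 (p - q) d (c - c').
Proof.
case=> sp ep tp [sq eq tq]; split.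
- by rewrite (leq_trans (size_polyD _ _)) // size_polyN geq_max sp.
- by rewrite coefB ep eq.
- by rewrite mulrBr coefB mulrBr tp tq -!mulrBl.
Qed.

Lemma top2B_eq p q d d' c c' e l : top2 p d c -> top2 q d' c' ->
  d = e -> d' = e -> c - c' = l -> top2 (p - q) e l.
Proof. by move=> hp hq ed ed' <-; apply: top2B; rewrite -?ed // ed -ed'. Qed.

Lemma top2_eq p d c d' c' : top2 p d c -> d = d' -> c = c' -> top2 p d' c'.
Proof. by move=> h <- <-. Qed.
End TopCoefs.

Section PsiDegree.
Variables (F : fieldType) (E : weierstrass F).
Local Notation top2 := (top2 (b2 E)).
Local Notation psq := (psi2_sq E).

(** The origin of the 12 in [top2]: the top coefficients are 4 and b2, and 12 b2 = 4 * 3 * b2. *)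
Lemma psi2_sq_top2 : top2 psq 3 4%:R.
Proof.
split.
- rewrite /psi2_sq; apply/leq_sizeP => j j4.
  rewrite !coefD !coefZ !coefXn coefX coefC.
  by rewrite !gtn_eqF ?mulr0 ?addr0 //; lia.
- by rewrite !coefD !coefZ !coefXn coefX coefC /= !mulr0 !addr0 mulr1.
- by rewrite coefXM !coefD !coefZ !coefXn coefX coefC /= !mulr0 !addr0; ring.
Qed.

Lemma psi3_top2 : top2 (psi3 E) 4 3%:R.
Proof.
split.
- rewrite /psi3; apply/leq_sizeP => j j4.
  rewrite !coefD !coefZ !coefXn coefX coefC.
  by rewrite !gtn_eqF ?mulr0 ?addr0 //; lia.
- by rewrite !coefD !coefZ !coefXn coefX coefC /= !mulr0 !addr0 mulr1.
- by rewrite coefXM !coefD !coefZ !coefXn coefX coefC /= !mulr0 !addr0; ring.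
Qed.

Lemma psi4_red_top2 : top2 (psi4_red E) 6 2%:R.
Proof.
split.
- rewrite /psi4_red; apply/leq_sizeP => j j4.
  rewrite !coefD !coefZ !coefXn coefX coefC.
  by rewrite !gtn_eqF ?mulr0 ?addr0 //; lia.
- by rewrite !coefD !coefZ !coefXn coefX coefC /= !mulr0 !addr0 mulr1.
- by rewrite coefXM !coefD !coefZ !coefXn coefX coefC /= !mulr0 !addr0; ring.
Qed.

(** Degree (n^2 - 1) / 2 and leading coefficient n for n = 2 j + 1; degree (n^2 - 4) / 2 and leading
    coefficient n / 2 for n = 2 i + 2, where the factor psi_2 is removed. *)
Local Notation top2_odd j :=
  (top2 (psi_red E j.*2.+1) (2 * j * j.+1) j.*2.+1%:R).
Local Notation top2_even i :=
  (top2 (psi_red E i.+1.*2) (2 * i * i.+2) i.+1%:R).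

Lemma psi_red_top2_step j :
  (forall i, (i < j)%N -> top2_odd i) -> (forall i, (i.+1 < j)%N -> top2_even i) ->
  (top2_odd j) /\ (0 < j -> top2_even j.-1)%N.
Proof.
move=> To Te.
have psq2 := top2X 2 psi2_sq_top2.
have oE i : odd i.*2 = false by rewrite odd_double.
have cases : j = 0%N \/ j = 1%N \/ j = 2%N \/
    exists i, j = i.*2.+3 \/ j = i.*2.+4.
  move: {To Te} j => [|[|[|j]]]; [by left|by right; left|by right; right; left|].
  right; right; right; exists j./2; have := odd_double_half j.
  by case: (odd j); lia.
case: cases To Te => [->|[->|[->|[i [->|->]]]]] To Te.
- by split=> //; apply: top2_1.
- by split=> [|_]; [exact: psi3_top2|exact: top2_1].
- split=> [|_]; last exact: psi4_red_top2.
  rewrite psi_red_odd //=.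
  have A := top2M (top2M psi4_red_top2 (top2X 3 (Te 0%N isT))) psq2.
  have B := top2M (top2M (top2_1 (b2 E)) (top2X 3 psi3_top2)) (top2_1 (b2 E)).
  by apply: (top2B_eq A B) => //; change 2.*2.+1 with 5%N; ring.
- have T2 := To i.+2 ltac:(lia); have T0 := To i.+1 ltac:(lia).
  have T_2 := To i ltac:(lia).
  have T1 := Te i.+1 ltac:(lia); have T_1 := Te i ltac:(lia).
  rewrite !doubleS in T2 T0 T_2 T1 T_1.
  split=> [|_].
    rewrite psi_red_odd //= !negbK oE /=.
    have A := top2M (top2M T2 (top2X 3 T0)) (top2_1 (b2 E)).
    have B := top2M (top2M T_1 (top2X 3 T1)) psq2.
    by apply: (top2B_eq A B); [lia|lia|rewrite -!addnn; ring].
  rewrite prednK // psi_red_even //=.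
  have A := top2M T2 (top2X 2 T_1); have B := top2M T_2 (top2X 2 T1).
  apply: (top2_eq (top2M T0 (top2B_eq A B _ erefl erefl))); [|lia|rewrite -!addnn; ring].
  lia.
- have T2 := Te i.+2 ltac:(lia); have T0 := Te i.+1 ltac:(lia).
  have T_2 := Te i ltac:(lia).
  have T1 := To i.+2 ltac:(lia); have T_1 := To i.+1 ltac:(lia).
  rewrite !doubleS in T2 T0 T_2 T1 T_1.
  split=> [|_].
    rewrite psi_red_odd //= !negbK oE /=.
    have A := top2M (top2M T2 (top2X 3 T0)) psq2.
    have B := top2M (top2M T_1 (top2X 3 T1)) (top2_1 (b2 E)).
    by apply: (top2B_eq A B); [lia|lia|rewrite -!addnn; ring].
  rewrite prednK // psi_red_even //=.
  have A := top2M T2 (top2X 2 T_1); have B := top2M T_2 (top2X 2 T1).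
  apply: (top2_eq (top2M T0 (top2B_eq A B _ erefl erefl))); [|lia|rewrite -!addnn; ring].
  lia.
Qed.

Lemma psi_red_top2_both j : (top2_odd j) /\ (0 < j -> top2_even j.-1)%N.
Proof.
elim/ltn_ind: j => j IH; apply: psi_red_top2_step => i ij; first by have [] := IH i ij.
by have [_ /(_ isT)] := IH i.+1 ij.
Qed.

Lemma psi_red_odd_top2 j : top2_odd j.
Proof. by have [] := psi_red_top2_both j. Qed.
Lemma psi_red_even_top2 i : top2_even i.
Proof. by have [_ /(_ isT)] := psi_red_top2_both i.+1. Qed.
End PsiDegree.

(** * From generic points to all affine points *)

Section Density.
Variables (F : closedFieldType) (E : weierstrass F) (smoothE : smooth E).
Hypothesis char0 : [pchar F] =i pred0.
Local Notation pt := (curve_point smoothE).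
Local Notation W P := (psiv E (px P) (pw P)).
Implicit Types P Q : pt.

Lemma natr_inj_char0 : injective (fun n : nat => n%:R : F).
Proof.
have h m n : (m <= n)%N -> m%:R = n%:R :> F -> m = n.
  move=> le e; apply/eqP; rewrite eqn_leq le /= -subn_eq0 -((pcharf0P F).1 char0).
  by rewrite natrB // e subrr.
by move=> m n e; case: (leqP m n) => [/h|/ltnW /h h']; [apply|apply/esym/h'].
Qed.

Lemma poly_eq0_char0 (g : {poly F}) : (forall x, g.[x] = 0) -> g = 0.
Proof.
move=> g0; apply/eqP/negPn/negP => gn.
have u : uniq [seq i%:R : F | i <- iota 0 (size g)].
  by rewrite map_inj_uniq ?iota_uniq //; apply: natr_inj_char0.
have al : all (root g) [seq i%:R : F | i <- iota 0 (size g)].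
  by apply/allP => x _; apply/rootP.
by have := max_poly_roots gn al u; rewrite size_map size_iota ltnn.
Qed.

Lemma curve_point_lift x : exists2 P : pt, P != 0 & px P = x.
Proof.
pose c i := if i == 0%N then x ^+ 3 + a2 E * x ^+ 2 + a4 E * x + a6 E
            else - (a1 E * x + a3 E).
have [y] := @solve_monicpoly F 2 c isT; rewrite big_ord_recl big_ord1 /c /= => ey.
have cP : on_curve E (Some (x, y)).
  by rewrite /= /weq ey; apply/eqP; rewrite /bump /=; ring.
by exists (exist _ (Some (x, y)) cP : pt).
Qed.

Lemma char0_unit (n : nat) : n.+1%:R != 0 :> F.
Proof. by rewrite ((pcharf0P F).1 char0). Qed.

Lemma psi_red_neq0 k : (0 < k)%N -> psi_red E k != 0.
Proof.
move=> k0; have ek := odd_double_half k; rewrite -ek; case: (odd k) ek => ek.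
  by apply: top2_neq0 (psi_red_odd_top2 E k./2); apply: char0_unit.
rewrite add0n -[k./2]prednK; last by lia.
by apply: top2_neq0 (psi_red_even_top2 E k./2.-1); apply: char0_unit.
Qed.

Lemma psi2_sq_neq0 : psi2_sq E != 0.
Proof. by apply: top2_neq0 (psi2_sq_top2 E); apply: char0_unit. Qed.

(** Its finitely many roots include the abscissas of all affine points with a vanishing multiple of
    positive index at most [M]. *)
Definition bad_poly M := psi2_sq E * \prod_(k < M) psi_red E k.+1.

Lemma bad_poly_neq0 M : bad_poly M != 0.
Proof.
rewrite /bad_poly mulf_neq0 ?psi2_sq_neq0 // prodf_seq_neq0.
by apply/allP => k _; rewrite psi_red_neq0.
Qed.

Lemma no_mul_generic M P : P != 0 -> (bad_poly M).[px P] != 0 -> no_mul P M.+1.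
Proof.
move=> P0; rewrite /bad_poly hornerM mulf_eq0 negb_or horner_prod => /andP[w0 pr0].
rewrite -(pw_sq P0) expf_eq0 /= in w0.
have p0 k : (0 < k <= M)%N -> (psi_red E k).[px P] != 0.
  move=> kM; have kM' : (k.-1 < M)%N by lia.
  move: pr0; rewrite prodf_seq_neq0 => /allP/(_ (Ordinal kM')).
  by rewrite mem_index_enum /= prednK; [apply|lia].
have Wn0 k : (0 < k <= M)%N -> W P k != 0.
  by move=> kM; rewrite /psiv mulf_neq0 ?p0 //; case: ifP; rewrite ?oner_eq0.
suff: forall s, (s <= M.+1)%N -> no_mul P s by apply.
elim=> [_ j|s IH sM]; first by lia.
have Ps := IH (ltnW sM); move=> j /andP[j0]; rewrite ltnS leq_eqVlt.
case/predU1P => [ej|js]; last by apply: Ps; rewrite j0.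
subst j; case: s j0 sM Ps {IH} => [|[|[|s]]] // _ sM Ps.
  by rewrite -pw_eq0.
apply/eqP => Ps0; have Ds := psi_diffs_no_mul Ps.
have := Ds s.+2 1%N isT; rewrite /psi_diff addn1 subn1 leqnn => /(_ isT) /eqP.
have -> : px (P *+ s.+2) = px (P *+ 1).
  by move/eqP: Ps0; rewrite mulrS addrC addr_eq0 => /eqP ->; rewrite px_opp.
rewrite subrr !mul0r mulf_eq0 (negPf (Wn0 _ _)) //=.
by rewrite (negPf (psiv_neq0 Ps Ds _)) //; lia.
Qed.

(** [g * bad_poly M] vanishes at all abscissas, and every element of a closed field is an
    abscissa. *)
Lemma generic_poly_eq0 M (g : {poly F}) :
  (forall P, P != 0 -> pw P != 0 -> no_mul P M.+1 -> g.[px P] = 0) -> g = 0.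
Proof.
move=> h; apply/eqP; have := mulf_eq0 g (bad_poly M); rewrite (negPf (bad_poly_neq0 M)) orbF.
move=> <-; apply/eqP/poly_eq0_char0 => x; have [P P0 <-] := curve_point_lift x.
rewrite hornerM; have [->|b0] := eqVneq (bad_poly M).[px P] 0; first by rewrite mulr0.
rewrite h ?mul0r //; last exact: no_mul_generic.
move: b0; rewrite /bad_poly hornerM mulf_eq0 negb_or => /andP[].
by rewrite -(pw_sq P0) expf_eq0.
Qed.

Lemma psi_diff_one s P k : no_mul P s -> (1 < k < s)%N ->
  W P k.+1 * W P k.-1 = (px (P *+ 1) - px (P *+ k)) * W P k ^+ 2.
Proof.
move=> Ps ks; have := psi_diffs_no_mul Ps.
move/(_ k 1%N); rewrite /psi_diff addn1 subn1 psiv1 expr1n mulr1.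
by apply; lia.
Qed.

(** The factor psi_2 ^ 2 which turns psi_j psi_k into a polynomial in x when j and k are both
    even. *)
Definition psi_par k : {poly F} := if odd k then 1 else psi2_sq E.

Lemma psiv_mul P j k : P != 0 -> odd j = odd k ->
  W P j * W P k = (psi_red E j * psi_red E k * psi_par k).[px P].
Proof.
move=> P0 e; rewrite /psiv /psi_par e !hornerM; case: (odd k); rewrite ?hornerC -?pw_sq //.
  by rewrite !mulr1.
by ring.
Qed.

(** At generic points this combines the relations with indices (m, 2) and (m, 1), eliminating x(mP);
    being free of division it extends to torsion points. *)
Lemma psiv_somos P m : P != 0 -> (1 < m)%N ->
  W P m.+2 * W P m.-2
  = pw P ^+ 2 * (W P m.+1 * W P m.-1) - (psi3 E).[px P] * (W P m * W P m).
Proof.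
move=> P0 m1.
pose G := psi_red E m.+2 * psi_red E m.-2 * psi_par m.+2
  - (psi2_sq E * (psi_red E m.+1 * psi_red E m.-1 * psi_par m.-1)
     - psi3 E * (psi_red E m * psi_red E m * psi_par m)).
have EG (Q : pt) : Q != 0 -> G.[px Q] = W Q m.+2 * W Q m.-2
    - (pw Q ^+ 2 * (W Q m.+1 * W Q m.-1) - (psi3 E).[px Q] * (W Q m * W Q m)).
  move=> Q0; rewrite !psiv_mul //; [|lia|lia].
  rewrite /G (_ : psi_par m.+2 = psi_par m.-2); last by rewrite /psi_par /= negbK;
    congr (if _ then _ else _); lia.
  rewrite (pw_sq Q0); move: (psi2_sq E) (psi3 E) => q r.
  move: (psi_par _) (psi_par _) (psi_par _) => e1 e2 e3.
  move: (psi_red E _) (psi_red E _) (psi_red E _) (psi_red E _) (psi_red E _) => p1 p2 p3 p4 p5.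
  by rewrite !(hornerD, hornerN, hornerM).
apply/eqP; rewrite -subr_eq0 -EG //; apply/eqP.
rewrite (_ : G = 0) ?horner0 //; apply: (@generic_poly_eq0 m.+2) => Q Q0 w0 Qs.
rewrite EG //; apply/eqP; rewrite subr_eq0; apply/eqP.
rewrite (psi3_double Q0 w0).
have e1 := psi_diff_one Qs (k := m) ltac:(lia); rewrite mulr1n in e1.
rewrite e1; have [->|m2] := eqVneq m 2.
  by rewrite /= psiv0 psiv2; ring.
have := psi_diffs_no_mul Qs; move/(_ m 2); rewrite /psi_diff psiv2.
have -> : (m + 2 = m.+2)%N by lia.
have -> : (m - 2 = m.-2)%N by lia.
move=> ->; [|lia|lia].
by ring.
Qed.

(** Half of the derivative of psi_2 ^ 2 at the abscissa of P. *)
Definition psi_slope P : F := 6%:R * px P ^+ 2 + b2 E * px P + b4 E.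

(** At generic points, after multiplication by W m, this is the formula for x((m + 1)P) + x((m -
    1)P), with the abscissas of the multiples expressed by the W. *)
Lemma psiv_cubic P m : P != 0 -> (1 < m)%N ->
  W P m.+2 * W P m.-1 ^+ 2 + W P m.-2 * W P m.+1 ^+ 2
  = W P m * (psi_slope P * (W P m.+1 * W P m.-1) - pw P ^+ 2 * W P m ^+ 2).
Proof.
move=> P0 m1.
pose L : {poly F} := 6%:R *: 'X^2 + b2 E *: 'X + (b4 E)%:P.
have EL (Q : pt) : L.[px Q] = psi_slope Q.
  by rewrite /L /psi_slope !hornerE /= ?hornerXn.
(* The powers of psi_2 are collected by parity: the difference of the two sides is [G] for odd m,
   and psi_2 times [G] for even m. *)
pose G := (if odd m then psi2_sq E else 1) * (psi_red E m.+2 * psi_red E m.-1 ^+ 2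
    + psi_red E m.-2 * psi_red E m.+1 ^+ 2
    - psi_red E m * (L * (psi_red E m.+1 * psi_red E m.-1)))
  + psi2_sq E * psi_par m * psi_red E m ^+ 3.
have EG (Q : pt) : Q != 0 -> G.[px Q] * (if odd m then 1 else pw Q) =
  W Q m.+2 * W Q m.-1 ^+ 2 + W Q m.-2 * W Q m.+1 ^+ 2
  - W Q m * (psi_slope Q * (W Q m.+1 * W Q m.-1) - pw Q ^+ 2 * W Q m ^+ 2).
  move=> Q0; rewrite /G /psiv /psi_par -EL; move: (pw_sq Q0) L {EL G} => ew L.
  have -> : odd m.+2 = odd m by rewrite /= negbK.
  have -> : odd m.-2 = odd m by lia.
  have -> : odd m.-1 = ~~ odd m by lia.
  rewrite [odd m.+1]/=; move: (psi2_sq E) (pw Q) ew (odd m) => q w ew b.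
  move: (psi_red E _) (psi_red E _) (psi_red E _) (psi_red E _) (psi_red E _) => p1 p2 p3 p4 p5.
  by case: b; rewrite !(hornerD, hornerN, hornerM, horner_exp, hornerC) /= -ew; ring.
apply/eqP; rewrite -subr_eq0 -EG //; apply/eqP.
rewrite (_ : G = 0) ?horner0 ?mul0r //; apply: (@generic_poly_eq0 m.+2) => Q Q0 w0 Qs.
have par0 : (if odd m then 1 else pw Q) != 0 by case: ifP => _; rewrite ?oner_eq0.
apply: (mulIf par0); rewrite mul0r EG //.
have Wm : W Q m != 0 by apply: psiv_neq0 Qs (psi_diffs_no_mul Qs) _ _; lia.
apply: (mulfI Wm); rewrite mulr0.
have e0 := psi_diff_one Qs (k := m) ltac:(lia).
have e1 := psi_diff_one Qs (k := m.+1) ltac:(lia).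
have e2 : W Q m * W Q m.-2 = (px (Q *+ 1) - px (Q *+ m.-1)) * W Q m.-1 ^+ 2.
  have [->|m2] := eqVneq m 2; first by rewrite /= psiv0 subrr mulr0 mul0r.
  by rewrite -(psi_diff_one Qs); [congr (W Q _ * _)|]; lia.
rewrite !mulr1n in e0 e1 e2.
have mQ0 : Q *+ m != 0 by apply: Qs; lia.
have nx : px (Q *+ m) != px Q.
  by have := @X_neq _ _ _ _ _ Qs m 1; rewrite mulr1n; apply; lia.
have [_ _ sm _] := px_addB mQ0 Q0 nx.
have eS : Q *+ m + Q = Q *+ m.+1 by rewrite mulrSr.
have eB : Q *+ m - Q = Q *+ m.-1 by rewrite -[in Q *+ m](@prednK m) ?mulrSr ?addrK //; lia.
rewrite eS eB in sm.
rewrite [m.+1.-1]/= in e1.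
have ew : pw Q ^+ 2 = 4%:R * px Q ^+ 3 + b2 E * px Q ^+ 2 + 2%:R * b4 E * px Q + b6 E.
  by rewrite pw_sq // /psi2_sq !(hornerD, hornerZ, hornerX, hornerXn, hornerC); ring.
rewrite /psi_slope.
move: (W Q m.+2) (W Q m.+1) (W Q m) (W Q m.-1) (W Q m.-2) e0 e1 e2 => A D M B C e0 e1 e2.
move: (px (Q *+ m)) (px (Q *+ m.+1)) (px (Q *+ m.-1)) (px Q) (pw Q) e0 e1 e2 sm ew.
move=> xm xp xn x w e0 e1 e2 sm ew.
apply: (eq_of_sub (d := (A * M - (x - xp) * D ^+ 2) * B ^+ 2
  + (M * C - (x - xn) * B ^+ 2) * D ^+ 2
  + (2%:R * x - xp - xn) * ((D * B) ^+ 2 - ((x - xm) * M ^+ 2) ^+ 2)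
  - M ^+ 2 * (6%:R * x ^+ 2 + b2 E * x + b4 E) * (D * B - (x - xm) * M ^+ 2)
  - M ^+ 4 * ((xp + xn) * (xm - x) ^+ 2 - xsum E xm x)
  + M ^+ 4 * (w ^+ 2 - (4%:R * x ^+ 3 + b2 E * x ^+ 2 + 2%:R * b4 E * x + b6 E)))).
  by rewrite e0 e1 e2 sm ew !subrr !(mul0r, mulr0, addr0, subr0).
by rewrite /xsum; ring.
Qed.

(** Nonzero neighbours at a zero of W k are part of the claim because the induction restarts from
    them on the other side. *)
Definition psi_claim P k :=
  if P *+ k == 0 then W P k = 0 /\ W P k.+1 * W P k.-1 != 0
  else W P k != 0 /\ W P k.+1 * W P k.-1 = (px P - px (P *+ k)) * W P k ^+ 2.

(** The identity [psi_slope ^ 2 = (12 x + b2) psi_2 ^ 2 - 4 psi_3] turns a common zero of psi_2 and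
    psi_3 into a singular point. *)
Lemma psi3_neq0 P : P != 0 -> pw P = 0 -> (psi3 E).[px P] != 0.
Proof.
move=> P0 w0; have [_ cP] := pt_affine P0; have := smoothE cP w0; apply: contra => /eqP e.
have es := pw_sq P0; rewrite w0 expr0n /= in es.
have g0 : psi_slope P ^+ 2 = 0.
  apply: (eq_of_sub (d := (12%:R * px P + b2 E) * (psi2_sq E).[px P] - 4%:R * (psi3 E).[px P])).
    by rewrite -es e !mulr0 subr0.
  rewrite /psi_slope /psi2_sq /psi3 !(hornerD, hornerZ, hornerX, hornerXn, hornerC).
  by rewrite /b8 /b6 /b4 /b2; ring.
have {}g0 : psi_slope P = 0 by apply/eqP; have := expf_eq0 (psi_slope P) 2;
  rewrite g0 eqxx => /esym/andP[].
apply/eqP; apply: (mulfI (char0_unit 1)); rewrite mulr0;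
  apply: (eq_of_sub (d := psi_slope P - a1 E * pw P)).
  by rewrite g0 w0 mulr0 subr0.
by rewrite /psi_slope /pw /b2 /b4; ring.
Qed.

(** Induction on two consecutive indices. The two identities centred at k + 2 give access to W (k +
    4), and the argument depends on which of (k + 1)P, (k + 2)P and (k + 3)P vanish. *)
Lemma psi_claimP P k : P != 0 -> (0 < k)%N -> psi_claim P k.
Proof.
move=> P0; suff: psi_claim P k.+1 /\ ((0 < k)%N -> psi_claim P k) by case.
have x1 : px (P *+ 1) = px P by rewrite mulr1n.
elim: k => [|k [IH1 IH0]].
  by split=> //; rewrite /psi_claim mulr1n (negPf P0) psiv1 psiv0 mulr0 subrr mul0r oner_eq0.
split=> [|_ //]; have [k0|k0] := posnP k.
  rewrite k0 /psi_claim psiv2 psiv3 psiv1 mulr1 -pw_eq0 //.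
  case: eqP => [w0|/eqP w0]; first by split=> //; apply: psi3_neq0.
  by split=> //; apply: psi3_double.
have {IH0} IH0 := IH0 k0; move: IH0 IH1; case: k k0 => // k _.
rewrite /psi_claim [k.+2.-1]/= [k.+1.-1]/= [k.+3.-1]/=.
have M1 : (1 < k.+2)%N by [].
have I1 := psiv_somos P0 M1; have I2 := psiv_cubic P0 M1.
rewrite [k.+2.-1]/= [k.+2.-2]/= in I1 I2.
have w2 : (P *+ 2 == 0) = (pw P == 0) by rewrite -pw_eq0.
have eS j : P *+ j.+1 = P *+ j + P by rewrite mulrSr.
have eB j : P *+ j = P *+ j.+1 - P by rewrite mulrSr addrK.
have PM : P *+ k.+1 = P *+ k.+2 - P by rewrite -eB.
have PMS : P *+ k.+3 = P *+ k.+2 + P by rewrite -eS.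
have e2 : P *+ 2 = P + P by rewrite mulr2n.
case: (eqVneq (P *+ k.+2) 0) => [kP|kP].
  move=> _ [WM]; rewrite mulf_eq0 negb_or => /andP[W1 _].
  rewrite PMS kP add0r (negPf P0); split=> //.
  by rewrite WM mulr0 subrr mul0r.
(* If (k + 3)P = 0 then (k + 2)P = - P, and [eM] kills W (k + 3) or W (k + 1). When (k + 1)P = 0 as
   well, P has order 2: the cubic identity with psi_2 = 0 gives W (k + 3) = 0, and psi_3, nonzero
   there, keeps W (k + 4) away from 0. *)
move=> IH0 [WM eM]; case: (eqVneq (P *+ k.+3) 0) => [kP1|kP1].
  have ekP : P *+ k.+2 = - P by apply/eqP; rewrite -addr_eq0 -PMS kP1.
  move: eM; rewrite ekP px_opp subrr mul0r => /eqP; rewrite mulf_eq0.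
  move: IH0; case: (eqVneq (P *+ k.+1) 0) => [kmP|kmP].
    have P2 : P *+ 2 = 0 by apply/eqP; rewrite e2 -oppr_eq0 opprD -{1}ekP -PM kmP.
    have w0 : pw P = 0 by apply/eqP; rewrite -w2 P2.
    case=> Wk1; rewrite mulf_eq0 negb_or => /andP[_ Wk] _.
    have wz : pw P ^+ 2 = 0 by rewrite w0 expr0n.
    move: I1 I2; rewrite Wk1 wz !(mulr0, mul0r, expr0n) /=.
    rewrite !(subr0, mulr0, add0r, oppr0) => I1 /eqP.
    rewrite mulf_eq0 (negPf Wk) expf_eq0 /= => /eqP W3; split=> //.
    apply/eqP => /eqP; rewrite mulf_eq0 (negPf WM) orbF => /eqP W4.
    have nz := mulf_neq0 (psi3_neq0 P0 w0) (mulf_neq0 WM WM).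
    by move: I1; rewrite W4 mul0r => /esym/eqP; rewrite oppr_eq0 (negPf nz).
  case=> Wk1 _; rewrite (negPf Wk1) orbF => /eqP W3; split=> //.
  have w0 : pw P != 0.
    by rewrite -w2 e2 -oppr_eq0 opprD -{1}ekP -PM.
  move: I2; rewrite W3 !(mulr0, expr0n, mul0r) /= !(mulr0, addr0, sub0r) => I2.
  apply/eqP => /eqP; rewrite mulf_eq0 (negPf WM) orbF => /eqP W4.
  have nz := mulf_neq0 WM (mulf_neq0 (expf_neq0 2 w0) (expf_neq0 2 WM)).
  by move: I2; rewrite W4 mul0r mulrN => /esym/eqP; rewrite oppr_eq0 (negPf nz).
(* If (k + 1)P = 0 then (k + 2)P = P and (k + 3)P = 2P, and both identities simplify because W (k +
   1) = 0. *)
move: IH0; case: (eqVneq (P *+ k.+1) 0) => [kmP|kmP].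
  have ekP : P *+ k.+2 = P by apply/eqP; rewrite -subr_eq0 -PM kmP.
  have e22 : P *+ k.+3 = P *+ 2 by rewrite PMS ekP e2.
  have w0 : pw P != 0 by rewrite -w2 -e22.
  case=> Wk1; rewrite mulf_eq0 negb_or => /andP[_ Wk].
  move: I1 I2; rewrite Wk1 (psi3_double P0 w0) e22 !(mulr0, expr0n, mul0r) /=.
  rewrite !(mulr0, add0r) => I1 I2.
  split.
    have nz := mulf_neq0 WM (mulf_neq0 (expf_neq0 2 w0) (expf_neq0 2 WM)).
    apply/eqP => W3; move: I2; rewrite W3 expr0n mulr0 mulrN => /esym/eqP.
    by rewrite oppr_eq0 (negPf nz).
  apply: (mulfI Wk).
  apply: (eq_of_sub (d := W P k.+2 * (W P k.+4 * W P k + (px P - px (P *+ 2)) * pw P ^+ 2 * (W P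
    k.+2 * W P k.+2))
    - (px P - px (P *+ 2)) * (W P k * W P k.+3 ^+ 2 + W P k.+2 * (pw P ^+ 2 * W P k.+2 ^+ 2)))).
    by rewrite I1 I2 addNr mulrN addNr !mulr0 subr0.
  by ring.
case=> Wk1 ek1.
have nx : px (P *+ k.+2) != px P.
  apply/eqP => e; case: (px_eq kP P0 e) => e'.
    by move: kmP; rewrite PM e' subrr eqxx.
  by move: kP1; rewrite PMS e' addNr eqxx.
have d0 : px P - px (P *+ k.+2) != 0 by rewrite subr_eq0 eq_sym.
split.
  have nz := mulf_neq0 d0 (expf_neq0 2 WM).
  by apply/eqP => W3; move: eM; rewrite W3 mul0r => /esym/eqP; rewrite (negPf nz).
have [_ _ sm _] := px_addB kP P0 nx; rewrite -PM -PMS in sm.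
have ew : pw P ^+ 2 = 4%:R * px P ^+ 3 + b2 E * px P ^+ 2 + 2%:R * b4 E * px P + b6 E.
  by rewrite pw_sq // /psi2_sq !(hornerD, hornerZ, hornerX, hornerXn, hornerC); ring.
apply: (mulfI (expf_neq0 2 Wk1)).
rewrite /psi_slope in I2.
move: I2 ek1 eM sm.
move: (W P k.+4) (W P k.+3) (W P k.+2) (W P k.+1) (W P k) => A D Mv B C.
move: (px (P *+ k.+2)) (px (P *+ k.+3)) (px (P *+ k.+1)) (px P) (pw P) ew.
move=> xm xp xn x w ew I2 ek1 eM sm.
apply: (eq_of_sub (d := Mv * (A * B ^+ 2 + C * D ^+ 2
     - Mv * ((6%:R * x ^+ 2 + b2 E * x + b4 E) * (D * B) - w ^+ 2 * Mv ^+ 2))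
  - (Mv * C - (x - xn) * B ^+ 2) * D ^+ 2
  - (2%:R * x - xp - xn) * ((D * B) ^+ 2 - ((x - xm) * Mv ^+ 2) ^+ 2)
  + Mv ^+ 2 * (6%:R * x ^+ 2 + b2 E * x + b4 E) * (D * B - (x - xm) * Mv ^+ 2)
  + Mv ^+ 4 * ((xp + xn) * (xm - x) ^+ 2 - xsum E xm x)
  - Mv ^+ 4 * (w ^+ 2 - (4%:R * x ^+ 3 + b2 E * x ^+ 2 + 2%:R * b4 E * x + b6 E)))).
  by rewrite I2 ek1 eM sm ew !subrr !(mul0r, mulr0, addr0, subr0).
by rewrite /xsum; ring.
Qed.
End Density.

Section ClosedSimpleRoots.
Variable F : closedFieldType.

Lemma simple_roots_factor (g : {poly F}) : g != 0 ->
  (forall r, root g r -> ~~ root g^`() r) ->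
  exists s, [/\ uniq s, g = lead_coef g *: \prod_(z <- s) ('X - z%:P)
              & size s = (size g).-1].
Proof.
move=> g0 simple; have [s es] := closed_field_poly_normal g.
have lg : lead_coef g != 0 by rewrite lead_coef_eq0.
exists s; split=> //; last first.
  by rewrite es size_scale // size_prod_XsubC.
rewrite -(separable_prod_XsubC s) -(eqp_separable (eqp_scale _ lg)) -es unlock.
by apply: Pdiv.ClosedField.root_coprimep => r /simple.
Qed.
End ClosedSimpleRoots.

(** * The number of n-torsion points *)

Section TorsionCount.
Variables (F : closedFieldType) (E : weierstrass F) (smoothE : smooth E).
Hypothesis char0 : [pchar F] =i pred0.
Local Notation pt := (curve_point smoothE).
Local Notation W P := (psiv E (px P) (pw P)).
Implicit Types P Q : pt.

Definition psi_sqr n : {poly F} := psi_red E n * psi_red E n * psi_par E n.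
(** The numerator in x(nP) = phi_n / psi_n ^ 2. *)
Definition phi_num n : {poly F} :=
  'X * psi_sqr n - psi_red E n.+1 * psi_red E n.-1 * psi_par E n.-1.

Lemma psi_sqrE P n : P != 0 -> (psi_sqr n).[px P] = W P n ^+ 2.
Proof. by move=> P0; rewrite expr2 psiv_mul. Qed.

Lemma phi_numE P n : P != 0 -> (0 < n)%N ->
  (phi_num n).[px P] = px P * W P n ^+ 2 - W P n.+1 * W P n.-1.
Proof.
move=> P0 n0; rewrite -psi_sqrE // psiv_mul //; last by lia.
by rewrite /phi_num hornerD hornerN (hornerM 'X) hornerX.
Qed.

Lemma psi_sqr_top n : (0 < n)%N ->
  (size (psi_sqr n) <= n ^ 2)%N /\ (psi_sqr n)`_(n ^ 2).-1 = (n ^ 2)%:R.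
Proof.
move=> n0; have en := odd_double_half n; rewrite /psi_sqr /psi_par.
have [[j ej]|[i ei]] : (exists j, n = j.*2.+1) \/ (exists i, n = i.+1.*2).
- by move: en; case: (odd n) => en; [left; exists n./2|right; exists n./2.-1]; lia.
- rewrite ej oddS odd_double.
  have [s e _] := top2M (psi_red_odd_top2 E j) (psi_red_odd_top2 E j).
  have ed : (j.*2.+1 ^ 2)%N = (2 * j * j.+1 + 2 * j * j.+1).+1%N by lia.
  by rewrite mulr1 ed; rewrite ?succnK; split=> //; rewrite e -natrM; congr (_%:R); lia.
rewrite ei odd_double.
have := top2M (psi_red_even_top2 E i) (psi_red_even_top2 E i).
move=> /top2M/(_ (psi2_sq_top2 E)) [s e _].
have ed : (i.+1.*2 ^ 2)%N = (2 * i * i.+2 + 2 * i * i.+2 + 3).+1%N by lia.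
by rewrite ed; rewrite ?succnK; split=> //; rewrite e -!natrM; congr (_%:R); lia.
Qed.

Lemma phi_sub_top n : (1 < n)%N ->
  let p := psi_red E n.+1 * psi_red E n.-1 * psi_par E n.-1 in
  (size p <= (n ^ 2).+1)%N /\ p`_(n ^ 2) = (n ^ 2).-1%:R.
Proof.
move=> n1; have en := odd_double_half n.
have [[j ej]|[i ei]] : (exists j, n = j.+1.*2.+1) \/ (exists i, n = i.+1.*2).
- move: n./2 en => k; case: (odd n) => en; [left|right]; exists k.-1; first by lia.
  by case: k en => [|k]; lia.
- rewrite ej [_.-1]/= /psi_par odd_double; cbv zeta.
  have := top2M (psi_red_even_top2 E j.+1) (psi_red_even_top2 E j).
  move=> /top2M/(_ (psi2_sq_top2 E)) [s e _].
  have ed : (j.+1.*2.+1 ^ 2)%N = (2 * j.+1 * j.+3 + 2 * j * j.+2 + 3)%N by lia.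
  have el : (j.+1.*2.+1 ^ 2).-1 = (j.+2 * j.+1 * 4)%N by lia.
  by rewrite el ed; split=> //; rewrite e -!natrM.
rewrite ei /psi_par; have -> : odd i.+1.*2.-1 by rewrite /= odd_double.
cbv zeta; rewrite mulr1.
have [s e _] := top2M (psi_red_odd_top2 E i.+1) (psi_red_odd_top2 E i).
have ed : (i.+1.*2 ^ 2)%N = (2 * i.+1 * i.+2 + 2 * i * i.+1)%N by lia.
have el : (i.+1.*2 ^ 2).-1 = (i.+1.*2.+1 * i.*2.+1)%N by lia.
by rewrite el ed; split=> //; rewrite e -!natrM.
Qed.

(** The leading coefficients n^2 and n^2 - 1 of the two terms leave 1, so that phi_n - c psi_n ^ 2
    has degree n^2 for every c. *)
Lemma phi_num_top n : (1 < n)%N ->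
  (size (phi_num n) <= (n ^ 2).+1)%N /\ (phi_num n)`_(n ^ 2) = 1.
Proof.
move=> n1; have [s e] := psi_sqr_top (ltnW n1); have [s' e'] := phi_sub_top n1.
have n2 : (0 < n ^ 2)%N by rewrite expn_gt0 (ltnW n1).
split.
  rewrite /phi_num (leq_trans (size_polyD _ _)) // size_polyN geq_max s' andbT.
  apply: leq_trans (size_polyMleq _ _) _; rewrite size_polyX.
  by move: (size (psi_sqr n)) s => a; lia.
rewrite /phi_num coefB coefXM e' eqn0Ngt n2 /= e -natrB; last by lia.
by rewrite (_ : (_ - _)%N = 1%N) //; lia.
Qed.

Lemma mul_point_phi P n : P != 0 -> (0 < n)%N -> P *+ n != 0 ->
  (psi_sqr n).[px P] != 0 /\ (phi_num n).[px P] = px (P *+ n) * (psi_sqr n).[px P].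
Proof.
move=> P0 n0 nP; rewrite psi_sqrE // phi_numE //.
have := psi_claimP char0 P0 n0; rewrite /psi_claim (negPf nP) => -[W0 e].
by rewrite expf_neq0 // e; split=> //; ring.
Qed.

Lemma mul_point_psi P n : P != 0 -> (0 < n)%N -> P *+ n = 0 ->
  (psi_sqr n).[px P] = 0 /\ (phi_num n).[px P] != 0.
Proof.
move=> P0 n0 nP; rewrite psi_sqrE // phi_numE //.
have := psi_claimP char0 P0 n0; rewrite /psi_claim nP eqxx => -[-> e].
by rewrite expr0n mulr0 sub0r oppr_eq0.
Qed.

(** A multiple root of phi_n - c psi_n ^ 2 is a root of the Wronskian of phi_n and psi_n ^ 2, whose
    top coefficient is n^2; only finitely many [c] are excluded. The condition on [psi2_sq] makes a
    point of abscissa [c] different from its opposite. *)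
Lemma generic_fibre n : (1 < n)%N -> exists c : F,
  (psi2_sq E).[c] != 0 /\ exists s, [/\ uniq s, size s = (n ^ 2)%N &
    forall z, (z \in s) = root (phi_num n - c *: psi_sqr n) z].
Proof.
move=> n1; have [sa ea] := phi_num_top n1; have [sb eb] := psi_sqr_top (ltnW n1).
have N2 : (0 < n ^ 2)%N by rewrite expn_gt0 (ltnW n1).
set a := phi_num n in sa ea *; set b := psi_sqr n in sb eb *.
have coprime z : a.[z] = 0 -> b.[z] = 0 -> False.
  have [P P0 <-] := curve_point_lift smoothE z.
  have [nP|nP] := eqVneq (P *+ n) 0.
    by have [_ /eqP] := mul_point_psi P0 (ltnW n1) nP.
  by have [/eqP h _ _ /h] := mul_point_phi P0 (ltnW n1) nP.
clearbody a b.
pose wr := a^`() * b - a * b^`().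
have [N eN] : exists N, (n ^ 2)%N = N.+2 by exists (n ^ 2).-2; nia.
have size_der (p : {poly F}) k : (size p <= k.+1)%N -> (size p^`() <= k)%N.
  by move=> sp; apply/leq_sizeP => j kj; rewrite coef_deriv nth_default ?mul0rn // (leq_trans sp).
rewrite eN /= in sa ea sb eb *.
have wr0 : wr != 0.
  apply/eqP => /(congr1 (fun p : {poly F} => p`_(N.+1 + N.+1))).
  rewrite coefB coef0 coefM_top ?size_der //.
  have -> : (N.+1 + N.+1 = N.+2 + N)%N by lia.
  rewrite coefM_top ?size_der // !coef_deriv ea eb.
  rewrite -[N.+2%:R *+ N.+1]mulr_natr mul1r mulrC -mulrBr -natrB // subSnn mulr1.
  by apply/eqP; apply: char0_unit.
have [rs ers] := closed_field_poly_normal wr.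
have rs_root r : root wr r -> r \in rs.
  by rewrite ers rootZ ?lead_coef_eq0 // root_prod_XsubC.
(* The roots of [h] are the values to avoid: the roots of psi_2 ^ 2 and the quotients phi_n / psi_n
   ^ 2 at the roots of the Wronskian. No factor is zero, since phi_n and psi_n ^ 2 have no common
   root. *)
pose h := psi2_sq E * \prod_(r <- rs) (a.[r]%:P - b.[r]%:P * 'X).
have h0 : h != 0.
  rewrite mulf_neq0 ?psi2_sq_neq0 // prodf_seq_neq0; apply/allP => r _ /=.
  apply/eqP => e; apply: (coprime r).
    by move/(congr1 (fun p : {poly F} => p.[0])): e; rewrite !hornerE /= ?mulr0 ?subr0.
  move/(congr1 (fun p : {poly F} => p`_1)): e.
  by rewrite coefB coefC coefCM coefX coef0 /= mulr1 sub0r => /eqP; rewrite oppr_eq0 => /eqP.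
have [c hc] : exists c, h.[c] != 0.
  apply: contrapT => nh; move/eqP: h0; apply; apply: (poly_eq0_char0 char0) => x.
  by apply: contrapT => /eqP hx; apply: nh; exists x.
move: hc; rewrite /h hornerM mulf_eq0 negb_or => /andP[c0 cr]; exists c; split=> //.
have sa3 : size a = N.+3.
  apply/eqP; rewrite eqn_leq sa /= ltnNge; apply/negP => le.
  by have /eqP := nth_default 0 le; rewrite ea oner_eq0.
have sg : size (a - c *: b) = N.+3.
  by rewrite size_polyDl // size_polyN sa3 ltnS (leq_trans (size_scale_leq _ _)).
have g0 : a - c *: b != 0 by rewrite -size_poly_eq0 sg.
have simple r : root (a - c *: b) r -> ~~ root (a - c *: b)^`() r.
  rewrite /root derivB derivZ !hornerD !hornerN !hornerZ => /eqP e; apply/negP => /eqP e'.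
  have /rs_root rin : root wr r.
    rewrite /root /wr hornerD hornerN !hornerM; apply/eqP.
    apply: (eq_of_sub (d := (a^`().[r] - c * b^`().[r]) * b.[r]
      - (a.[r] - c * b.[r]) * b^`().[r])); last by ring.
    by rewrite e e' !mul0r subr0.
  move: cr; rewrite horner_prod prodf_seq_neq0 => /allP/(_ _ rin) /=.
  by rewrite !hornerE mulrC e eqxx.
have [s [us es ss]] := simple_roots_factor g0 simple.
exists s; split=> //; first by rewrite ss sg.
by move=> z; rewrite es rootZ ?lead_coef_eq0 // root_prod_XsubC.
Qed.

(** Over each abscissa of the generic fibre exactly one of the two points is sent to R, the other
    being sent to - R; subtracting a fixed preimage of R carries the fibre onto the n-torsion. *)
Lemma torsion_enum n : (0 < n)%N -> exists s : seq pt,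
  [/\ uniq s, size s = (n ^ 2)%N & forall T, (T \in s) = (T *+ n == 0)].
Proof.
case: n => [|[|n]] // _.
  by exists [:: 0]; split=> // T; rewrite mulr1n inE.
set m := n.+2; have m1 : (1 < m)%N by []; have m0 : (0 < m)%N by [].
have [c [c0 [s [us ss sE]]]] := generic_fibre m1.
have [R R0 eR] := curve_point_lift smoothE c.
have Rne : R <> - R.
  move=> e; move: c0; rewrite -eR -(pw_sq R0) expf_eq0 /= pw_eq0 // mulr2n addr_eq0.
  by rewrite -e eqxx.
have lift z : exists P : pt, z \in s -> [/\ P != 0, px P = z & P *+ m = R].
  have [zs|zs] := boolP (z \in s); last by exists 0.
  have [P P0 eP] := curve_point_lift smoothE z.
  move: zs; rewrite sE /root hornerD hornerN hornerZ -eP subr_eq0 => /eqP e.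
  have mP : P *+ m != 0.
    apply/eqP => mP; have [b0 /eqP a0] := mul_point_psi P0 m0 mP.
    by apply: a0; rewrite e b0 mulr0.
  have [b0 a0] := mul_point_phi P0 m0 mP.
  have ex : px (P *+ m) = px R by rewrite eR; apply: (mulIf b0); rewrite -a0 e.
  have [eq|eq] := px_eq mP R0 ex; first by exists P.
  by exists (- P) => _; rewrite oppr_eq0 px_opp mulNrn eq opprK.
have [f fP] := choice lift.
have [z0 z0s] : exists z0, z0 \in s.
  by case: (s) ss => [|z s'] // _; exists z; rewrite inE eqxx.
have [_ _ fz0] := fP _ z0s.
exists [seq f z - f z0 | z <- s]; split.
- rewrite map_inj_in_uniq // => z z' zs zs' /addIr e.
  by have [_ <- _] := fP _ zs; have [_ <- _] := fP _ zs'; rewrite e.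
- by rewrite size_map.
move=> T; apply/mapP/eqP => [[z zs ->]|mT].
  by have [_ _ e] := fP _ zs; rewrite mulrnBl e fz0 subrr.
have mQ : (T + f z0) *+ m = R by rewrite mulrnDl mT add0r fz0.
have Q0 : T + f z0 != 0 by apply: contraNneq R0 => e; rewrite -mQ e mul0rn.
have mQ0 : (T + f z0) *+ m != 0 by rewrite mQ.
have [b0 a0] := mul_point_phi Q0 m0 mQ0.
have zs : px (T + f z0) \in s.
  by rewrite sE /root hornerD hornerN hornerZ a0 mQ eR subrr.
have [fz fx fm] := fP _ zs; exists (px (T + f z0)) => //.
have [->|e] := px_eq fz Q0 fx; first by rewrite addrK.
by case: Rne; rewrite -{1}fm e mulNrn mQ.
Qed.
End TorsionCount.

(** * Torsion of an abelian group with n^2 elements of n-torsion *)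

Section ExactOrder.
Variable A : zmodType.
Implicit Types (x y : A) (m n d k : nat).

Definition exact_ord n x := (x *+ n == 0) && all (fun m => x *+ m != 0) (iota 1 n.-1).

Lemma exact_ordP n x :
  reflect (x *+ n = 0 /\ forall m, (0 < m < n)%N -> x *+ m != 0) (exact_ord n x).
Proof.
apply: (iffP andP) => [[/eqP xn /allP h]|[xn h]]; split=> //.
- by move=> m mn; apply: h; rewrite mem_iota; lia.
- exact/eqP.
- by apply/allP => m; rewrite mem_iota => mn; apply: h; lia.
Qed.

Lemma exact_ord_dvd d x m : (0 < d)%N -> exact_ord d x -> (x *+ m == 0) = (d %| m)%N.
Proof.
move=> d0 /exact_ordP[xd h]; rewrite {1}(divn_eq m d) mulrnDr mulnC mulrnA xd mul0rn add0r.
rewrite /dvdn; have := ltn_pmod m d0; case: (m %% d)%N => [|r] lt; first by rewrite mulr0n !eqxx.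
by apply/negbTE/h.
Qed.

Lemma exact_ord_of_dvd d x : (0 < d)%N -> (forall m, (x *+ m == 0) = (d %| m)%N) ->
  exact_ord d x.
Proof.
move=> d0 h; apply/exact_ordP; split=> [|m /andP[m0 md]]; first by apply/eqP; rewrite h.
by rewrite h; apply/negP => /dvdn_leq; lia.
Qed.

Lemma exact_ord_exists n x : (0 < n)%N -> x *+ n = 0 ->
  exists d, [/\ (0 < d)%N, (d %| n)%N & exact_ord d x].
Proof.
move=> n0 xn; have ex : exists m, (0 < m)%N && (x *+ m == 0).
  by exists n; rewrite n0 xn eqxx.
case: (ex_minnP ex) => d /andP[d0 /eqP xd] dmin.
have ed : exact_ord d x.
  apply/exact_ordP; split=> // m /andP[m0 md]; apply/negP => xm.
  by have := dmin m; rewrite m0 xm => /(_ isT); lia.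
by exists d; split=> //; rewrite -(exact_ord_dvd _ d0 ed) xn.
Qed.

Lemma exact_ord_inj d d' x : (0 < d)%N -> (0 < d')%N ->
  exact_ord d x -> exact_ord d' x -> d = d'.
Proof.
move=> d0 d0' e e'; apply/eqP; rewrite eqn_dvd.
by rewrite -(exact_ord_dvd _ d0 e) -(exact_ord_dvd _ d0' e'); 
  case/andP: e => -> _; case/andP: e' => ->.
Qed.

Lemma exact_ordN d x : exact_ord d (- x) = exact_ord d x.
Proof.
rewrite /exact_ord mulNrn oppr_eq0; congr (_ && _); apply: eq_all => m.
by rewrite mulNrn oppr_eq0.
Qed.
End ExactOrder.

Section TorsionStructure.
Variables (A : zmodType) (tors : nat -> seq A).
Hypothesis torsP : forall n, (0 < n)%N ->
  [/\ uniq (tors n), size (tors n) = (n ^ 2)%N & forall x, (x \in tors n) = (x *+ n == 0)].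
Implicit Types (x y : A) (m n d k : nat).

(** By counting: on the mq-torsion, multiplication by q has a kernel of q^2 elements, so its image
    has at least m^2 elements and fills the m-torsion. *)
Lemma mulrn_surj m q y : (0 < m)%N -> (0 < q)%N -> y *+ m = 0 -> exists x, x *+ q = y.
Proof.
move=> m0 q0 ym; have mq0 : (0 < m * q)%N by rewrite muln_gt0 m0.
have [us ss sE] := torsP mq0; have [um sm mE] := torsP m0; have [uq sq qE] := torsP q0.
set I := undup [seq x *+ q | x <- tors (m * q)].
have IP z : z \in I -> exists x, x *+ q = z.
  by rewrite mem_undup => /mapP[x _ ->]; exists x.
have subI : {subset I <= tors m}.
  move=> z; rewrite mem_undup => /mapP[x]; rewrite sE => /eqP xs ->.
  by rewrite mE -mulrnA mulnC xs.
have ex z : exists x, z \in I -> x *+ q = z.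
  by have [/IP[x ?]|?] := boolP (z \in I); [exists x|exists 0].
have [g gP] := choice ex.
have le : (size (tors (m * q)) <= size I * size (tors q))%N.
  rewrite -(size_allpairs (fun z t => g z + t)); apply: uniq_leq_size => // x xs.
  have xI : x *+ q \in I by rewrite mem_undup; apply/mapP; exists x.
  apply/allpairsP; exists (x *+ q, x - g (x *+ q)); split=> //=; last by rewrite addrC subrK.
  by rewrite qE mulrnBl gP // subrr.
have leI : (m ^ 2 <= size I)%N.
  by move: le; rewrite ss sq expnMn leq_pmul2r // expn_gt0 q0.
have [_ eI] := uniq_min_size (undup_uniq _) subI ltac:(by rewrite sm).
by apply: IP; rewrite eI mE ym.
Qed.

Lemma prime_torsion_neq0 q : prime q -> exists2 g : A, g != 0 & g *+ q = 0.
Proof.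
move=> pq; have q0 := prime_gt0 pq; have [us ss sE] := torsP q0.
apply: contrapT => h.
have : {subset tors q <= [:: 0]}.
  move=> x; rewrite sE inE => /eqP xq; apply: contrapT => /negP x0.
  by apply: h; exists x.
move/(uniq_leq_size us); rewrite ss /= => le; have := prime_gt1 pq; nia.
Qed.

Lemma prime_exact_ord q (x : A) : prime q -> x != 0 -> x *+ q = 0 -> exact_ord q x.
Proof.
move=> pq x0 xq; have [d [d0 dq ed]] := exact_ord_exists (prime_gt0 pq) xq.
have /primeP[_ /(_ _ dq) /orP[/eqP d1|/eqP <- //]] := pq.
by case/exact_ordP: ed; rewrite d1 mulr1n => e; rewrite e eqxx in x0.
Qed.

Lemma bezout_coprime a m : (0 < a)%N -> coprime a m -> exists k l, (k * a = l * m + 1)%N.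
Proof.
by move=> a0 /eqP co; case: (egcdnP m a0) => k l e _; exists k, l; rewrite e co.
Qed.

Definition indep n e1 e2 :=
  forall i j, (e1 *+ i + e2 *+ j == 0 :> A) = (n %| i)%N && (n %| j)%N.

Lemma indep_mul0 n e1 e2 : indep n e1 e2 -> e1 *+ n = 0 /\ e2 *+ n = 0.
Proof.
move=> h; have := h n 0%N; have := h 0%N n.
by rewrite !mulr0n add0r addr0 dvdn0 dvdnn => /eqP -> /eqP ->.
Qed.

Lemma mulrn_dvd n x i : x *+ n = 0 -> (n %| i)%N -> x *+ i = 0.
Proof. by move=> xn /dvdnP[k ->]; rewrite mulnC mulrnA xn mul0rn. Qed.

Lemma indepI n e1 e2 : e1 *+ n = 0 -> e2 *+ n = 0 ->
  (forall i j, e1 *+ i + e2 *+ j = 0 -> (n %| i)%N /\ (n %| j)%N) -> indep n e1 e2.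
Proof.
move=> h1 h2 h i j; apply/eqP/andP => [/h //|[ni nj]].
by rewrite (mulrn_dvd h1 ni) (mulrn_dvd h2 nj) addr0.
Qed.

Lemma indep_prime q : prime q -> exists e1 e2, indep q e1 e2.
Proof.
move=> pq; have q0 := prime_gt0 pq; have q1 := prime_gt1 pq.
have [us ss sE] := torsP q0.
have [g1 g10 g1q] := prime_torsion_neq0 pq.
have [g2 g2q g2n] : exists2 g2, g2 *+ q = 0 & g2 \notin [seq g1 *+ k | k <- iota 0 q].
  apply: contrapT => h.
  have : {subset tors q <= [seq g1 *+ k | k <- iota 0 q]}.
    move=> x; rewrite sE => /eqP xq; apply: contrapT => /negP xn.
    by apply: h; exists x.
  by move/(uniq_leq_size us); rewrite ss size_map size_iota => le; nia.
exists g1, g2; apply: indepI => // i j e.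
have nj : (q %| j)%N.
  apply/negPn/negP => nj.
  have j0 : (0 < j)%N by case: j nj {e} => //; rewrite dvdn0.
  have co : coprime j q by rewrite coprime_sym prime_coprime.
  have [k [l ekl]] := bezout_coprime j0 co.
  have ej : g2 *+ j = g1 *+ (i * q.-1).
    apply: (addrI (g1 *+ i)); rewrite e -mulrnDr -[in LHS](mul0rn _ i) -g1q -mulrnA.
    by congr (_ *+ _); nia.
  move/negP: g2n; apply; apply/mapP; exists ((k * (i * q.-1)) %% q)%N.
    by rewrite mem_iota ltn_pmod.
  have -> : g2 = g2 *+ (k * j) by rewrite ekl mulrnDr mulnC mulrnA g2q mul0rn add0r.
  rewrite mulnC mulrnA ej -mulrnA mulnC {1}(divn_eq (k * (i * q.-1)) q) mulrnDr.
  by rewrite [(_ %/ _ * _)%N]mulnC mulrnA g1q mul0rn add0r.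
split=> //; rewrite -(exact_ord_dvd _ q0 (prime_exact_ord pq g10 g1q)).
by move: e; rewrite (mulrn_dvd g2q nj) addr0 => ->.
Qed.

(** Induction on n = m q with q prime: a basis of the m-torsion is divided by q if q divides m, and
    otherwise glued to a basis of the q-torsion by the Chinese remainder theorem. *)
Lemma indep_exists n : (0 < n)%N -> exists e1 e2, indep n e1 e2.
Proof.
elim/ltn_ind: n => n IH n0; have [n1|n1] := leqP n 1.
  have -> : n = 1%N by lia.
  by exists 0, 0 => i j; rewrite !mul0rn addr0 !dvd1n eqxx.
have pq := pdiv_prime n1; set q := pdiv n in pq; have q1 := prime_gt1 pq.
have en : (n = n %/ q * q)%N by rewrite divnK // pdiv_dvd.
move: en; set m := (n %/ q)%N => en; have m0 : (0 < m)%N by nia.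
have [f1 [f2 fi]] := IH m ltac:(nia) m0; have [f1m f2m] := indep_mul0 fi.
have [qm|qm] := boolP (q %| m)%N.
  have [e1 e1q] := mulrn_surj m0 (ltnW q1) f1m.
  have [e2 e2q] := mulrn_surj m0 (ltnW q1) f2m.
  exists e1, e2; rewrite en; apply: indepI; rewrite ?[(m * q)%N]mulnC ?mulrnA ?e1q ?e2q //.
  move=> i j e; have [m' em] := dvdnP qm.
  have : f1 *+ i + f2 *+ j == 0.
    by rewrite -e1q -e2q -!mulrnA !(mulnC q) !mulrnA -mulrnDl e mul0rn.
  rewrite fi => /andP[/dvdnP[i' ei] /dvdnP[j' ej]].
  have : f1 *+ (m' * i') + f2 *+ (m' * j') == 0.
    rewrite -e1q -e2q -!mulrnA -e ei ej em.
    by apply/eqP; congr (_ *+ _ + _ *+ _); lia.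
  have m'0 : (0 < m')%N by move: m0; rewrite em muln_gt0 => /andP[].
  rewrite fi {1 2}em !dvdn_pmul2l // => /andP[qi qj].
  by rewrite ei ej ![(_ * m)%N]mulnC !dvdn_pmul2l.
have co : coprime q m by rewrite prime_coprime.
have [a [a' ea]] := bezout_coprime (ltnW q1) co.
rewrite coprime_sym in co; have [b [b' eb]] := bezout_coprime m0 co.
have [g1 [g2 gi]] := indep_prime pq; have [g1q g2q] := indep_mul0 gi.
(* As [a] inverts q modulo m and [b] inverts m modulo q, multiplying [f *+ a + g *+ b] by q recovers
   f, and by m recovers g. *)
have eq (f g : A) : f *+ m = 0 -> g *+ q = 0 -> (f *+ a + g *+ b) *+ q = f.
  move=> fm gq; rewrite mulrnDl -!mulrnA ea mulrnDr [(b * q)%N]mulnC [(a' * m)%N]mulnC.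
  by rewrite !mulrnA fm gq !mul0rn add0r addr0.
have em (f g : A) : f *+ m = 0 -> g *+ q = 0 -> (f *+ a + g *+ b) *+ m = g.
  move=> fm gq; rewrite mulrnDl -!mulrnA eb mulrnDr [(a * m)%N]mulnC [(b' * q)%N]mulnC.
  by rewrite !mulrnA fm gq !mul0rn !add0r.
exists (f1 *+ a + g1 *+ b), (f2 *+ a + g2 *+ b); rewrite en.
apply: indepI; [by rewrite mulrnA em|by rewrite mulrnA em|move=> i j e].
have : f1 *+ i + f2 *+ j == 0.
  rewrite -(eq _ _ f1m g1q) -(eq _ _ f2m g2q) -!mulrnA !(mulnC q) !mulrnA -mulrnDl e.
  by rewrite mul0rn.
have : g1 *+ i + g2 *+ j == 0.
  rewrite -(em _ _ f1m g1q) -(em _ _ f2m g2q) -!mulrnA !(mulnC m) !mulrnA -mulrnDl e.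
  by rewrite mul0rn.
by rewrite fi gi => /andP[qi qj] /andP[mi mj]; rewrite !Gauss_dvd // mi mj qi qj.
Qed.

Lemma indep_span n e1 e2 x : (0 < n)%N -> indep n e1 e2 -> x *+ n = 0 ->
  exists i j, x = e1 *+ i + e2 *+ j.
Proof.
move=> n0 h xn; have [us ss sE] := torsP n0; have [h1 h2] := indep_mul0 h.
set s := [seq e1 *+ i + e2 *+ j | i <- iota 0 n, j <- iota 0 n].
have sub : {subset s <= tors n}.
  move=> y /allpairsP[[i j] [_ _ ->]] /=; rewrite sE mulrnDl -!mulrnA.
  by rewrite (mulrn_dvd h1) ?(mulrn_dvd h2) ?addr0 ?dvdn_mull.
have us' : uniq s.
  apply: allpairs_uniq; rewrite ?iota_uniq // => -[i j] [i' j'].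
  move=> /allpairsP[[a b] [/= + + [-> ->]]] /allpairsP[[a' b'] [/= + + [-> ->]]].
  rewrite !mem_iota !add0n => /andP[_ an] /andP[_ bn] /andP[_ an'] /andP[_ bn'] e.
  (* [n - a'] replaces the opposite of [a'], the coefficients being natural numbers. *)
  have : e1 *+ (a + (n - a')) + e2 *+ (b + (n - b')) == 0.
    rewrite !mulrnDr addrACA e -addrACA -!mulrnDr !subnKC; try by lia.
    by rewrite h1 h2 addr0.
  rewrite h => /andP[/dvdnP[k ek] /dvdnP[l el]].
  have one b0 c k0 : (b0 < n)%N -> (c < n)%N -> (b0 + (n - c))%N = (k0 * n)%N -> b0 = c.
    case: k0 => [|[|k0]] lt1 lt2; rewrite ?mulSn; [lia|lia|].
    by move: (k0 * n)%N => z; lia.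
  by congr (_, _); [apply: one ek|apply: one el].
have [_ es] := uniq_min_size us' sub ltac:(by rewrite ss size_allpairs !size_iota -mulnn).
have : x \in s by rewrite es sE xn.
by case/allpairsP=> -[i j] [_ _ ->]; exists i, j.
Qed.

Lemma indep_exact_ord n e1 e2 : (0 < n)%N -> indep n e1 e2 ->
  [/\ exact_ord n e1, exact_ord n e2 & exact_ord n (e1 + e2)].
Proof.
move=> n0 h; split; apply: exact_ord_of_dvd => // m.
- by have := h m 0%N; rewrite mulr0n addr0 dvdn0 andbT.
- by have := h 0%N m; rewrite mulr0n add0r dvdn0.
- by rewrite mulrnDl h andbb.
Qed.

(** Serves to carry transitivity from E_n down to E_m for m dividing n. For one prime q: if q
    divides m, any x with q x = y has order m q; otherwise an element of order q is added to a
    multiple of y. *)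
Lemma exact_ord_lift m k y : (0 < m)%N -> (0 < k)%N -> exact_ord m y ->
  exists2 x, exact_ord (m * k) x & x *+ k = y.
Proof.
elim/ltn_ind: k m y => k IH m y m0 k0 ey; have [k1|k1] := leqP k 1.
  by exists y; rewrite (_ : k = 1%N) ?muln1 //; lia.
have pq := pdiv_prime k1; set q := pdiv k in pq; have q1 := prime_gt1 pq.
have en : (k = k %/ q * q)%N by rewrite divnK // pdiv_dvd.
move: en; set k' := (k %/ q)%N => en; have k'0 : (0 < k')%N by nia.
suff [x ex xq] : exists2 x, exact_ord (m * q) x & x *+ q = y.
  have mq0 : (0 < m * q)%N by rewrite muln_gt0 m0 ltnW.
  have [z ez zk] := IH k' ltac:(nia) _ _ mq0 k'0 ex.
  by exists z; [rewrite en [(k' * q)%N]mulnC mulnA|rewrite en mulrnA zk].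
have ym : y *+ m = 0 by case/exact_ordP: ey.
have [qm|qm] := boolP (q %| m)%N.
  have [x xq] := mulrn_surj m0 (ltnW q1) ym; exists x => //.
  apply: exact_ord_of_dvd; first by rewrite muln_gt0 m0 ltnW.
  move=> j; apply/eqP/idP => [xj|mqj]; last first.
    by apply: mulrn_dvd mqj; rewrite mulnC mulrnA xq.
  have [m' em] := dvdnP qm.
  have : y *+ j == 0 by rewrite -xq -mulrnA mulnC mulrnA xj mul0rn.
  rewrite (exact_ord_dvd _ m0 ey) => /dvdnP[j' ej].
  have : y *+ (m' * j') == 0.
    rewrite -xq -mulrnA -xj ej em; apply/eqP; congr (_ *+ _); lia.
  have m'0 : (0 < m')%N by move: m0; rewrite em muln_gt0 => /andP[].
  rewrite (exact_ord_dvd _ m0 ey) {1}em dvdn_pmul2l // => qj'.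
  by rewrite ej [(j' * m)%N]mulnC dvdn_pmul2l.
have co : coprime q m by rewrite prime_coprime.
have [a [a' ea]] := bezout_coprime (ltnW q1) co.
rewrite coprime_sym in co; have [b [b' eb]] := bezout_coprime m0 co.
have [g g0 gq] := prime_torsion_neq0 pq; have eg := prime_exact_ord pq g0 gq.
have eq : (y *+ a + g *+ b) *+ q = y.
  rewrite mulrnDl -!mulrnA ea mulrnDr [(b * q)%N]mulnC [(a' * m)%N]mulnC.
  by rewrite !mulrnA ym gq !mul0rn add0r addr0.
have em : (y *+ a + g *+ b) *+ m = g.
  rewrite mulrnDl -!mulrnA eb mulrnDr [(a * m)%N]mulnC [(b' * q)%N]mulnC.
  by rewrite !mulrnA ym gq !mul0rn !add0r.
exists (y *+ a + g *+ b) => //.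
apply: exact_ord_of_dvd; first by rewrite muln_gt0 m0 ltnW.
move=> j; apply/eqP/idP => [xj|mqj]; last first.
  by apply: mulrn_dvd mqj; rewrite mulrnA em.
rewrite Gauss_dvd // -(exact_ord_dvd _ m0 ey) -(exact_ord_dvd _ (ltnW q1) eg).
have yj : y *+ j = 0 by rewrite -[y]eq mulrnAC xj mul0rn.
have gj : g *+ j = 0 by rewrite -[g]em mulrnAC xj mul0rn.
by rewrite yj gj eqxx.
Qed.

(** Different signs at the basis elements e1 and e2, compared with the sign at e1 + e2, force 2 e1 =
    0 or 2 e2 = 0; then n divides 2 and the two signs coincide. *)
Lemma sign_uniform n (g : A -> A) : (0 < n)%N ->
  (forall x y, x *+ n = 0 -> y *+ n = 0 -> g (x + y) = g x + g y) ->
  (forall x, exact_ord n x -> g x = x \/ g x = - x) ->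
  (forall x, x *+ n = 0 -> g x = x) \/ (forall x, x *+ n = 0 -> g x = - x).
Proof.
move=> n0 gD h; have [e1 [e2 hi]] := indep_exists n0.
have [h1 h2] := indep_mul0 hi; have [o1 o2 o3] := indep_exact_ord n0 hi.
have gM x i : x *+ n = 0 -> g (x *+ i) = g x *+ i.
  move=> xn; have g0 : g 0 = 0.
    by have := gD 0 0 (mul0rn _ _) (mul0rn _ _); rewrite addr0 => /esym/eqP;
      rewrite -subr_eq0 addrK => /eqP.
  elim: i => [|i IHi]; first by rewrite !mulr0n.
  by rewrite !mulrS gD ?IHi // -mulrnA mulnC mulrnA xn mul0rn.
have en y k : y *+ n = 0 -> y *+ k *+ n = 0.
  by move=> yn; rewrite -mulrnA mulnC mulrnA yn mul0rn.
have L1 : g e1 = e1 -> g e2 = e2 -> forall x, x *+ n = 0 -> g x = x.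
  move=> g1 g2 x /(indep_span n0 hi)[i [j ->]].
  by rewrite gD ?en // !gM // g1 g2.
have LN : g e1 = - e1 -> g e2 = - e2 -> forall x, x *+ n = 0 -> g x = - x.
  move=> g1 g2 x /(indep_span n0 hi)[i [j ->]].
  by rewrite gD ?en // !gM // g1 g2 !mulNrn opprD.
have case2 z : (z = e1 \/ z = e2) -> z = - z -> e1 *+ 2 = 0 /\ e2 *+ 2 = 0.
  move=> hz ez; have z2 : z *+ 2 = 0 by rewrite mulr2n {1}ez addNr.
  have n2 : (n %| 2)%N.
    by case: hz z2 => ->; [rewrite -(exact_ord_dvd _ n0 o1)|rewrite -(exact_ord_dvd _ n0 o2)]
      => ->.
  by rewrite (mulrn_dvd h1 n2) (mulrn_dvd h2 n2).
have neg y : y *+ 2 = 0 -> - y = y.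
  by rewrite mulr2n => /eqP; rewrite addr_eq0 => /eqP {2}->.
have mixed : (g e1 = e1 /\ g e2 = - e2) \/ (g e1 = - e1 /\ g e2 = e2) ->
    e1 *+ 2 = 0 /\ e2 *+ 2 = 0.
  case=> -[g1 g2]; case: (h _ o3); rewrite gD // g1 g2.
  - by move/addrI => e; apply: (case2 e2); [right|].
  - by rewrite opprD => /addIr e; apply: (case2 e1); [left|].
  - by move/addIr => e; apply: (case2 e1); [left|].
  - by rewrite opprD => /addrI e; apply: (case2 e2); [right|].
case: (h _ o1) (h _ o2) => g1 [g2|g2].
- by left=> x xn; rewrite L1.
- have [d1 d2] := mixed (or_introl (conj g1 g2)); left=> x xn; rewrite L1 //.
  by rewrite g2 neg.
- have [d1 d2] := mixed (or_intror (conj g1 g2)); left=> x xn; rewrite L1 //.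
  by rewrite g1 neg.
- by right=> x xn; rewrite LN.
Qed.
End TorsionStructure.

(** * Primitive division polynomials *)

Section SplitsSimply.
Variable F : fieldType.
Implicit Types (p q : {poly F}) (s t : seq F).

Definition simple_split (p : {poly F}) (s : seq F) :=
  [/\ p != 0, uniq s & p = lead_coef p *: \prod_(z <- s) ('X - z%:P)].

Lemma simple_split_root p s z : simple_split p s -> root p z = (z \in s).
Proof. by case=> p0 _ ->; rewrite rootZ ?lead_coef_eq0 // root_prod_XsubC. Qed.

Lemma simple_split_size p s : simple_split p s -> size p = (size s).+1.
Proof. by case=> p0 _ ->; rewrite size_scale ?lead_coef_eq0 // size_prod_XsubC. Qed.

Lemma simple_split_intro p s : p != 0 -> uniq s -> (size p <= (size s).+1)%N ->
  {subset s <= root p} -> simple_split p s.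
Proof.
move=> p0 us sp sub; split=> //; apply: all_roots_prod_XsubC.
- apply/eqP; rewrite eqn_leq sp; apply: max_poly_roots => //.
  by apply/allP => z /sub.
- by apply/allP => z /sub.
- by rewrite uniq_rootsE.
Qed.

Lemma perm_filter_notin s t : uniq s -> uniq t -> {subset t <= s} ->
  perm_eq s ([seq z <- s | z \notin t] ++ t).
Proof.
move=> us ut sub; apply: uniq_perm => //.
  rewrite cat_uniq filter_uniq // ut andbT; apply/hasPn => z zt.
  by rewrite mem_filter zt.
move=> z; rewrite mem_cat mem_filter; have [/sub ->|] := boolP (z \in t).
  by rewrite orbT.
by rewrite orbF.
Qed.

Lemma simple_split_divl p q s t : simple_split p s -> simple_split q t ->
  {subset t <= s} -> simple_split (p %/ q) [seq z <- s | z \notin t].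
Proof.
move=> [p0 us ep] [q0 ut eq] sub.
set r := [seq z <- s | z \notin t].
have pe : perm_eq s (r ++ t) by apply: perm_filter_notin.
have lq : lead_coef q != 0 by rewrite lead_coef_eq0.
have lp : lead_coef p != 0 by rewrite lead_coef_eq0.
have epq : p = ((lead_coef p / lead_coef q) *: \prod_(z <- r) ('X - z%:P)) * q.
  rewrite [X in _ = _ * X]eq -scalerAl -scalerAr scalerA divfK // {1}ep; congr (_ *: _).
  by rewrite (perm_big _ pe) big_cat.
rewrite {1}epq mulpK //.
have c0 : lead_coef p / lead_coef q != 0 by rewrite mulf_neq0 ?invr_eq0.
split.
- by rewrite scaler_eq0 (negPf c0) -size_poly_eq0 size_prod_XsubC.
- by rewrite filter_uniq.
- by rewrite lead_coefZ (monicP (monic_prod_XsubC _ _ _)) mulr1.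
Qed.

(* The arithmetic mean of s is - b / 12. *)
Definition balanced (b : F) s := \sum_(z <- s) (12%:R * z + b) = 0.

(** The second coefficient is minus the leading one times the sum of the roots. *)
Lemma simple_split_balanced (b : F) p d (c : F) s : c != 0 -> top2 b p d c -> simple_split p s ->
  balanced b s.
Proof.
move=> c0 tp hs; have [_ _ ep] := hs; have sp := simple_split_size hs.
have ed : d = size s by have := size_top c0 tp; rewrite sp => -[].
case: tp => _ epd etp; have lc : lead_coef p = c by rewrite lead_coefE sp /= -ed.
rewrite /balanced big_split /= -mulr_sumr big_const_seq count_predT iter_addr_0.
apply: (mulfI c0); rewrite mulr0 mulrDr -[b *+ _]mulr_natl.
move: etp; rewrite coefXM ed; case: eqP => [s0|/eqP s0].
  by rewrite (size0nil s0) big_nil /= => _; rewrite !(mulr0, mul0r, addr0).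
rewrite ep lc coefZ coefPn_prod_XsubC // => e.
apply: (eq_of_sub (d := c * (size s)%:R * b - 12%:R * (c * - (\sum_(z <- s) z)))).
  by rewrite e subrr.
by ring.
Qed.

Lemma simple_split_prod (I : eqType) (r : seq I) (P : pred I) (p : I -> {poly F})
    (s : I -> seq F) : uniq r ->
  (forall i, i \in r -> P i -> simple_split (p i) (s i)) ->
  (forall i j z, i \in r -> P i -> j \in r -> P j -> z \in s i -> z \in s j -> i = j) ->
  exists t, simple_split (\prod_(i <- r | P i) p i) t /\
    (forall z, z \in t <-> exists i, [/\ i \in r, P i & z \in s i]) /\
    (forall b, (forall i, i \in r -> P i -> balanced b (s i)) -> balanced b t).
Proof.
elim: r => [|i r IH] /= ur h inj.
  exists [::]; rewrite big_nil; split.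
    by split; rewrite ?oner_eq0 // big_nil lead_coef1 scale1r.
  by split=> [z|b _]; [split=> // -[i []]|rewrite /balanced big_nil].
case/andP: ur => ir ur.
have [||t [ht [tE tB]]] := IH ur.
- by move=> j jr; apply: h; rewrite inE jr orbT.
- by move=> j k z jr Pj kr Pk; apply: inj; rewrite ?inE ?jr ?kr ?orbT.
rewrite big_cons; have [Pi|Pi] := boolP (P i); last first.
  exists t; split=> //; split=> [z|b hb]; last first.
    by apply: tB => j jr; apply: hb; rewrite inE jr orbT.
  rewrite tE; split=> -[j [jr Pj zj]]; exists j; split=> //.
    by rewrite inE jr orbT.
  by move: jr; rewrite inE => /predU1P[ej|//]; rewrite ej (negPf Pi) in Pj.
have [p0 us ep] := h i (mem_head _ _) Pi.
have [q0 ut eq] := ht.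
exists (s i ++ t); split.
  split; first by rewrite mulf_neq0.
    rewrite cat_uniq us ut andbT; apply/hasPn => z /tE[j [jr Pj zj]].
    apply/negP => zi; move/negP: ir; apply.
    by rewrite (inj i j z) ?inE ?eqxx ?jr ?orbT.
  rewrite lead_coefM big_cat /= {1}ep {1}eq.
  by rewrite -scalerAl -scalerAr scalerA.
split=> [z|b hb]; last first.
  rewrite /balanced big_cat /= (hb i) ?mem_head // add0r.
  by apply: tB => j jr; apply: hb; rewrite inE jr orbT.
rewrite mem_cat; split=> [/orP[zi|/tE[j [jr Pj zj]]]|[j [jr Pj zj]]].
- by exists i; rewrite inE eqxx.
- by exists j; rewrite inE jr orbT.
move: jr; rewrite inE => /predU1P[<-|jr]; apply/orP; [by left|right].
by apply/tE; exists j.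
Qed.
End SplitsSimply.

Section PsiRoots.
Variables (F : closedFieldType) (E : weierstrass F) (smoothE : smooth E).
Hypothesis char0 : [pchar F] =i pred0.
Local Notation pt := (curve_point smoothE).
Variable tors : nat -> seq pt.
Hypothesis torsP : forall n, (0 < n)%N ->
  [/\ uniq (tors n), size (tors n) = (n ^ 2)%N & forall P, (P \in tors n) = (P *+ n == 0)].
Implicit Types P Q : pt.

Lemma psi_red_root P n : P != 0 -> P *+ 2 != 0 -> (0 < n)%N ->
  root (psi_red E n) (px P) = (P *+ n == 0).
Proof.
move=> P0 P2 n0; have w0 : pw P != 0 by rewrite pw_eq0.
have := psi_claimP char0 P0 n0; rewrite /psi_claim /psiv /root.
have par0 : (if odd n then 1 else pw P) != 0 by case: ifP; rewrite ?oner_eq0.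
have [nP|nP] := eqVneq (P *+ n) 0 => -[].
  by move=> /eqP + _; rewrite mulf_eq0 (negPf par0) orbF.
by rewrite mulf_eq0 (negPf par0) orbF => /negPf.
Qed.

Lemma px_fibre_size (s : seq pt) : uniq s -> (forall P, P \in s -> P != 0) ->
  (size s <= (size (undup [seq px P | P <- s])).*2)%N.
Proof.
move=> us s0; set X := undup _.
have ex z : exists P, z \in X -> P \in s /\ px P = z.
  have [|zX] := boolP (z \in X); last by exists 0.
  by rewrite mem_undup => /mapP[P Ps ->]; exists P.
have [f fP] := choice ex.
have -> : (size X).*2 = size ([seq f z | z <- X] ++ [seq - f z | z <- X]).
  by rewrite size_cat !size_map addnn.
apply: uniq_leq_size => // P Ps; rewrite mem_cat.
have zX : px P \in X by rewrite mem_undup map_f.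
have [fs fx] := fP _ zX.
by have [->|->] := px_eq (s0 _ Ps) (s0 _ fs) (esym fx); apply/orP; [left|right];
  apply: (map_f _ zX).
Qed.

(** E[n] has n^2 - 1 or n^2 - 4 points outside E[2], according to the parity of n, and an abscissa
    is shared by at most two of them. This yields as many roots as the degree allows, so all roots
    are simple. *)
Lemma psi_red_split n : (0 < n)%N -> exists s, simple_split (psi_red E n) s /\
  (forall z, z \in s <-> exists P, [/\ P != 0, P *+ 2 != 0, P *+ n = 0 & px P = z])
  /\ balanced (b2 E) s.
Proof.
move=> n0; have [ut st tE] := torsP n0; have [u2 s2 E2] := torsP (n := 2) isT.
set T := [seq P <- tors n | (P != 0) && (P *+ 2 != 0)].
have TE P : (P \in T) = [&& P != 0, P *+ 2 != 0 & P *+ n == 0].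
  by rewrite mem_filter tE andbA.
set s := undup [seq px P | P <- T].
have sE z : z \in s <-> exists P, [/\ P != 0, P *+ 2 != 0, P *+ n = 0 & px P = z].
  rewrite mem_undup; split=> [/mapP[P]|[P [P0 P2 nP <-]]].
    by rewrite TE => /and3P[P0 P2 /eqP nP] ->; exists P.
  by apply/mapP; exists P; rewrite // TE P0 P2 nP eqxx.
suff hs : simple_split (psi_red E n) s.
  exists s; split=> //; split=> //; have en := odd_double_half n.
  have [[j ej]|[i ei]] : (exists j, n = j.*2.+1) \/ (exists i, n = i.+1.*2).
    by move: en; case: (odd n) => en; [left; exists n./2|right; exists n./2.-1]; lia.
    rewrite ej in hs; exact: simple_split_balanced (char0_unit char0 _) (psi_red_odd_top2 E j) hs.
  rewrite ei in hs; exact: simple_split_balanced (char0_unit char0 _) (psi_red_even_top2 E i) hs.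
apply: simple_split_intro; rewrite ?undup_uniq //.
- exact: psi_red_neq0.
- have uT : uniq T by rewrite filter_uniq.
  have T0 P : P \in T -> P != 0 by rewrite TE => /and3P[].
  have le := px_fibre_size uT T0; rewrite -/s in le.
  have en := odd_double_half n.
  have [[j ej]|[i ei]] : (exists j, n = j.*2.+1) \/ (exists i, n = i.+1.*2).
    by move: en; case: (odd n) => en; [left; exists n./2|right; exists n./2.-1]; lia.
  - have sT : (n ^ 2 <= (size T).+1)%N.
      rewrite -st -[(size T).+1]/(size (0 :: T)); apply: uniq_leq_size => // P.
      rewrite tE inE TE => nP; rewrite nP andbT; have [//|P0] /= := eqVneq P 0.
      apply: contra P0 => /eqP P2; move: nP.
      by rewrite ej -addn1 mulrnDr -mul2n mulrnA P2 mul0rn add0r mulr1n.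
    have [sp _ _] := psi_red_odd_top2 E j; rewrite -ej in sp.
    apply: leq_trans sp _; rewrite ltnS.
    have e : (n ^ 2 = (2 * j * j.+1).*2.+1)%N by rewrite ej; lia.
    by move: sT le; rewrite e; move: (size T) (size s) => a b; lia.
  have sT : (n ^ 2 <= size T + 4)%N.
    rewrite -st -[4%N]/(2 ^ 2)%N -s2 -size_cat; apply: uniq_leq_size => // P.
    rewrite tE mem_cat TE E2 => nP; rewrite nP andbT.
    apply/orP; have [P2|P2] := boolP (P *+ 2 == 0); [by right|left].
    by apply/andP; split=> //; apply: contraNneq P2 => ->; rewrite mul0rn.
  have [sp _ _] := psi_red_even_top2 E i; rewrite -ei in sp.
  apply: leq_trans sp _; rewrite ltnS.
  have e : (n ^ 2 = (2 * i * i.+2).*2 + 4)%N by rewrite ei; lia.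
  by move: sT le; rewrite e; move: (size T) (size s) => a b; lia.
- by move=> z /sE[P [P0 P2 nP <-]]; rewrite -topredE /= psi_red_root // nP.
Qed.

Lemma psi2_sq_split : exists s, simple_split (psi2_sq E) s /\
  (forall z, z \in s <-> exists P, P != 0 /\ exact_ord 2 P /\ px P = z)
  /\ balanced (b2 E) s.
Proof.
have [u2 s2 E2] := torsP (n := 2) isT.
set T := [seq P <- tors 2 | P != 0].
have TE P : (P \in T) = (P != 0) && (P *+ 2 == 0) by rewrite mem_filter E2.
have eT P : P \in T -> P != 0 /\ exact_ord 2 P.
  rewrite TE => /andP[P0 P2]; split=> //; apply/exact_ordP; split; first exact/eqP.
  by case=> [|[|m]] //; rewrite mulr1n.
suff hs : simple_split (psi2_sq E) [seq px P | P <- T].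
  exists [seq px P | P <- T]; split=> //; split; last first.
    exact: simple_split_balanced (char0_unit char0 3) (psi2_sq_top2 E) hs.
  move=> z; split=> [/mapP[P /eT[P0 oP] ->]|[P [P0 [oP <-]]]]; first by exists P.
  by apply/mapP; exists P => //; rewrite TE P0; case/andP: oP.
apply: simple_split_intro.
- exact: psi2_sq_neq0.
- rewrite map_inj_in_uniq ?filter_uniq // => P Q; rewrite !TE => /andP[P0 P2] /andP[Q0 Q2] e.
  have [//|->] := px_eq P0 Q0 e.
  by apply/eqP; rewrite eq_sym -addr_eq0 -mulr2n.
- have [sp _ _] := psi2_sq_top2 E; apply: leq_trans sp _; rewrite size_map ltnS -ltnS.
  rewrite -[(size T).+1]/(size (0 :: T)) -[4%N]s2; apply: uniq_leq_size => // P.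
  by rewrite E2 inE TE => ->; rewrite andbT orbN.
- move=> _ /mapP[P PT ->]; move: PT; rewrite TE => /andP[P0 P2].
  by rewrite -topredE /= /root -pw_sq // expf_eq0 pw_eq0.
Qed.

(** By induction the divisor in [prim_psi] has as simple roots the abscissas of the points whose
    order is a divisor d < n other than 2; the quotient keeps those of order n. The sums of 12 x +
    b2 are additive, so the mean passes to the quotient. *)
Lemma prim_psi_split n : (0 < n)%N -> n != 2 -> exists s,
  simple_split (prim_psi E n) s /\
  (forall z, z \in s <-> exists P, P != 0 /\ exact_ord n P /\ px P = z)
  /\ balanced (b2 E) s.
Proof.
elim/ltn_ind: n => n IH n0 n2.
have ex d : exists s, (0 < d < n)%N -> d != 2 -> simple_split (prim_psi E d) s /\
  (forall z, z \in s <-> exists P, P != 0 /\ exact_ord d P /\ px P = z)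
  /\ balanced (b2 E) s.
  have [/andP[d0 dn]|nd] := boolP (0 < d < n)%N; last by exists [::].
  have [->|d2] := eqVneq d 2%N; first by exists [::].
  by have [s hs] := IH d dn d0 d2; exists s.
have [f fP] := choice ex.
have dvP d : d \in divisors n -> (d != 2) && (d < n)%N -> (0 < d < n)%N /\ d != 2.
  rewrite -dvdn_divisors // => /dvdn_gt0 d0 /andP[d2 dn].
  by rewrite d0 // dn.
have ord_inj d d' P Q : (0 < d)%N -> (0 < d')%N -> P != 0 -> Q != 0 ->
    exact_ord d P -> exact_ord d' Q -> px P = px Q -> d = d'.
  move=> d0 d0' P0 Q0 oP oQ /(px_eq P0 Q0)[e|e]; apply: (exact_ord_inj d0 d0' oP).
    by rewrite e.
  by rewrite e exact_ordN.
have [||t [ht [tE tB]]] := @simple_split_prod F nat (divisors n)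
    (fun d => (d != 2) && (d < n)%N) (prim_psi E) f (divisors_uniq n).
- by move=> d dn /(dvP _ dn)[d1 d2]; case: (fP d d1 d2).
- move=> d d' z dn /(dvP _ dn)[d1 d2] dn' /(dvP _ dn')[d1' d2'].
  have [_ [/(_ z) fd _]] := fP d d1 d2; have [_ [/(_ z) fd' _]] := fP d' d1' d2'.
  move=> /fd[P [P0 [oP eP]]] /fd'[Q [Q0 [oQ eQ]]].
  case/andP: d1 => d1 _; case/andP: d1' => d1' _.
  by apply: (ord_inj d d' P Q) => //; rewrite eP eQ.
have [s [hs [sE sB]]] := psi_red_split n0.
have two_neq d P : (0 < d)%N -> P != 0 -> exact_ord d P -> d != 2 -> P *+ 2 != 0.
  move=> d0 P0 oP d2; rewrite (exact_ord_dvd _ d0 oP) dvdn_divisors // !inE.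
  rewrite (negPf d2) orbF; apply: contra P0 => /eqP d1.
  by case/andP: oP; rewrite d1 mulr1n.
have sub : {subset t <= s}.
  move=> z /tE[d [dn Pd zd]]; have [d1 d2] := dvP _ dn Pd.
  have [_ [/(_ z) fd _]] := fP d d1 d2; move/fd: zd => [P [P0 [oP eP]]].
  case/andP: d1 => d1 _.
  apply/sE; exists P; split=> //; first exact: two_neq oP d2.
  by apply/eqP; rewrite (exact_ord_dvd _ d1 oP) dvdn_divisors.
exists [seq z <- s | z \notin t]; split.
  by rewrite prim_psiE //; apply: simple_split_divl.
split; last first.
  have tB' : balanced (b2 E) t.
    by apply: tB => d dn Pd; have [d1 d2] := dvP _ dn Pd; case: (fP d d1 d2) => _ [].
  move: sB; rewrite /balanced (perm_big _ (perm_filter_notin _ _ sub)) /=.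
  - by rewrite big_cat /= tB' addr0.
  - by case: hs.
  - by case: ht.
move=> z; rewrite mem_filter; split=> [/andP[zt /sE[P [P0 P2 nP eP]]]|].
  have [d [d0 dn oP]] := exact_ord_exists n0 nP.
  exists P; split=> //; split=> //.
  have [-> //|dne] := eqVneq n d; case/negP: zt; apply/tE; exists d.
  have d2 : d != 2 by apply: contraNneq P2 => d2; case/andP: oP; rewrite d2.
  have ltd : (d < n)%N by rewrite ltn_neqAle eq_sym dne dvdn_leq.
  have d1 : (0 < d < n)%N by rewrite d0.
  split; first by rewrite -dvdn_divisors.
    by rewrite d2.
  by have [_ [/(_ z) fd _]] := fP d d1 d2; apply/fd; exists P.
case=> P [P0 [oP eP]]; apply/andP; split; last first.
  by apply/sE; exists P; split=> //; [exact: two_neq oP n2|apply/eqP; case/andP: oP].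
apply/negP => /tE[d [dn Pd zd]]; have [d1 d2] := dvP _ dn Pd.
have [_ [/(_ z) fd _]] := fP d d1 d2; move/fd: zd => [Q [Q0 [oQ eQ]]].
case/andP: d1 => d1 dlt.
have e : d = n by apply: (ord_inj d n Q P) => //; rewrite eP eQ.
by rewrite e ltnn in dlt.
Qed.
End PsiRoots.

(** * Absolute Galois groups *)

Section Extension.
Variables (A M : fieldType) (L : closedFieldType).
Variables (i : {rmorphism A -> M}) (iota : {rmorphism A -> L}).
Hypothesis alg : integralRange i.
Local Open Scope classical_set_scope.
Implicit Types G H : set (M * L).

(* The graph of a morphism over A from a subring of M to L. *)
Definition partial_hom G :=
  [/\ forall c, G (i c, iota c),
      forall u v, G u -> G v -> G (u.1 - v.1, u.2 - v.2),
      forall u v, G u -> G v -> G (u.1 * v.1, u.2 * v.2)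
    & forall y, G (0, y) -> y = 0].

Definition poly_graph G (p : {poly M}) (q : {poly L}) := forall k, G (p`_k, q`_k).

Section PartialHom.
Variables (G : set (M * L)) (hG : partial_hom G).

Lemma ph_base c : G (i c, iota c). Proof. by case: hG. Qed.
Lemma ph_sub x x' y y' : G (x, x') -> G (y, y') -> G (x - y, x' - y').
Proof. by case: hG => _ h _ _; apply: h. Qed.
Lemma ph_mul x x' y y' : G (x, x') -> G (y, y') -> G (x * y, x' * y').
Proof. by case: hG => _ _ h _; apply: h. Qed.
Lemma ph_fun0 y : G (0, y) -> y = 0. Proof. by case: hG => _ _ _; apply. Qed.
Lemma ph_0 : G (0, 0). Proof. by have := ph_base 0; rewrite !rmorph0. Qed.
Lemma ph_1 : G (1, 1). Proof. by have := ph_base 1; rewrite !rmorph1. Qed.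
Lemma ph_opp x x' : G (x, x') -> G (- x, - x').
Proof. by move=> h; rewrite -[- x]sub0r -[- x']sub0r; apply: ph_sub => //; apply: ph_0. Qed.
Lemma ph_add x x' y y' : G (x, x') -> G (y, y') -> G (x + y, x' + y').
Proof. by move=> hx /ph_opp hy; rewrite -[y]opprK -[y']opprK; apply: ph_sub. Qed.
Lemma ph_fun x y y' : G (x, y) -> G (x, y') -> y = y'.
Proof. by move=> h h'; apply/eqP; rewrite -subr_eq0; apply/eqP/ph_fun0; rewrite -(subrr x);
  apply: ph_sub. Qed.
Lemma ph_sum (I : Type) (r : seq I) (P : pred I) f f' :
  (forall j, G (f j, f' j)) -> G (\sum_(j <- r | P j) f j, \sum_(j <- r | P j) f' j).
Proof.
move=> h; apply: (big_ind2 (fun x y => G (x, y))) => //; first exact: ph_0.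
by move=> *; apply: ph_add.
Qed.

Lemma ph_exp x x' n : G (x, x') -> G (x ^+ n, x' ^+ n).
Proof.
move=> h; elim: n => [|n IH]; first exact: ph_1.
by rewrite !exprS; apply: ph_mul.
Qed.

Lemma ph_horner p x x' : G (x, x') -> G ((map_poly i p).[x], (map_poly iota p).[x']).
Proof.
move=> h; rewrite !horner_coef !size_map_poly; apply: ph_sum => k.
by rewrite !coef_map; apply: ph_mul; [apply: ph_base|apply: ph_exp].
Qed.

(** An equation of x is divided by X until its constant term is nonzero. The domain of a partial
    morphism is thus closed under inverses. *)
Lemma alg_inverse (p : {poly A}) x : x != 0 -> p != 0 -> (map_poly i p).[x] = 0 ->
  exists h : {poly A}, x * (map_poly i h).[x] = 1.
Proof.
move=> x0; elim/poly_ind: p => [|p c IH]; first by rewrite eqxx.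
rewrite rmorphD rmorphM /= map_polyX map_polyC !hornerE /=.
have [->|c0] := eqVneq c 0.
  rewrite !addr0 rmorph0 addr0 mulf_eq0 negb_or => /andP[p0 _] /eqP.
  by rewrite mulf_eq0 (negPf x0) orbF => /eqP; apply: IH.
move=> _ /eqP; rewrite addr_eq0 => /eqP e; exists (- c^-1 *: p).
rewrite map_polyZ hornerZ mulrCA [x * _]mulrC e rmorphN mulrNN -rmorphM mulVf //.
exact: rmorph1.
Qed.

Lemma ph_inv x x' : G (x, x') -> exists2 y', G (x^-1, y') & (x != 0 -> x' * y' = 1).
Proof.
move=> hx; have [->|x0] := eqVneq x 0.
  by exists 0; rewrite // invr0; apply: ph_0.
have [p mp /eqP px] := alg x.
have [h eh] := alg_inverse x0 (monic_neq0 mp) px.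
exists ((map_poly iota h).[x']) => [|_].
  by rewrite -[x^-1]mulr1 -eh mulKf //; apply: ph_horner.
by apply: (@ph_fun 1 _ _ _ ph_1); rewrite -eh; apply: ph_mul => //; apply: ph_horner.
Qed.

Lemma pg_sub p q p' q' : poly_graph G p p' -> poly_graph G q q' -> poly_graph G (p - q) (p' - q').
Proof. by move=> hp hq k; rewrite !coefB; apply: ph_sub. Qed.

Lemma pg_mul p q p' q' : poly_graph G p p' -> poly_graph G q q' -> poly_graph G (p * q) (p' * q').
Proof. by move=> hp hq k; rewrite !coefM; apply: ph_sum => j; apply: ph_mul. Qed.

Lemma pg_C c c' : G (c, c') -> poly_graph G c%:P c'%:P.
Proof. by move=> h [|k]; rewrite !coefC //=; apply: ph_0. Qed.

Lemma pg_Xn n : poly_graph G 'X^n 'X^n.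
Proof. by move=> k; rewrite !coefXn; case: eqP => _; [apply: ph_1|apply: ph_0]. Qed.

Lemma pg_size p p' : p \is monic -> poly_graph G p p' -> size p' = size p.
Proof.
move=> mp h; have p0 := monic_neq0 mp.
have l1 : p'`_(size p).-1 = 1.
  by apply: (@ph_fun 1 _ _ _ ph_1); have := h (size p).-1; rewrite -lead_coefE (monicP mp).
apply/eqP; rewrite eqn_leq; apply/andP; split.
  by apply/leq_sizeP => j hj; apply: ph_fun0; have := h j; rewrite nth_default.
rewrite -(prednK (_ : 0 < size p)%N) ?lt0n ?size_poly_eq0 //.
rewrite ltnNge; apply/negP => le.
by have /eqP := nth_default 0 le; rewrite l1 oner_eq0.
Qed.

(* p is the minimal polynomial of z over the domain of G. *)
Lemma pg_min_poly z : exists p p', [/\ p \is monic, p.[z] = 0, poly_graph G p p' &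
  forall q q' z', poly_graph G q q' -> q.[z] = 0 -> p'.[z'] = 0 -> q'.[z'] = 0].
Proof.
pose good n := `[< exists p p', [/\ p \is monic, p.[z] = 0, poly_graph G p p' & size p = n] >].
have ex : exists n, good n.
  have [p mp /eqP pz] := alg z; exists (size (map_poly i p)); apply/asboolP.
  exists (map_poly i p), (map_poly iota p); split=> //; first exact: monic_map.
  by move=> k; rewrite !coef_map; apply: ph_base.
case: (ex_minnP ex) => n /asboolP[p [p' [mp pz hp sp]]] nmin.
exists p, p'; split=> // q q' z' + + p'z; move: {2}(size q) (leqnn (size q)) => m.
elim: m q q' => [|m IH] q q' sq hq qz.
  have q0 : q = 0 by apply/eqP; rewrite -size_poly_eq0 -leqn0.
  rewrite q0 in hq.
  have -> : q' = 0 by apply/polyP => k; rewrite coef0; apply: ph_fun0; have := hq k; rewrite coef0.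
  by rewrite horner0.
have [sq'|sq'] := leqP (size q) m; first exact: IH sq' hq qz.
have {sq sq'}sq : size q = m.+1 by apply/eqP; rewrite eqn_leq sq.
have q0 : q != 0 by rewrite -size_poly_eq0 sq.
have hd := hq m; set d := q`_m in hd; set d' := q'`_m in hd.
have dE : d = lead_coef q by rewrite lead_coefE sq.
have d0 : d != 0 by rewrite dE lead_coef_eq0.
(* If q is shorter than p, making it monic contradicts the minimality of p. Otherwise one step of
   Euclidean division by p lowers the size of q and changes neither value, p vanishing at z and p'
   at z'. *)
have [lt|le] := ltnP m.+1 n.
  have [e he _] := ph_inv hd.
  have : good m.+1.
    apply/asboolP; exists (d^-1%:P * q), (e%:P * q'); split.
    - by rewrite monicE lead_coefM lead_coefC -dE mulVf.
    - by rewrite hornerM qz mulr0.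
    - by apply: pg_mul => //; apply: pg_C.
    - by rewrite mul_polyC size_scale // invr_eq0.
  by move/nmin; rewrite leqNgt lt.
have n0 : (0 < n)%N by rewrite -sp lt0n size_poly_eq0 monic_neq0.
set k := (m.+1 - n)%N.
have e1 : (q - d%:P * ('X^k * p)).[z] = 0.
  by rewrite hornerD hornerN qz !hornerM pz !mulr0 subrr.
have h1 := pg_sub hq (pg_mul (pg_C hd) (pg_mul (pg_Xn k) hp)).
have := IH _ _ _ h1 e1; rewrite hornerD hornerN !hornerM p'z !mulr0 subr0; apply.
apply/leq_sizeP => j; rewrite leq_eqVlt => /predU1P[<-|lt].
  rewrite coefB coefCM coefXnM ifF; last by rewrite /k; lia.
  rewrite (_ : m - k = (size p).-1)%N; last by rewrite sp /k; lia.
  by rewrite -lead_coefE (monicP mp) mulr1 subrr.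
rewrite coefB coefCM coefXnM ifF; last by rewrite /k; lia.
have -> : q`_j = 0 by rewrite nth_default // sq.
have -> : p`_(j - k) = 0 by rewrite nth_default // sp /k; lia.
by rewrite mulr0 subr0.
Qed.

Lemma ph_extend z z' : (forall q q', poly_graph G q q' -> q.[z] = 0 -> q'.[z'] = 0) ->
  exists H, [/\ partial_hom H, G `<=` H & H (z, z')].
Proof.
move=> zz'; exists [set u | exists q q', poly_graph G q q' /\ u = (q.[z], q'.[z'])].
split.
- split=> [c|_ _ [q [q' [hq ->]]] [r [r' [hr ->]]]|_ _ [q [q' [hq ->]]] [r [r' [hr ->]]]|y].
  + by exists (i c)%:P, (iota c)%:P; split; [apply/pg_C/ph_base|rewrite !hornerC].
  + by exists (q - r), (q' - r'); split; [apply: pg_sub|rewrite !hornerD !hornerN].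
  + by exists (q * r), (q' * r'); split; [apply: pg_mul|rewrite !hornerM].
  + by case=> q [q' [hq [/esym eq ->]]]; apply: zz' eq.
- by case=> x y hxy; exists x%:P, y%:P; split; [apply: pg_C|rewrite !hornerC].
- exists 'X, 'X; rewrite !hornerX; split=> //.
  by rewrite -['X]expr1 -[X in poly_graph _ _ X]expr1; apply: pg_Xn.
Qed.

Lemma ph_extend_exists z : exists z' H, [/\ partial_hom H, G `<=` H & H (z, z')].
Proof.
have [p [p' [mp pz hp hmin]]] := pg_min_poly z.
have sp' : size p' != 1%N.
  rewrite (pg_size mp hp); apply/eqP => /eqP/size_poly1P[c c0 ep].
  by move: pz; rewrite ep hornerC => /eqP; rewrite (negPf c0).
have [z' /eqP pz'] := closed_rootP p' sp'.
by exists z'; apply: ph_extend => q q' hq qz; apply: hmin hq qz pz'.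
Qed.
End PartialHom.

Lemma partial_hom_total G : partial_hom G -> (forall x, exists y, G (x, y)) ->
  exists phi : {rmorphism M -> L}, forall x, G (x, phi x).
Proof.
move=> hG tot; have [f fG] := choice tot.
have fB : zmod_morphism f.
  by move=> x y; apply: (ph_fun hG (fG _)); apply: (ph_sub hG).
have fM : monoid_morphism f.
  split; first by apply: (ph_fun hG (fG _)); apply: ph_1.
  by move=> x y; apply: (ph_fun hG (fG _)); apply: (ph_mul hG).
pose Za := GRing.isZmodMorphism.Build M L f fB.
pose Ma := GRing.isMonoidMorphism.Build M L f fM.
pose phi : {rmorphism M -> L} := HB.pack f Za Ma.
by exists phi.
Qed.

Lemma extend_partial_hom G0 : partial_hom G0 ->
  exists phi : {rmorphism M -> L}, forall u, G0 u -> phi u.1 = u.2.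
Proof.
(* The union with [G0] inside [P] makes the empty set a member, as Zorn's lemma requires for the
   empty chain. *)
move=> h0; pose P : set (set (M * L)) := [set G | partial_hom (G0 `|` G)].
have [|G [PG Gmax]] := @Zorn_bigcup _ P.
  move=> C CP tot; rewrite /P /=.
  have mem u v : (G0 `|` \bigcup_(X in C) X) u -> (G0 `|` \bigcup_(X in C) X) v ->
      (G0 u /\ G0 v) \/ exists X, [/\ C X, (G0 `|` X) u & (G0 `|` X) v].
    case=> [uG|[X CX uX]] [vG|[Y CY vY]]; [by left|right|right|right].
    - by exists Y; split=> //; [left|right].
    - by exists X; split=> //; [right|left].
    - have [XY|YX] := tot _ _ CX CY.
        by exists Y; split=> //; right=> //; apply: XY.
      by exists X; split=> //; right=> //; apply: YX.
  have sub X : C X -> G0 `|` X `<=` G0 `|` \bigcup_(X in C) X.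
    by move=> CX u [uG|uX]; [left|right; exists X].
  split=> [c|u v hu hv|u v hu hv|y hy].
  - by left; apply: ph_base.
  - case: (mem u v hu hv) => [[uG vG]|[X [CX uX vX]]].
      by left; case: h0 => _ h _ _; apply: h.
    by apply: (sub X CX); case: (CP X CX) => _ h _ _; apply: h.
  - case: (mem u v hu hv) => [[uG vG]|[X [CX uX vX]]].
      by left; case: h0 => _ _ h _; apply: h.
    by apply: (sub X CX); case: (CP X CX) => _ _ h _; apply: h.
  - case: (mem _ _ hy hy) => [[uG _]|[X [CX uX _]]]; first exact: ph_fun0 h0 _ uG.
    exact: ph_fun0 (CP X CX) _ uX.
have tot x : exists y, (G0 `|` G) (x, y).
  have [y [H [hH GH Hxy]]] := ph_extend_exists PG x; exists y.
  apply: contrapT => nG; apply: (Gmax H); last first.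
    rewrite /P /= (_ : G0 `|` H = H) //; apply/setUidPr => u Gu; apply: GH; by left.
  split; first by move=> u Gu; apply: GH; right.
  by move=> HG; apply: nG; right; apply: HG.
have [phi hphi] := partial_hom_total PG tot; exists phi => -[x y] Gxy /=.
by apply: (ph_fun PG (hphi x)); left.
Qed.

Lemma partial_hom_base : partial_hom [set u | exists c, u = (i c, iota c)].
Proof.
split=> [c|_ _ [c ->] [d ->]|_ _ [c ->] [d ->]|y [c [/esym/eqP]]].
- by exists c.
- by exists (c - d); rewrite !rmorphB.
- by exists (c * d); rewrite !rmorphM.
- by rewrite fmorph_eq0 => /eqP -> ->; rewrite rmorph0.
Qed.

Lemma extend_hom : exists phi : {rmorphism M -> L}, forall c, phi (i c) = iota c.
Proof.
have [phi hphi] := extend_partial_hom partial_hom_base; exists phi => c.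
by apply: (hphi (i c, iota c)); exists c.
Qed.

Lemma extend_hom_conj z z' :
  (forall q : {poly A}, (map_poly i q).[z] = 0 -> (map_poly iota q).[z'] = 0) ->
  exists phi : {rmorphism M -> L}, (forall c, phi (i c) = iota c) /\ phi z = z'.
Proof.
move=> zz'; have [|H [hH GH Hz]] := @ph_extend _ partial_hom_base z z'.
  move=> q q' hq qz.
  have [r rP] := choice hq.
  pose p := \poly_(k < maxn (size q) (size q')) r k.
  have ep : map_poly i p = q.
    apply/polyP => k; rewrite coef_map coef_poly; case: ltnP => [_|le].
      by have [] := rP k.
    by rewrite raddf0 nth_default // (leq_trans (leq_maxl _ _) le).
  have ep' : map_poly iota p = q'.
    apply/polyP => k; rewrite coef_map coef_poly; case: ltnP => [_|le].
      by have [] := rP k.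
    by rewrite raddf0 nth_default // (leq_trans (leq_maxr _ _) le).
  by rewrite -ep'; apply: zz'; rewrite ep.
have [phi hphi] := extend_partial_hom hH; exists phi; split.
  by move=> c; apply: (hphi (i c, iota c)); apply: GH; exists c.
exact: (hphi (z, z')).
Qed.
End Extension.

Lemma root_conj (K M : fieldType) (L : fieldType) (i : {rmorphism K -> M})
    (iota : {rmorphism K -> L}) (phi : {rmorphism M -> L}) (p : {poly K}) x :
  (forall c, phi (i c) = iota c) ->
  root (map_poly iota p) (phi x) = root (map_poly i p) x.
Proof.
move=> h; have -> : map_poly iota p = map_poly phi (map_poly i p).
  by rewrite -map_poly_comp; apply: eq_map_poly => c /=; rewrite h.
exact: fmorph_root.
Qed.

Section AbsoluteGaloisTheory.
Variables (K : fieldType) (L : closedFieldType) (iota : {rmorphism K -> L}).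
Hypothesis alg : integralRange iota.

(** An injective map permutes the finite set of roots in L of each polynomial over K, and these sets
    cover L. *)
Lemma endo_bijective (s : {rmorphism L -> L}) : (forall c, s (iota c) = iota c) -> bijective s.
Proof.
move=> sf; have surj y : exists x, s x = y.
  have [p mp py] := alg y; have p0 : map_poly iota p != 0 by rewrite map_poly_eq0 monic_neq0.
  have [rs ers] := closed_field_poly_normal (map_poly iota p).
  have rE x : (x \in undup rs) = root (map_poly iota p) x.
    by rewrite mem_undup ers rootZ ?lead_coef_eq0 // root_prod_XsubC.
  have sub : {subset [seq s x | x <- undup rs] <= undup rs}.
    by move=> _ /mapP[x + ->]; rewrite !rE (root_conj _ _ sf).
  have us : uniq [seq s x | x <- undup rs].
    by rewrite map_inj_uniq ?undup_uniq //; apply: fmorph_inj.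
  have [_ e] := uniq_min_size us sub ltac:(by rewrite size_map).
  by move: py; rewrite -rE -e => /mapP[x _ ->]; exists x.
have [g gP] := choice surj; exists g => // x.
by apply: (fmorph_inj s); rewrite gP.
Qed.

Definition abs_gal_of (s : {rmorphism L -> L}) (h : forall c, s (iota c) = iota c) :
  abs_gal iota := AbsGal (endo_bijective h) h.

Lemma abs_gal_root (s : abs_gal iota) (p : {poly K}) x :
  root (map_poly iota p) (s x) = root (map_poly iota p) x.
Proof. by apply: root_conj => c; rewrite gal_fix. Qed.

Lemma abs_gal_comp (s t : abs_gal iota) : exists u : abs_gal iota, forall x, u x = t (s x).
Proof.
have h c : (gal_fun t \o gal_fun s) (iota c) = iota c by rewrite /= !gal_fix.
by exists (abs_gal_of h).
Qed.

Lemma integral_over_ext (S : fieldType) (i : {rmorphism K -> S}) (j : {rmorphism S -> L}) :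
  (forall c, j (i c) = iota c) -> integralRange j.
Proof.
move=> h z; have [p mp pz] := alg z; exists (map_poly i p); first exact: monic_map.
rewrite -map_poly_comp; suff -> : map_poly (j \o i) p = map_poly iota p by [].
by apply: eq_map_poly => c /=; rewrite h.
Qed.

(** L is algebraic over S through [j1], so [j2] extends along [j1]. *)
Lemma abs_gal_extend (S : fieldType) (i : {rmorphism K -> S}) (j1 j2 : {rmorphism S -> L}) :
  (forall c, j1 (i c) = iota c) -> (forall c, j2 (i c) = iota c) ->
  exists s : abs_gal iota, forall x, s (j1 x) = j2 x.
Proof.
move=> h1 h2; have [phi hphi] := extend_hom j2 (integral_over_ext h1).
have fix_phi c : phi (iota c) = iota c by rewrite -h1 hphi h2.
by exists (abs_gal_of fix_phi).
Qed.
End AbsoluteGaloisTheory.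

Section FixedField.
Variables (A : fieldType) (L : closedFieldType) (i : {rmorphism A -> L}).
Hypotheses (alg : integralRange i) (char0 : [pchar A] =i pred0).

(** In characteristic 0 a minimal polynomial of degree above 1 has a second root, and some morphism
    over A sends y to it. *)
Lemma fixed_in_base y :
  (forall s : {rmorphism L -> L}, (forall c, s (i c) = i c) -> s y = y) ->
  exists a, y = i a.
Proof.
move=> fixy.
pose good n := `[< exists p : {poly A}, [/\ p != 0, root (map_poly i p) y & size p = n] >].
have ex : exists n, good n.
  by have [p mp py] := alg y; exists (size p); apply/asboolP; exists p; split=> //;
    apply: monic_neq0.
case: (ex_minnP ex) => n /asboolP[p [p0 py sp]] nmin.
have pmin q : q != 0 -> root (map_poly i q) y -> (n <= size q)%N.
  by move=> q0 qy; apply: nmin; apply/asboolP; exists q.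
have n1 : (1 < n)%N.
  rewrite ltnNge; apply/negP => le1; move: p0 py; rewrite [p]size1_polyC ?sp //.
  by rewrite polyC_eq0 map_polyC /root hornerC fmorph_eq0 => /negPf ->.
have lp : p`_n.-1 != 0 by rewrite -sp -lead_coefE lead_coef_eq0.
have [n2|n2] := leqP n 2.
  have en : n = 2%N by lia.
  move: py lp; rewrite en /= /root horner_coef size_map_poly sp en.
  rewrite big_ord_recl big_ord1 /= !coef_map expr0 mulr1 expr1 addr_eq0 => /eqP e lp.
  exists (- (p`_0 / p`_1)); rewrite rmorphN fmorph_div /= e mulNr opprK mulrC mulKf //.
  by rewrite fmorph_eq0.
have d0 : p^`() != 0.
  apply/eqP => /(congr1 (fun q : {poly A} => q`_n.-2)).
  rewrite coef_deriv coef0 prednK; last by lia.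
  move=> /eqP; rewrite -mulr_natr mulf_eq0 (negPf lp) /= ((pcharf0P A).1 char0).
  by lia.
have dy : ~~ root (map_poly i p^`()) y.
  by apply/negP => /(pmin _ d0); rewrite leqNgt -sp lt_size_deriv.
have /factor_theorem[q eq] := py.
have qy : q.[y] != 0.
  apply: contra dy => /eqP qy0; rewrite -deriv_map eq derivM derivXsubC /root.
  by rewrite !hornerE /= qy0 subrr !mulr0 ?addr0.
have q0 : q != 0 by apply: contraNneq qy => ->; rewrite horner0.
have sq : size q = n.-1.
  have := congr1 (fun r : {poly L} => size r) eq.
  rewrite size_map_poly sp size_Mmonic ?monicXsubC // size_XsubC addnC /=.
  by move=> ->.
have [r /eqP qr] := closed_rootP q ltac:(rewrite sq; lia).
have ry : r != y by apply: contraNneq qy => <-; rewrite qr.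
have [g gy|phi [phi_i phi_y]] := @extend_hom_conj A L L i i alg y r.
  have e : g %% p = 0.
    apply/eqP; apply: contraTT isT => g0.
    have root_g : root (map_poly i (g %% p)) y.
      move: gy; rewrite {1}(divp_eq g p) rmorphD rmorphM /= hornerD hornerM.
      by rewrite (eqP py) mulr0 add0r => e; apply/eqP.
    by have := pmin _ g0 root_g; rewrite leqNgt -sp ltn_modp p0.
  by rewrite (divp_eq g p) e addr0 rmorphM /= hornerM eq hornerM qr mul0r mulr0.
by move/eqP: ry; case; rewrite -phi_y fixy.
Qed.
End FixedField.

Section AdjoinInduction.
Variables (K : fieldType) (S : fieldExtType K).

(** Elements of a finite extension are polynomials in the adjoined ones, so closure under sums and
    products is enough. *)
Lemma adjoin_seq_ind (P : S -> Prop) (rs : seq S) :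
  (forall c : K, P c%:A) -> (forall x y, P x -> P y -> P (x + y)) ->
  (forall x y, P x -> P y -> P (x * y)) -> {in rs, forall r, P r} ->
  forall x, x \in <<1 & rs>>%VS -> P x.
Proof.
move=> P1 PD PM; elim/last_ind: rs => [_ x|rs r IH Prs x].
  by rewrite adjoin_nil subfield_closed => /vlineP[c ->].
rewrite adjoin_rcons => /Fadjoin_polyP[p /polyOverP Kp ->].
have Pr : P r by apply: Prs; rewrite mem_rcons mem_head.
have P0 : P 0 by rewrite -(scale0r 1); apply: P1.
rewrite horner_coef; apply: (big_ind P) => // k _; apply: (PM).
  by apply: IH (Kp _) => s hs; apply: Prs; rewrite mem_rcons inE hs orbT.
elim: {k}(k : nat) => [|k IHk]; first by rewrite expr0 -(scale1r 1); apply: P1.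
by rewrite exprS; apply: PM.
Qed.

Lemma in_alg_integral : integralRange (in_alg S).
Proof.
move=> x; have /polyOver1P[q eq] := minPolyOver 1%AS x.
exists q; last by rewrite -eq root_minPoly.
by rewrite -(map_monic (in_alg S)) -eq monic_minPoly.
Qed.
End AdjoinInduction.

Section GaloisIsog.
Variables (K : fieldType) (L : closedFieldType) (iota : {rmorphism K -> L}).
Hypothesis alg : integralRange iota.

(** Both Galois groups of the theorem are computed with this: [R] has to distinguish automorphisms
    exactly as their action on the roots of [f] does. The splitting field S is embedded in L by [j];
    automorphisms of S lift to L, and those of L restrict to S. *)
Lemma galois_isog (f : {poly K}) (U : Type) (op : U -> U -> U) (R : abs_gal iota -> U) :
  f != 0 ->
  (forall s t u : abs_gal iota, (forall x, u x = t (s x)) -> R u = op (R s) (R t)) ->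
  (forall s t : abs_gal iota,
    R s = R t <-> (forall x, root (map_poly iota f) x -> s x = t x)) ->
  galois_group_isog f op (range R)%classic.
Proof.
move=> f0 Rmul Req S [rs frs genS].
have [j jE] := extend_hom iota (@in_alg_integral K S).
have rsE x : root (map_poly (in_alg S) f) x = (x \in rs).
  by rewrite (eqp_root frs) root_prod_XsubC.
have rsj x : root (map_poly iota f) x -> exists2 r, r \in rs & j r = x.
  have -> : map_poly iota f = map_poly j (map_poly (in_alg S) f).
    by rewrite -map_poly_comp; apply: eq_map_poly => c /=; rewrite jE.
  move/eqpfP: frs => ->; rewrite map_polyZ rmorph_prod /=.
  rewrite (eq_bigr (fun z => 'X - (j z)%:P)); last by move=> z _;
    rewrite rmorphB /= map_polyX map_polyC.
  rewrite rootZ; last first.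
    by rewrite fmorph_eq0 mulf_neq0 ?invr_eq0 ?lead_coef_eq0 ?map_poly_eq0 // monic_neq0
      ?monic_prod_XsubC.
  rewrite -(big_map j xpredT (fun z => 'X - z%:P)) root_prod_XsubC => /mapP[r rrs ->].
  by exists r.
have lift (s : gal_of {:S}%AS) : exists sh : abs_gal iota, forall x, sh (j x) = j (s x).
  pose j2 : {rmorphism S -> L} := j \o gal_repr s.
  have j2E c : j2 (in_alg S c) = iota c by rewrite /j2 /= linearZ /= rmorph1 -jE.
  by have [sh shE] := abs_gal_extend alg jE j2E; exists sh.
have [F FE] := choice lift.
exists (fun s => R (F s)); split.
- move=> s t _ _; have [u uE] := abs_gal_comp alg (F s) (F t).
  rewrite -(Rmul _ _ _ uE); apply/Req => _ /rsj[r _ <-].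
  by rewrite uE !FE galM ?memvf.
- move=> s t _ _ /Req e; apply/eqP/gal_eqP => x _.
  apply: (fmorph_inj j); rewrite -!FE.
  have: x \in <<1 & rs>>%VS by rewrite genS memvf.
  apply: (adjoin_seq_ind (P := fun x => F s (j x) = F t (j x))) => {x}.
  + by move=> c; rewrite jE !gal_fix.
  + by move=> x y ex ey; rewrite !rmorphD ex ey.
  + by move=> x y ex ey; rewrite !rmorphM ex ey.
  + by move=> r rrs; apply: e; rewrite (root_conj _ _ jE) rsE.
apply/seteqP; split=> y [s _ <-]; first by exists (F s).
(* Since [s] permutes the roots of [f], which generate S, it preserves the image of S; [g] is the
   automorphism induced on S. *)
have ex x : exists y, j y = s (j x).
  have: x \in <<1 & rs>>%VS by rewrite genS memvf.
  apply: (adjoin_seq_ind (P := fun x => exists y, j y = s (j x))) => {x}.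
  + by move=> c; exists c%:A; rewrite jE gal_fix.
  + by move=> x1 x2 [x' e1] [y' e2]; exists (x' + y'); rewrite !rmorphD e1 e2.
  + by move=> x1 x2 [x' e1] [y' e2]; exists (x' * y'); rewrite !rmorphM e1 e2.
  + move=> r rrs; have : root (map_poly iota f) (s (j r)).
      by rewrite abs_gal_root (root_conj _ _ jE) rsE.
    by case/rsj => r' _ <-; exists r'.
have [g gE] := choice ex.
have gD : {morph g : x1 x2 / x1 + x2} by move=> x1 x2; apply: (fmorph_inj j);
  rewrite !(gE, rmorphD).
have gM : {morph g : x1 x2 / x1 * x2} by move=> x1 x2; apply: (fmorph_inj j);
  rewrite !(gE, rmorphM).
have gA c : g c%:A = c%:A by apply: (fmorph_inj j); rewrite gE jE gal_fix.
have gL : linear g by move=> c x1 x2; rewrite gD -mulr_algl gM gA mulr_algl.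
pose gl : {linear S -> S} := HB.pack g (GRing.isLinear.Build _ _ _ _ g gL).
have hom : kHom 1 {:S} (linfun gl).
  apply/kHomP; split=> [x1 x2 _ _|_ /vlineP[c ->]]; first by rewrite !lfunE /= gM.
  by rewrite lfunE /= gA.
have sub : (1%AS <= {:S}%AS <= {:S}%AS)%VS by rewrite sub1v subvv.
have [t galt tE] := kHom_to_gal sub (normalFieldf _) hom.
exists t => //; apply/Req => _ /rsj[r _ <-].
by rewrite FE -gE -tE ?memvf // lfunE.
Qed.
End GaloisIsog.

(** * Averages over conjugates *)

Section Average.
Variables (K : fieldType) (L : closedFieldType) (iota : {rmorphism K -> L}).
Hypotheses (alg : integralRange iota) (char0 : [pchar L] =i pred0).
Implicit Types (V s : seq L) (x : L).

Definition gal_stable s := forall (t : abs_gal iota) x, x \in s -> t x \in s.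
Definition gal_orbit s := forall x y, x \in s -> y \in s -> exists t : abs_gal iota, t x = y.

Lemma gal_stable_perm s (t : abs_gal iota) : uniq s -> gal_stable s ->
  perm_eq [seq t x | x <- s] s.
Proof.
move=> us st; have ut : uniq [seq t x | x <- s] by rewrite map_inj_uniq //; apply: fmorph_inj.
have sub : {subset [seq t x | x <- s] <= s} by move=> _ /mapP[x xs ->]; apply: st.
have [_ e] := uniq_min_size ut sub ltac:(by rewrite size_map).
exact: uniq_perm.
Qed.

(** [I] is the set of maps from [V] to itself induced by the Galois group, and [t] lifts each of
    them. A common [V] for several orbits allows their averages to be added. *)
Lemma finite_galois_average V : gal_stable V -> exists (I : finType) (t : I -> abs_gal iota),
  (0 < #|I|)%N /\ forall s (b0 : K), uniq s -> {subset s <= V} -> gal_stable s -> gal_orbit s ->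
    \sum_(z <- s) (12%:R * z + iota b0) = 0 ->
  forall x, x \in s -> \sum_(k : I) (12%:R * t k x + iota b0) = 0.
Proof.
move=> stV; pose T : finType := seq_sub V.
pose act (t : abs_gal iota) (v : T) : T := SeqSub (stV t _ (ssvalP v)).
pose good (h : {ffun T -> T}) := `[< exists t, forall v, h v = act t v >].
pose I := {h : {ffun T -> T} | good h}.
have ex (h : I) : exists t, forall v, val h v = act t v by case: h => h /= /asboolP.
have [t tE] := choice ex.
have good_act u : good [ffun v => act u v] by apply/asboolP; exists u => v; rewrite ffunE.
pose mk h (p : good h) : I := exist (fun h => is_true (good h)) h p.
exists I, t; split.
  have idf c : (idfun : {rmorphism L -> L}) (iota c) = iota c by [].
  by apply/card_gt0P; exists (mk _ (good_act (abs_gal_of alg idf))).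
move=> s b0 us sub sts orb bal x xs.
have tval (h : I) y (yV : y \in V) : t h y = ssval (val h (SeqSub yV)) by rewrite tE.
(* Composition with [u] permutes [I], so the sum has the same value at y and at u(y). *)
have inv (u : abs_gal iota) y : y \in V ->
    \sum_(k : I) (12%:R * t k (u y) + iota b0) = \sum_(k : I) (12%:R * t k y + iota b0).
  move=> yV; have good_u (h : I) : good [ffun v => val h (act u v)].
    apply/asboolP; have [w wE] := abs_gal_comp alg u (t h).
    by exists w => v; rewrite ffunE tE; apply: val_inj; rewrite /= wE.
  pose r (h : I) : I := mk _ (good_u h).
  have act_inj : injective (act u).
    by move=> v w /(congr1 (fun z : T => ssval z)) /= /fmorph_inj e; apply: val_inj.
  have r_inj : injective r.
    move=> h h' /(congr1 val) /= /ffunP e; apply: val_inj; apply/ffunP => v.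
    by have := e (invF act_inj v); rewrite !ffunE f_invF.
  rewrite [RHS](reindex_inj r_inj); apply: eq_bigr => h _; congr (12%:R * _ + _).
  rewrite (tval (r h) _ yV) /= ffunE (tval h _ (stV u _ yV)).
  by congr (ssval (_ _)); apply: val_inj.
have const y : y \in s ->
    \sum_(k : I) (12%:R * t k y + iota b0) = \sum_(k : I) (12%:R * t k x + iota b0).
  by move=> ys; have [u <-] := orb _ _ xs ys; apply: inv; apply: sub.
(* Exchanging the sums gives 0, as each [t k] permutes [s]; on the other hand this is the size of
   [s] times the constant value. *)
have : \sum_(y <- s) \sum_(k : I) (12%:R * t k y + iota b0) = 0.
  rewrite exchange_big big1 // => k _ /=.
  rewrite -(big_map (t k) xpredT (fun z => 12%:R * z + iota b0)).
  by rewrite (perm_big _ (gal_stable_perm _ us sts)).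
rewrite (eq_big_seq _ const) big_const_seq count_predT iter_addr_0 => /eqP.
rewrite -[_ *+ size s]mulr_natl mulf_eq0 ((pcharf0P L).1 char0) => /orP[/eqP s0|/eqP //].
by move: xs; rewrite (size0nil s0).
Qed.

Lemma galois_average x1 x2 x3 s1 s2 s3 (b0 c : K) :
  [/\ uniq s1, uniq s2 & uniq s3] -> [/\ x1 \in s1, x2 \in s2 & x3 \in s3] ->
  [/\ gal_stable s1, gal_stable s2 & gal_stable s3] ->
  [/\ gal_orbit s1, gal_orbit s2 & gal_orbit s3] ->
  [/\ \sum_(z <- s1) (12%:R * z + iota b0) = 0, \sum_(z <- s2) (12%:R * z + iota b0) = 0
    & \sum_(z <- s3) (12%:R * z + iota b0) = 0] ->
  x1 + x2 + x3 = iota c -> 12%:R * c + 3%:R * b0 = 0.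
Proof.
move=> [u1 u2 u3] [h1 h2 h3] [st1 st2 st3] [o1 o2 o3] [b1 b2 b3] e.
have stV : gal_stable (s1 ++ s2 ++ s3).
  move=> t x; rewrite !mem_cat => /or3P[] h; apply/or3P;
  [apply: Or31; apply: st1|apply: Or32; apply: st2|apply: Or33; apply: st3]; exact: h.
have [I [t [I0 av]]] := finite_galois_average stV.
have sub1 : {subset s1 <= s1 ++ s2 ++ s3} by move=> z h; rewrite mem_cat h.
have sub2 : {subset s2 <= s1 ++ s2 ++ s3} by move=> z h; rewrite !mem_cat h orbT.
have sub3 : {subset s3 <= s1 ++ s2 ++ s3} by move=> z h; rewrite !mem_cat h !orbT.
have := av _ _ u1 sub1 st1 o1 b1 _ h1; have := av _ _ u2 sub2 st2 o2 b2 _ h2.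
have := av _ _ u3 sub3 st3 o3 b3 _ h3 => a3 a2 a1.
have : \sum_(k : I) iota (12%:R * c + 3%:R * b0) = 0.
  rewrite (eq_bigr (fun k => (12%:R * t k x1 + iota b0) + (12%:R * t k x2 + iota b0)
    + (12%:R * t k x3 + iota b0))); last first.
    move=> k _; have ek : t k x1 + t k x2 + t k x3 = iota c by rewrite -!rmorphD e gal_fix.
    by rewrite rmorphD !rmorphM !rmorph_nat -ek; ring.
  by rewrite big_split /= a3 addr0 big_split /= a1 a2 addr0.
rewrite big_const iter_addr_0 -[_ *+ #|_|]mulr_natl => /eqP.
rewrite mulf_eq0 ((pcharf0P L).1 char0) -leqn0 leqNgt I0 /= fmorph_eq0.
by move/eqP.
Qed.
End Average.

(** * The Galois action on torsion points *)

Section BaseChangePolynomials.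
Variables (K L : fieldType) (f : {rmorphism K -> L}) (E : weierstrass K).
Local Notation EL := (map_weierstrass f E).

Lemma map_b2 : b2 EL = f (b2 E).
Proof. by rewrite /b2 /= !(rmorph_nat, rmorphXn, rmorphM, rmorphD). Qed.
Lemma map_b4 : b4 EL = f (b4 E).
Proof. by rewrite /b4 /= !(rmorph_nat, rmorphXn, rmorphM, rmorphD). Qed.
Lemma map_b6 : b6 EL = f (b6 E).
Proof. by rewrite /b6 /= !(rmorph_nat, rmorphXn, rmorphM, rmorphD). Qed.
Lemma map_b8 : b8 EL = f (b8 E).
Proof. by rewrite /b8 /= !(rmorph_nat, rmorphXn, rmorphM, rmorphB, rmorphD). Qed.

Lemma map_discriminant : discriminant EL = f (discriminant E).
Proof.
rewrite /discriminant map_b2 map_b4 map_b6 map_b8.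
by rewrite !(rmorph_nat, rmorphXn, rmorphM, rmorphN, rmorphB, rmorphD).
Qed.

Lemma map_psi2_sq : psi2_sq EL = map_poly f (psi2_sq E).
Proof.
rewrite /psi2_sq map_b2 map_b4 map_b6; move: (b2 E) (b4 E) (b6 E) => B2 B4 B6.
rewrite !rmorphD /= !map_polyZ /= !map_polyXn map_polyX.
by rewrite !map_polyC /= !(rmorph_nat, rmorphM).
Qed.
Lemma map_psi3 : psi3 EL = map_poly f (psi3 E).
Proof.
rewrite /psi3 map_b2 map_b4 map_b6 map_b8.
move: (b2 E) (b4 E) (b6 E) (b8 E) => B2 B4 B6 B8;
  rewrite !rmorphD /= !map_polyZ /= !map_polyXn map_polyX.
by rewrite !map_polyC /= !(rmorph_nat, rmorphM).
Qed.
Lemma map_psi4_red : psi4_red EL = map_poly f (psi4_red E).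
Proof.
rewrite /psi4_red map_b2 map_b4 map_b6 map_b8.
move: (b2 E) (b4 E) (b6 E) (b8 E) => B2 B4 B6 B8.
have -> : f B4 * f B8 - f B6 ^+ 2 = f (B4 * B8 - B6 ^+ 2).
  by rewrite rmorphB rmorphM rmorphXn.
have -> : f B2 * f B8 - f B4 * f B6 = f (B2 * B8 - B4 * B6).
  by rewrite rmorphB !rmorphM.
move: (B2 * B8 - B4 * B6) (B4 * B8 - B6 ^+ 2) => c d.
rewrite !rmorphD /= !map_polyZ /= !map_polyXn map_polyX.
by rewrite !map_polyC /= !(rmorph_nat, rmorphM).
Qed.

Lemma map_psi_red n : psi_red EL n = map_poly f (psi_red E n).
Proof.
elim/ltn_ind: n => n IH; have [n5|n5] := ltnP 4 n; last first.
  case: n n5 {IH} => [|[|[|[|[|n]]]]] // _; rewrite /psi_red /= ?rmorph0 ?rmorph1 //.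
    exact: map_psi3.
  exact: map_psi4_red.
rewrite !psi_red_step // /= map_psi2_sq.
have := odd_double_half n; case: (odd n) => en; rewrite !IH; try lia.
  by case: (odd n./2); rewrite !(rmorphXn, rmorphM, rmorphB, rmorph1) /=.
by rewrite !(rmorphXn, rmorphM, rmorphB).
Qed.

Lemma map_prim_psi n : (0 < n)%N -> prim_psi EL n = map_poly f (prim_psi E n).
Proof.
elim/ltn_ind: n => n IH n0; rewrite !prim_psiE // map_divp map_psi_red rmorph_prod.
congr (_ %/ _); rewrite big_seq_cond [RHS]big_seq_cond; apply: eq_bigr => d /and3P[dn _ lt].
by apply: IH => //; move: dn; rewrite -dvdn_divisors // => /dvdn_gt0; apply.
Qed.
End BaseChangePolynomials.

Section GaloisAction.
Variables (K : fieldType) (L : closedFieldType) (iota : {rmorphism K -> L}).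
Variables (E : weierstrass K).
Local Notation EL := (map_weierstrass iota E).
Variable smoothE : smooth EL.
Local Notation pt := (curve_point smoothE).
Implicit Types (P Q : pt) (s t : abs_gal iota).

Lemma map_curve_gal s : map_weierstrass s EL = EL.
Proof. by rewrite /map_weierstrass /= !gal_fix. Qed.

Lemma on_curve_gal s (P : ecpoint L) : on_curve EL P -> on_curve EL (map_point s P).
Proof.
case: P => [[x y]|] //= /eqP e; rewrite -{1}(map_curve_gal s) /weq /=.
by rewrite -!(rmorphXn, rmorphM, rmorphD, rmorphB) /= -/(weq EL x y) e rmorph0.
Qed.

Definition gal_pt s P : pt := exist _ (map_point s (pv P)) (on_curve_gal s (pv_curve P)).

Lemma pv_gal s P : pv (gal_pt s P) = map_point s (pv P). Proof. by []. Qed.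

Lemma gal_ptD s P Q : gal_pt s (P + Q) = gal_pt s P + gal_pt s Q.
Proof.
apply: pv_inj; rewrite pv_gal pv_ptD map_add_point map_curve_gal.
by rewrite [RHS]pv_ptD.
Qed.

Lemma gal_pt_inj s : injective (gal_pt s).
Proof.
move=> P Q /(congr1 (fun R : pt => pv R)); rewrite !pv_gal => e; apply: pv_inj; move: e.
case: (pv P) (pv Q) => [[x y]|] [[x' y']|] //= [ex ey].
by rewrite (fmorph_inj s ex) (fmorph_inj s ey).
Qed.

Lemma gal_pt0 s : gal_pt s 0 = 0. Proof. exact: pv_inj. Qed.

Lemma gal_pt_eq0 s P : (gal_pt s P == 0) = (P == 0).
Proof. by rewrite -[RHS](inj_eq (@gal_pt_inj s)) gal_pt0. Qed.

Lemma gal_ptN s P : gal_pt s (- P) = - gal_pt s P.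
Proof. by apply/eqP; rewrite -addr_eq0 -gal_ptD addNr gal_pt0. Qed.

Lemma gal_pt_mulrn s P n : gal_pt s (P *+ n) = gal_pt s P *+ n.
Proof. by elim: n => [|n IH]; rewrite ?mulr0n ?gal_pt0 // !mulrS gal_ptD IH. Qed.

Lemma px_gal s P : P != 0 -> px (gal_pt s P) = s (px P).
Proof. by rewrite /px pv_gal => /pt_affine[-> _]. Qed.

Lemma py_gal s P : P != 0 -> py (gal_pt s P) = s (py P).
Proof. by rewrite /py pv_gal => /pt_affine[-> _]. Qed.

Lemma exact_ord_gal s n P : exact_ord n (gal_pt s P) = exact_ord n P.
Proof.
rewrite /exact_ord -gal_pt_mulrn gal_pt_eq0; congr (_ && _).
by apply: eq_all => m; rewrite -gal_pt_mulrn gal_pt_eq0.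
Qed.

Lemma exact_orderP n (Q : ecpoint L) : (0 < n)%N ->
  exact_order EL n Q <-> exists P, pv P = Q /\ exact_ord n P.
Proof.
move=> n0; split=> [[/andP[cQ /eqP nQ] h]|[P [<- /exact_ordP[nP h]]]].
  exists (exist _ Q cQ); split=> //; apply/exact_ordP; split.
    by apply: pv_inj; rewrite pv_mulrn.
  move=> m mn; apply/eqP => e; apply: (h m mn).
  by have := congr1 (fun R : pt => pv R) e; rewrite pv_mulrn.
split; first by rewrite /in_torsion pv_curve -pv_mulrn nP.
by move=> m mn e; move/eqP: (h m mn); apply; apply: pv_inj; rewrite pv_mulrn.
Qed.

Lemma torsion_pt n (Q : torsion EL n) : exists P, pv P = val Q /\ P *+ n = 0.
Proof.
case: Q => Q /= /andP[cQ /eqP nQ]; exists (exist _ Q cQ); split=> //.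
by apply: pv_inj; rewrite pv_mulrn.
Qed.

Lemma pt_torsion n P : P *+ n = 0 -> exists Q : torsion EL n, val Q = pv P.
Proof.
move=> nP; have tP : in_torsion EL n (pv P) by rewrite /in_torsion pv_curve -pv_mulrn nP.
by exists (exist _ (pv P) tP).
Qed.

Lemma rho_eqP n s t : rho (E := E) (n := n) s = rho t <-> (forall P, P *+ n = 0 -> gal_pt s P =
  gal_pt t P).
Proof.
split=> [e P /pt_torsion[Q eQ]|h].
  apply: pv_inj; rewrite !pv_gal -eQ.
  by have := congr1 (fun r => val (r Q)) e.
apply/funext => Q; apply: val_inj => /=; have [P [eP nP]] := torsion_pt Q.
by rewrite -eP -!pv_gal (h _ nP).
Qed.

Lemma rho_oppP n s t : rho (E := E) (n := n) s = @opp_torsion L EL n \o rho t <->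
  (forall P, P *+ n = 0 -> gal_pt s P = - gal_pt t P).
Proof.
split=> [e P /pt_torsion[Q eQ]|h].
  apply: pv_inj; rewrite pv_ptN !pv_gal -eQ.
  by have := congr1 (fun r => val (r Q)) e.
apply/funext => Q; apply: val_inj => /=; have [P [eP nP]] := torsion_pt Q.
by rewrite -eP -!pv_gal (h _ nP) pv_ptN.
Qed.

Lemma opp_torsionK n : involutive (@opp_torsion L EL n).
Proof.
move=> Q; apply: val_inj => /=; case: (val Q) => [[x y]|] //=.
by congr (Some (_, _)); ring.
Qed.

Lemma rho_comp n s t (u : abs_gal iota) : (forall x, u x = t (s x)) ->
  rho (n := n) (E := E) u = comp_op (rho s) (rho t).
Proof.
move=> e; apply/funext => Q; apply: val_inj => /=.
by case: (val Q) => [[x y]|] //=; rewrite !e.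
Qed.

Lemma rho_opp n s (Q : torsion EL n) : rho s (opp_torsion Q) = opp_torsion (rho s Q).
Proof.
apply: val_inj => /=; case: (val Q) => [[x y]|] //=; congr (Some (_, _)).
by rewrite !(rmorphB, rmorphN, rmorphM) !gal_fix.
Qed.

Lemma rho_bar_comp n s t (u : abs_gal iota) : (forall x, u x = t (s x)) ->
  @rho_bar K L iota E n u = coset_op (@rho_bar K L iota E n s) (@rho_bar K L iota E n t).
Proof.
move=> e; have eu := rho_comp n e; apply/seteqP; split=> [f|f].
  case=> ->.
    by exists (rho s); [left|exists (rho t); [left|rewrite eu]].
  by exists (rho s); [left|exists (@opp_torsion L EL n \o rho t); [right|rewrite eu]].
case=> _ [->|->] [_ [->|->] <-]; rewrite /comp_op.
- by left; rewrite eu.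
- by right; rewrite eu.
- by right; rewrite eu; apply/funext => Q; rewrite /comp_op /= rho_opp.
- by left; rewrite eu; apply/funext => Q; rewrite /comp_op /= rho_opp opp_torsionK.
Qed.

Lemma rho_bar_eqP n s t : @rho_bar K L iota E n s = @rho_bar K L iota E n t <->
  (forall P, P *+ n = 0 -> gal_pt s P = gal_pt t P) \/
  (forall P, P *+ n = 0 -> gal_pt s P = - gal_pt t P).
Proof.
rewrite -rho_eqP -rho_oppP; split=> [e|[e|e]].
- have : @rho_bar K L iota E n s (rho s) by left.
  by rewrite e => -[h|h]; [left|right].
- by rewrite /rho_bar e.
rewrite /rho_bar e setUC; congr (_ `|` _)%classic; congr [set _]%classic.
by apply/funext => Q /=; rewrite opp_torsionK.
Qed.
End GaloisAction.

(** A nonconstant divisor has a root in [s], hence by conjugation all of [s] as roots. *)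
Lemma irreducible_of_orbit (K : fieldType) (L : closedFieldType) (iota : {rmorphism K -> L})
    (f : {poly K}) s :
  simple_split (map_poly iota f) s -> gal_orbit iota s -> s != [::] -> irreducible_poly f.
Proof.
move=> hs orb s0; have sf : size f = (size s).+1.
  by rewrite -(simple_split_size hs) size_map_poly.
have f0 : f != 0 by rewrite -size_poly_eq0 sf.
split=> [|q q1 qf]; first by rewrite sf ltnS lt0n size_eq0.
have q0 : q != 0 by apply: contraTneq qf => ->; rewrite dvd0p.
have [z qz] := closed_rootP (map_poly iota q) ltac:(by rewrite size_map_poly).
have fz : z \in s.
  rewrite -(simple_split_root _ hs).
  by have := qf; rewrite -(dvdp_map iota) => /dvdpP[d ->]; rewrite rootM qz orbT.
rewrite -dvdp_size_eqp // eqn_leq dvdp_leq //= sf.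
have [_ us _] := hs; rewrite -(size_map_poly iota q); apply: max_poly_roots => //.
  by rewrite map_poly_eq0.
by apply/allP => y ys; have [t <-] := orb _ _ fz ys; rewrite abs_gal_root.
Qed.

Section TransitiveTorsion.
Variables (K : fieldType) (L : closedFieldType) (iota : {rmorphism K -> L}).
Hypotheses (alg : integralRange iota) (char0 : [pchar L] =i pred0).
Variable E : weierstrass K.
Local Notation EL := (map_weierstrass iota E).
Variable smoothE : smooth EL.
Local Notation pt := (curve_point smoothE).
Implicit Types (P Q : pt) (s t : abs_gal iota).

Lemma tors_enum_exists : exists tors : nat -> seq pt, forall n, (0 < n)%N ->
  [/\ uniq (tors n), size (tors n) = (n ^ 2)%N & forall P, (P \in tors n) = (P *+ n == 0)].
Proof.
have ex n : exists s : seq pt, (0 < n)%N ->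
    [/\ uniq s, size s = (n ^ 2)%N & forall P, (P \in s) = (P *+ n == 0)].
  case: n => [|n]; first by exists [::].
  by have [s hs] := torsion_enum smoothE char0 (ltn0Sn n); exists s.
by have [g gP] := choice ex; exists g.
Qed.

Variable tors : nat -> seq pt.
Hypothesis torsP : forall n, (0 < n)%N ->
  [/\ uniq (tors n), size (tors n) = (n ^ 2)%N & forall P, (P \in tors n) = (P *+ n == 0)].

Lemma exact_ord_neq0 m P : (1 < m)%N -> exact_ord m P -> P != 0.
Proof. by move=> m1 /exact_ordP[_ /(_ 1%N)]; rewrite mulr1n; apply. Qed.

Lemma gal_inv s : exists t, (forall P, gal_pt t (gal_pt s P) = P) /\
  (forall P, gal_pt s (gal_pt t P) = P).
Proof.
have [t ht] := abs_gal_extend alg (gal_fix s) (fun c => erefl : idfun (iota c) = iota c).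
have st P : gal_pt t (gal_pt s P) = P.
  apply: pv_inj; rewrite !pv_gal; case: (pv P) => [[x y]|] //=.
  by congr (Some (_, _)); apply: ht.
by exists t; split=> // P; apply: (@gal_pt_inj _ _ _ _ _ t); rewrite st.
Qed.

Variable n : nat.
Hypothesis n1 : (1 < n)%N.
Hypothesis trans : forall P Q, exact_ord n P -> exact_ord n Q -> exists s, gal_pt s P = Q.

Let n0 : (0 < n)%N. Proof. by lia. Qed.

Lemma trans_dvd m P Q : (m %| n)%N -> exact_ord m P -> exact_ord m Q ->
  exists s, gal_pt s P = Q.
Proof.
move=> mn eP eQ; have m0 : (0 < m)%N by apply: dvdn_gt0 mn.
have [k ek] := dvdnP mn; have k0 : (0 < k)%N by move: n0; rewrite ek; case: (k).
have [P' eP' <-] := exact_ord_lift torsP m0 k0 eP.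
have [Q' eQ' <-] := exact_ord_lift torsP m0 k0 eQ.
rewrite mulnC -ek in eP' eQ'; have [s es] := trans eP' eQ'.
by exists s; rewrite gal_pt_mulrn es.
Qed.

Lemma exact_ord_nonempty : exists P : pt, exact_ord n P.
Proof.
by have [e1 [e2 ind]] := indep_exists torsP n0; have [h _ _] := indep_exact_ord n0 ind; exists e1.
Qed.

Definition abscissa_poly m : {poly K} := if m == 2%N then psi2_sq E else prim_psi E m.

Lemma abscissas m : (1 < m)%N -> (m %| n)%N -> exists s : seq L,
  [/\ simple_split (map_poly iota (abscissa_poly m)) s,
      forall z, z \in s <-> exists P, P != 0 /\ exact_ord m P /\ px P = z,
      gal_stable iota s, gal_orbit iota s & \sum_(z <- s) (12%:R * z + iota (b2 E)) = 0].
Proof.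
move=> m1 mn; have m0 : (0 < m)%N by lia.
have [s [hs [sE bal]]] : exists s : seq L, simple_split (map_poly iota (abscissa_poly m)) s /\
    (forall z, z \in s <-> exists P, P != 0 /\ exact_ord m P /\ px P = z)
    /\ balanced (b2 EL) s.
  rewrite /abscissa_poly; have [->|m2] := eqVneq m 2.
    rewrite -map_psi2_sq; exact: (psi2_sq_split char0 torsP).
  rewrite -map_prim_psi //; exact: (prim_psi_split char0 torsP).
exists s; split=> //.
- move=> t _ /sE[P [P0 [eP <-]]]; apply/sE; exists (gal_pt t P).
  by rewrite gal_pt_eq0 exact_ord_gal px_gal.
- move=> _ _ /sE[P [P0 [eP <-]]] /sE[Q [Q0 [eQ <-]]].
  by have [t <-] := trans_dvd mn eP eQ; exists t; rewrite px_gal.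
by rewrite -map_b2.
Qed.

Lemma abscissa_poly_irreducible : irreducible_poly (abscissa_poly n).
Proof.
have [s [hs sE _ orb _]] := abscissas n1 (dvdnn n); apply: irreducible_of_orbit hs orb _.
have [P eP] := exact_ord_nonempty.
have : px P \in s by apply/sE; exists P; rewrite (exact_ord_neq0 n1 eP).
by case: (s).
Qed.

(** Automorphisms s and t that agree on abscissas agree up to sign at each point of order n;
    [sign_uniform], applied to s followed by the inverse of t, makes the sign the same on all of
    E[n]. *)
Lemma abscissa_poly_galois : galois_group_isog (abscissa_poly n)
  (@coset_op (torsion EL n)) (range (@rho_bar K L iota E n))%classic.
Proof.
have [r [hr rE _ _ _]] := abscissas n1 (dvdnn n).
apply: (galois_isog alg).
- exact: (irredp_neq0 abscissa_poly_irreducible).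
- by move=> s t u e; apply: rho_bar_comp.
move=> s t; rewrite (rho_bar_eqP smoothE); split=> [h x|h].
  rewrite (simple_split_root _ hr) => /rE[P [P0 [eP <-]]].
  have nP : P *+ n = 0 by case/exact_ordP: eP.
  rewrite -!(px_gal (smoothE := smoothE)) //.
  by case: h => /(_ _ nP) ->; rewrite ?px_opp.
have [u [ut tu]] := gal_inv t.
have lin P Q : gal_pt u (gal_pt s (P + Q)) = gal_pt u (gal_pt s P) + gal_pt u (gal_pt s Q).
  by rewrite !gal_ptD.
have [||g|g] := @sign_uniform _ _ torsP n (fun P => gal_pt u (gal_pt s P)) n0.
- by move=> P Q _ _; apply: lin.
- move=> P eP; have P0 := exact_ord_neq0 n1 eP.
  have e : px (gal_pt s P) = px (gal_pt t P).
    rewrite !px_gal //; apply: h; rewrite (simple_split_root _ hr).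
    by apply/rE; exists P.
  have [] := px_eq _ _ e; rewrite ?gal_pt_eq0 // => ->; first by left.
  by right; rewrite gal_ptN ut.
- by left=> P /g e; rewrite -[LHS]tu e.
by right=> P /g e; rewrite -[LHS]tu e gal_ptN.
Qed.
End TransitiveTorsion.

Lemma rmorph_eval_xy (K : nzRingType) (R S : nzRingType) (phi : {rmorphism R -> S}) (g : K -> R)
    (G : {poly {poly K}}) x y : phi (eval_xy g G x y) = eval_xy (phi \o g) G (phi x) (phi y).
Proof.
rewrite /eval_xy -horner_map -(horner_map (map_poly phi)) /= map_polyC /=; congr (_.[_].[_]).
rewrite -(@map_poly_comp_id0 _ _ _ (map_poly phi) (map_poly g)) ?rmorph0 //.
by apply: eq_map_poly => p /=; rewrite -(@map_poly_comp_id0 _ _ _ phi g) ?rmorph0.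
Qed.

(** * Evaluation of the coordinate ring at points *)

Section CoordinateRingPoints.
Variables (K : fieldType) (L : fieldType) (iota : {rmorphism K -> L}).
Variable E : weierstrass K.
Local Notation EL := (map_weierstrass iota E).

Lemma eval_xy_degree_one (be al ga : K) x y :
  eval_xy iota (be%:P *: 'X + (al *: 'X + ga%:P)%:P) x y
  = iota be * y + iota al * x + iota ga.
Proof.
rewrite /eval_xy rmorphD /= map_polyZ /= map_polyX !map_polyC /= rmorphD /= map_polyZ /= map_polyX.
by rewrite !map_polyC /= !hornerE. 
Qed.

Lemma inv_pullback_degree_one (be al ga : K) :
  inv_pullback E (be%:P *: 'X + (al *: 'X + ga%:P)%:P)
  = (- be)%:P *: 'X + ((al - be * a1 E) *: 'X + (ga - be * a3 E)%:P)%:P.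
Proof.
rewrite /inv_pullback comp_polyD comp_polyZ comp_polyX comp_polyC.
rewrite -!mul_polyC !(rmorphN, rmorphB, rmorphM, rmorphD) /=; ring.
Qed.

Section Evaluation.
Variables (x y : L).
Hypothesis exy : weq EL x y = 0.

Definition plane_eval : {rmorphism {poly {poly K}} -> L} :=
  (horner_eval x \o horner_eval y%:P \o map_poly (map_poly iota))%FUN.

Lemma plane_evalE p : plane_eval p = eval_xy iota p x y. Proof. by []. Qed.

Lemma plane_eval_weq : plane_eval (weq_poly E) = 0.
Proof.
rewrite -exy plane_evalE /eval_xy /weq_poly /weq /=.
rewrite !(rmorphB, rmorphD) /= !map_polyZ /= !map_polyXn !map_polyX !map_polyC /=.
rewrite !(rmorphB, rmorphD) /= !map_polyZ /= !map_polyXn !map_polyX !map_polyC /=.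
rewrite !hornerE; ring.
Qed.

Definition coord_eval (q : coord_ring E) : L := plane_eval (val q).

Lemma coord_eval_in p : coord_eval (in_qpoly (weq_poly E) p) = plane_eval p.
Proof.
have mw : weq_poly E \is monic by rewrite -mk_monic_weq_poly monic_mk_monic.
rewrite [in RHS](Pdiv.RingMonic.rdivp_eq mw p) rmorphD rmorphM plane_eval_weq mulr0 add0r.
by rewrite /coord_eval /= mk_monic_weq_poly.
Qed.

Lemma coord_eval_morphism : exists phi : {rmorphism coord_ring E -> L}, phi =1 coord_eval.
Proof.
have zm : zmod_morphism coord_eval.
  by move=> p q; rewrite /coord_eval -rmorphB.
have mm : monoid_morphism coord_eval.
  split; first exact: (rmorph1 plane_eval).
  move=> p q; rewrite -[RHS]rmorphM; apply: (coord_eval_in (val p * val q)).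
pose phi : {rmorphism coord_ring E -> L} :=
  HB.pack coord_eval (GRing.isZmodMorphism.Build _ _ _ zm) (GRing.isMonoidMorphism.Build _ _ _ mm).
by exists phi.
Qed.
End Evaluation.

(** Evaluation at a point is a ring morphism, determined by its values on the two generators, and x
    and y are polynomials in these. *)
Lemma generators_separate (u : {poly {poly K}}) x y x' y' : generates_coord_ring E u ->
  weq EL x y = 0 -> weq EL x' y' = 0 ->
  eval_xy iota u x y = eval_xy iota u x' y' ->
  eval_xy iota (inv_pullback E u) x y = eval_xy iota (inv_pullback E u) x' y' ->
  x = x' /\ y = y'.
Proof.
move=> gen e e' eu ev.
have [phi phiE] := coord_eval_morphism e; have [phi' phiE'] := coord_eval_morphism e'.
have same p : eval_xy iota p x y = eval_xy iota p x' y'.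
  have [G eG] := gen (in_qpoly (weq_poly E) p).
  have := congr1 phi eG; have := congr1 phi' eG.
  rewrite !rmorph_eval_xy !phiE !phiE' !coord_eval_in // !plane_evalE -eu -ev => -> ->.
  congr (_.[_].[_]); apply: eq_map_poly => q; apply: eq_map_poly => c /=.
  rewrite phiE phiE' !coord_eval_in // !plane_evalE /eval_xy.
  by rewrite !map_polyC /= !hornerC !map_polyC /= !hornerC.
by split; [have := same 'X%:P|have := same 'X];
  rewrite /eval_xy ?map_polyC /= !map_polyX ?hornerC !hornerX ?hornerC.
Qed.
End CoordinateRingPoints.

(** * The values of u *)

Section SeparatingFunction.
Variables (K : fieldType) (L : closedFieldType) (iota : {rmorphism K -> L}).
Hypotheses (alg : integralRange iota) (char0 : [pchar L] =i pred0).
Variable E : weierstrass K.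
Local Notation EL := (map_weierstrass iota E).
Variable smoothE : smooth EL.
Local Notation pt := (curve_point smoothE).
Variable tors : nat -> seq pt.
Hypothesis torsP : forall n, (0 < n)%N ->
  [/\ uniq (tors n), size (tors n) = (n ^ 2)%N & forall P, (P \in tors n) = (P *+ n == 0)].
Variables (be al ga : K).
Hypothesis gen : generates_coord_ring E (be%:P *: 'X + (al *: 'X + ga%:P)%:P).
Implicit Types (P Q : pt) (s t : abs_gal iota).

Definition upt P : L := iota be * py P + iota al * px P + iota ga.

Lemma py_opp P : P != 0 -> py (- P) = - py P - a1 EL * px P - a3 EL.
Proof. by move=> P0; have [eP _] := pt_affine P0; rewrite /py pv_ptN eP. Qed.

Lemma upt_gal s P : P != 0 -> upt (gal_pt s P) = s (upt P).
Proof.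
by move=> P0; rewrite /upt px_gal // py_gal // !rmorphD !rmorphM !gal_fix.
Qed.

Lemma upt_separates P Q : P != 0 -> Q != 0 -> upt P = upt Q -> upt (- P) = upt (- Q) -> P = Q.
Proof.
move=> P0 Q0 eu; rewrite /upt !px_opp !py_opp //= => ev.
have [eP cP] := pt_affine P0; have [eQ cQ] := pt_affine Q0.
have [||] := generators_separate gen cP cQ.
- by rewrite !eval_xy_degree_one.
- have inv x y : eval_xy iota (inv_pullback E (be%:P *: 'X + (al *: 'X + ga%:P)%:P)) x y
      = iota be * (- y - iota (a1 E) * x - iota (a3 E)) + iota al * x + iota ga.
    rewrite inv_pullback_degree_one eval_xy_degree_one !(rmorphN, rmorphM, rmorphB); ring.
  by rewrite !inv.
by move=> ex ey; apply: pv_inj; rewrite eP eQ ex ey.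
Qed.

(** Without y, the function u would take the same value at P and - P, for P of order 3. *)
Lemma y_coef_neq0 : be != 0.
Proof.
apply/eqP => b0; have [P [_ /(indep_exact_ord (isT : 0 < 3)%N)[eP _ _]]] := indep_exists torsP
  (isT : 0 < 3)%N.
have P0 := exact_ord_neq0 (isT : 1 < 3)%N eP.
have e : P = - P.
  by apply: upt_separates; rewrite ?oppr_eq0 // /upt b0 rmorph0 !mul0r !px_opp.
have : P *+ 2 == 0 by rewrite mulr2n {1}e addNr.
by rewrite (exact_ord_dvd _ (isT : 0 < 3)%N eP).
Qed.

(** In [2 u = be * psi_2 + (2 al - be a1) x + (2 ga - be a3)] the first term vanishes at points of
    order 2, which are their own opposites: without the middle term, u and its pull-back would be
    constant there. *)
Lemma not_half_slope : 2%:R * al != be * a1 E.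
Proof.
apply/eqP => e; have [P [Q ind]] := indep_exists torsP (isT : 0 < 2)%N.
have [eP eQ _] := indep_exact_ord (isT : 0 < 2)%N ind.
have two := char0_neq0 char0 (isT : 0 < 2)%N.
have cst (R : pt) : exact_ord 2 R -> - R = R /\ 2%:R * upt R = iota (2%:R * ga - be * a3 E).
  move=> eR; have R0 := exact_ord_neq0 (isT : 1 < 2)%N eR.
  have /exact_ordP[R2 _] := eR; split.
    by apply/eqP; rewrite eq_sym -addr_eq0 -mulr2n R2.
  have /eqP w0 : pw R == 0 by rewrite pw_eq0 ?R2.
  have e' := congr1 iota e; rewrite !rmorphM rmorph_nat in e'.
  rewrite rmorphB !rmorphM rmorph_nat.
  apply: (eq_of_sub (d := iota be * pw R + (2%:R * iota al - iota be * iota (a1 E)) * px R)).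
    by rewrite w0 e' subrr mul0r mulr0 addr0.
  by rewrite /upt /pw /=; ring.
have [oP cP] := cst _ eP; have [oQ cQ] := cst _ eQ.
have eu : upt P = upt Q by apply: (mulfI two); rewrite cP cQ.
have ePQ : P = Q.
  by apply: upt_separates; rewrite ?oP ?oQ //; apply: (exact_ord_neq0 (isT : 1 < 2)%N).
by have := ind 1%N 1%N; rewrite !mulr1n ePQ -mulr2n; case/exact_ordP: eQ => -> _; rewrite eqxx.
Qed.

Variable n : nat.
Hypothesis n1 : (1 < n)%N.
Hypothesis trans : forall P Q, exact_ord n P -> exact_ord n Q -> exists s, gal_pt s P = Q.

(* If u(P) = u(Q), the chord through P and Q has the slope -al/be, which is in
   K, and so does x(P) + x(Q) + x(P + Q); but the mean of 12 x + b2 over the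
   points of a given order is 0, so this sum is - b2 / 4. *)
Lemma upt_inj P Q : exact_ord n P -> exact_ord n Q -> upt P = upt Q -> P = Q.
Proof.
move=> eP eQ eu; apply/eqP/negPn/negP => nPQ.
have P0 := exact_ord_neq0 n1 eP; have Q0 := exact_ord_neq0 n1 eQ.
have [vP cP] := pt_affine P0; have [vQ cQ] := pt_affine Q0.
have b0 := y_coef_neq0; have ib0 : iota be != 0 by rewrite fmorph_eq0.
(* Equal abscissas would give equal ordinates, [be] being nonzero. In particular Q is not - P, so P
   + Q is affine. *)
have nx : px P != px Q.
  apply: contraNneq nPQ => ex; apply/eqP/pv_inj; rewrite vP vQ ex; congr (Some (_, _)).
  by apply: (mulfI ib0); move: eu; rewrite /upt ex => /addIr/addIr.
have nd : px Q - px P != 0 by rewrite subr_eq0 eq_sym.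
have [R0 _ _ _] := px_addB P0 Q0 nx.
pose l := - al / be; pose c := l ^+ 2 + a1 E * l - a2 E.
have ec : px P + px Q + px (P + Q) = iota c.
  rewrite {3}/px pv_ptD vP vQ /= (negPf nx) /=.
  have -> : (py Q - py P) / (px Q - px P) = iota l.
    apply: (mulIf nd); rewrite divfK // rmorphM rmorphN fmorphV.
    apply: (mulfI ib0); move/eqP: eu; rewrite -subr_eq0 => /eqP e0.
    by apply: (eq_of_sub (d := - (upt P - upt Q))); [rewrite e0 oppr0|rewrite /upt; field].
  by rewrite /c !(rmorphXn, rmorphM, rmorphB, rmorphD); ring.
have [nP _] := exact_ordP _ _ eP; have [nQ _] := exact_ordP _ _ eQ.
have nR : (P + Q) *+ n = 0 by rewrite mulrnDl nP nQ addr0.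
(* P + Q need not have order n, only some order m > 1 dividing n; this is where the action on E_m
   comes in. *)
have [m [m0 mn eR]] := exact_ord_exists (ltnW n1) nR.
have m1 : (1 < m)%N.
  rewrite ltn_neqAle m0 andbT; apply: contraNneq R0 => e1.
  by case/exact_ordP: eR; rewrite -e1 mulr1n => ->.
have [s [hs sE sts os bs]] := abscissas char0 torsP n1 trans n1 (dvdnn n).
have [r [hr rE str or br]] := abscissas char0 torsP n1 trans m1 mn.
have [us [_ ur _]] : uniq s /\ simple_split (map_poly iota (abscissa_poly E m)) r by case: hs.
have sP : px P \in s by apply/sE; exists P.
have sQ : px Q \in s by apply/sE; exists Q.
have rR : px (P + Q) \in r by apply/rE; exists (P + Q).
have av : 12%:R * c + 3%:R * b2 E = 0.
  by apply: (@galois_average _ _ _ alg char0 _ _ _ s s r) ec; split.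
have /eqP : 3%:R * (2%:R * l + a1 E) ^+ 2 = 0 by rewrite -av /c /b2; ring.
have three : 3%:R != 0 :> K.
  by rewrite -(fmorph_eq0 iota) rmorph_nat; apply: (char0_neq0 char0).
rewrite mulf_eq0 (negPf three) expf_eq0 /= => /eqP e.
move: not_half_slope => /eqP; apply; apply: (eq_of_sub (d := - be * (2%:R * l + a1 E))).
  by rewrite e mulr0.
by rewrite /l; field.
Qed.
End SeparatingFunction.

(** * The characteristic polynomial of a multiplication *)

Section MultiplicationPolynomial.
Variables (K : fieldType) (F : fieldExtType K).
Implicit Types z : F.

Lemma char_poly_tr (R : comNzRingType) m (A : 'M[R]_m) : char_poly A^T = char_poly A.
Proof.
rewrite /char_poly -[RHS]det_tr; congr (\det _).
by rewrite /char_poly_mx linearB /= tr_scalar_mx map_trmx.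
Qed.

(* The vector of the elements of the basis is an eigenvector, for the eigenvalue
   z, of the matrix of the multiplication by z. *)
Lemma root_mul_charpoly z : root (map_poly (in_alg F) (mul_charpoly z)) z.
Proof.
rewrite /mul_charpoly map_char_poly -char_poly_tr -eigenvalue_root_char.
pose e := vbasis {:F}; apply/eigenvalueP; exists (\row_i e`_i).
  rewrite -[X in X *m _]trmxK -trmx_mul -[RHS]trmxK; congr trmx.
  apply/matrixP => i k; rewrite !mxE /=.
  have -> : z * e`_i = amull z e`_i by rewrite lfunE.
  rewrite (coord_vbasis (memvf (amull z e`_i))); apply: eq_bigr => l _.
  rewrite !mxE /= -/e passmx.vecof_delta.
  by rewrite mulr_algl.
have dF : (0 < \dim {:F})%N by rewrite adim_gt0.
apply/eqP => /rowP /(_ (Ordinal dF)); rewrite !mxE => /eqP.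
apply/negP; have /andP[_ fr] := vbasisP {:F}.
by apply: (free_not0 fr); apply: mem_nth; rewrite size_tuple.
Qed.

(** The minimal polynomial divides the characteristic one, and both have degree the dimension of F
    when z generates F. *)
Lemma mul_charpoly_minPoly z : <<1; z>>%VS = {:F}%VS ->
  map_poly (in_alg F) (mul_charpoly z) = minPoly 1 z.
Proof.
move=> gz; apply/eqP; rewrite -eqp_monic ?monic_minPoly ?map_monic ?char_poly_monic //.
rewrite eqp_sym -dvdp_size_eqp; last first.
  apply: minPoly_dvdp; last exact: root_mul_charpoly.
  by apply/polyOver1P; exists (mul_charpoly z).
rewrite size_map_poly size_char_poly size_minPoly eqSS.
by have := dim_Fadjoin 1%AS z; rewrite gz dimv1 muln1 => ->.
Qed.

Lemma mul_charpoly_irreducible z : <<1; z>>%VS = {:F}%VS -> irreducible_poly (mul_charpoly z).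
Proof.
move=> gz; split=> [|q q1 qchi].
  by rewrite size_char_poly ltnS adim_gt0.
have : map_poly (in_alg F) q %| minPoly 1 z.
  by rewrite -mul_charpoly_minPoly // dvdp_map.
move=> /minPoly_irr; case/(_ _)/orP; first by apply/polyOver1P; exists q.
  by rewrite -mul_charpoly_minPoly // eqp_map.
by rewrite -size_poly_eq1 size_map_poly (negPf q1).
Qed.
End MultiplicationPolynomial.

Section PointField.
Variables (K : fieldType) (L : closedFieldType) (iota : {rmorphism K -> L}).
Hypotheses (alg : integralRange iota) (char0 : [pchar L] =i pred0).
Variable E : weierstrass K.
Local Notation EL := (map_weierstrass iota E).
Variable smoothE : smooth EL.
Local Notation pt := (curve_point smoothE).
Variable tors : nat -> seq pt.
Hypothesis torsP : forall n, (0 < n)%N ->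
  [/\ uniq (tors n), size (tors n) = (n ^ 2)%N & forall P, (P \in tors n) = (P *+ n == 0)].
Variables (be al ga : K).
Local Notation u := (be%:P *: 'X + (al *: 'X + ga%:P)%:P).
Hypothesis gen : generates_coord_ring E u.
Implicit Types (P Q : pt) (s t : abs_gal iota).
Local Notation upt := (upt be al ga).
Variable n : nat.
Hypothesis n1 : (1 < n)%N.
Hypothesis trans : forall P Q, exact_ord n P -> exact_ord n Q -> exists s, gal_pt s P = Q.
Let n0 : (0 < n)%N := ltnW n1.

Variables (F : fieldExtType K) (j : {rmorphism F -> L}) (a b : F) (P : pt).
Hypotheses (jE : forall c : K, j c%:A = iota c) (eP : exact_ord n P)
  (vP : pv P = Some (j a, j b)) (genF : <<<<1; a>>; b>>%VS = {:F}%VS).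
Let P0 : P != 0 := exact_ord_neq0 n1 eP.
Let z := eval_xy (in_alg F) u a b.

Lemma value_image : j z = upt P.
Proof.
by rewrite /z eval_xy_degree_one /upt /px /py vP /= !rmorphD !rmorphM /= !jE.
Qed.

Lemma value_generates : <<1; z>>%VS = {:F}%VS.
Proof.
(* K(z) is made a field of its own, to serve as the base in [fixed_in_base]. *)
pose A := subvs_of <<1; z>>%AS.
pose i : {rmorphism A -> L} := (j \o vsval)%FUN.
have iE (c : K) : i (in_alg A c) = iota c.
  by rewrite -jE /= algid1.
have algi : integralRange i := integral_over_ext alg iE.
have charA : [pchar A] =i pred0 by move=> p; rewrite -(fmorph_pchar i) char0.
have fixP (s : {rmorphism L -> L}) : (forall c, s (i c) = i c) -> s (j a) = j a /\ s (j b) = j b.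
  move=> si; have sK c : s (iota c) = iota c by rewrite -iE si.
  have ez : s (j z) = j z.
    by have := si (Subvs (memv_adjoin 1%VS z)).
  have e : gal_pt (abs_gal_of alg sK) P = P.
    apply: (upt_inj alg char0 torsP gen n1 trans); rewrite ?exact_ord_gal //.
    by rewrite upt_gal // -value_image.
  by have := congr1 (fun Q : pt => pv Q) e; rewrite pv_gal vP => -[-> ->].
have mem (c : F) : (forall s : {rmorphism L -> L}, (forall c, s (i c) = i c) -> s (j c) = j c) ->
    c \in <<1; z>>%VS.
  move=> /(fixed_in_base algi charA)[x ex].
  by rewrite (fmorph_inj j ex) subvsP.
apply/eqP; rewrite eqEsubv subvf /= -genF.
apply/FadjoinP; split; last by apply: mem => s /fixP[].
apply/FadjoinP; split; last by apply: mem => s /fixP[].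
exact: sub1v.
Qed.

(** A root is the image of z by some embedding of F over K, which extends to an automorphism of L;
    its action on P gives Q. *)
Lemma value_charpoly_root x : root (map_poly iota (mul_charpoly z)) x <->
  exists Q, exact_ord n Q /\ upt Q = x.
Proof.
have rz : root (map_poly iota (mul_charpoly z)) (j z).
  by rewrite (root_conj (i := in_alg F)) ?root_mul_charpoly.
split=> [rx|[Q [eQ <-]]]; last first.
  by have [s <-] := trans eP eQ; rewrite upt_gal // -value_image abs_gal_root.
have [q qz|phi [phi_in phi_z]] := @extend_hom_conj K F L (in_alg F) iota (@in_alg_integral K F) z x.
  have : mul_charpoly z %| q.
    rewrite -(dvdp_map (in_alg F)) mul_charpoly_minPoly ?value_generates //.
    by apply: minPoly_dvdp; [apply/polyOver1P; exists q|apply/eqP].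
  by case/dvdpP => r ->; rewrite rmorphM hornerM (eqP rx) mulr0.
have [s sE] := abs_gal_extend alg (i := in_alg F) jE phi_in.
exists (gal_pt s P); rewrite exact_ord_gal; split=> //.
by rewrite upt_gal // -value_image sE.
Qed.

Lemma value_charpoly_galois : galois_group_isog (mul_charpoly z)
  (@comp_op (torsion EL n)) (range (@rho K L iota E n))%classic.
Proof.
apply: (galois_isog alg).
- exact: irredp_neq0 (mul_charpoly_irreducible value_generates).
- by move=> s t v e; apply: rho_comp.
move=> s t; rewrite (rho_eqP smoothE); split=> [h x|h].
  case/value_charpoly_root => Q [eQ <-]; have Q0 := exact_ord_neq0 n1 eQ.
  by rewrite -!(upt_gal (smoothE := smoothE)) // h //; case/exact_ordP: eQ.
(* Agreement at points of exact order n is enough, since such points form a basis of E[n]. *)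
have fixE Q : exact_ord n Q -> gal_pt s Q = gal_pt t Q.
  move=> eQ; apply: (upt_inj alg char0 torsP gen n1 trans); rewrite ?exact_ord_gal //.
  rewrite !upt_gal ?(exact_ord_neq0 n1 eQ) //; apply: h; apply/value_charpoly_root.
  by exists Q.
have [e1 [e2 ind]] := indep_exists torsP n0; have [h1 h2 _] := indep_exact_ord n0 ind.
move=> Q nQ; have [k [l ->]] := indep_span torsP n0 ind nQ.
by rewrite !gal_ptD !gal_pt_mulrn !fixE.
Qed.
End PointField.

Theorem theorem1p26 (K : fieldExtType rat) (L : closedFieldType)
    (iota : {rmorphism K -> L}) (L_alg : integralRange iota)
    (E : weierstrass K) (E_elliptic : discriminant E != 0)
    (n : nat) (n_ge2 : (2 <= n)%N)
    (u : {poly {poly K}}) (u_deg1 : degree_one u)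
    (u_gen : generates_coord_ring E u)
    (transitive_action : forall P Q : ecpoint L,
       exact_order (map_weierstrass iota E) n P ->
       exact_order (map_weierstrass iota E) n Q ->
       exists s : abs_gal iota, map_point s P = Q) :
  (let f := if n == 2%N then psi2_sq E else prim_psi E n in
   irreducible_poly f /\
   galois_group_isog f (@coset_op (torsion (map_weierstrass iota E) n))
     (range (@rho_bar K L iota E n)))
  /\
  (forall P : ecpoint L, exact_order (map_weierstrass iota E) n P ->
   (* [F] is the field K(P), and (a, b) the point P, seen over [F]. *)
   forall (F : fieldExtType K) (j : {rmorphism F -> L}) (a b : F),
     (forall c : K, j c%:A = iota c) ->
     P = Some (j a, j b) ->
     <<<<1; a>>; b>>%VS = {:F}%VS ->
   let chi := mul_charpoly (eval_xy (in_alg F) u a b) in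
   irreducible_poly chi /\
   galois_group_isog chi (@comp_op (torsion (map_weierstrass iota E) n))
     (range (@rho K L iota E n))).
Proof.
have charL : [pchar L] =i pred0.
  move=> p; rewrite (fmorph_pchar (iota \o in_alg K)); exact: Num.Theory.pchar_num.
pose EL := map_weierstrass iota E.
have dL : discriminant EL != 0 by rewrite map_discriminant fmorph_eq0.
have smoothE := discriminant_smooth charL dL.
have [tors torsP] := tors_enum_exists charL smoothE.
have n0 : (0 < n)%N := ltnW n_ge2.
have trans (P Q : curve_point smoothE) : exact_ord n P -> exact_ord n Q ->
    exists s, gal_pt s P = Q.
  move=> eP eQ; have [||s es] := @transitive_action (pv P) (pv Q).
  - by apply/(exact_orderP smoothE _ n0); exists P.
  - by apply/(exact_orderP smoothE _ n0); exists Q.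
  by exists s; apply: pv_inj; rewrite pv_gal.
split; first split.
- exact: (abscissa_poly_irreducible charL torsP n_ge2 trans).
- exact: (abscissa_poly_galois L_alg charL torsP n_ge2 trans).
have [al [be [ga [_ eu]]]] := u_deg1; subst u.
move=> _ /(exact_orderP smoothE _ n0)[P [<- eP]] F j a b jE vP genF chi.
split; last exact: (value_charpoly_galois L_alg charL torsP u_gen n_ge2 trans jE eP vP genF).
apply: mul_charpoly_irreducible.
exact: (value_generates L_alg charL torsP u_gen n_ge2 trans jE eP vP genF).
Qed.
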